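(* Let $\tau$ be a structure. If $\tau$ is stably metrizable and Polish with preserved roots, then the associated local GH-type topologies on $\mathfrak{M}_\bullet(\tau)$ with preserved roots and with non-preserved roots coincide, and the resulting topology is Polish.
   Context: A bcm (boundedly-compact metric) space is a non-empty metric space in which every closed ball of finite radius is compact; a rooted bcm space $(X,\rho_X)$ is a bcm space $X$ with a distinguished point $\rho_X$. The metric of $X$ is denoted $d_X$, and $D_X(x,r)=\{y: d_X(x,y)\le r\}$. An isometric embedding is a distance-preserving map (not necessarily onto); an isometry is a bijective one; a map is root-preserving if it sends root to root. A topological embedding is a homeomorphism onto its image. Structure: a functor $\tau$ from the category of bcm spaces (morphisms: isometric embeddings) to the category of metrizable topological spaces (morphisms: topological embeddings). That is, to each bcm space $X$ it assigns a metrizable space $\tau(X)$ and to each isometric embedding $f\colon X\to Y$ a topological embedding $\tau_f\colon\tau(X)\to\tau(Y)$, with $\tau_{\mathrm{id}_X}=\mathrm{id}_{\tau(X)}$ and $\tau_{g\circ f}=\tau_g\circ\tau_f$. When $X$ is isometrically embedded into $Y$ by $f$, $\tau(X)$ is regarded as a subspace of $\tau(Y)$ via $\tau_f$. $\tau$ is continuous if all of the following hold. Embedding-continuity: if $f_n\colon X\to Y$, $n\in\mathbb{N}\cup\{\infty\}$, are isometric embeddings between bcm spaces with $f_n\to f_\infty$ uniformly on compact sets, then $\tau_{f_n}(a)\to\tau_{f_\infty}(a)$ for all $a\in\tau(X)$. Upper and lower semicontinuity: whenever bcm spaces $X_n$, $n\in\mathbb{N}\cup\{\infty\}$, are isometrically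 embedded into a common bcm space $Y$ so that $X_n\to X_\infty$ in the Fell topology as subsets of $Y$, (upper) if $a_n\in\tau(X_n)$ converge to some $a\in\tau(Y)$ then $a\in\tau(X_\infty)$; (lower) for every $a\in\tau(X_\infty)$ there are a subsequence $(n_k)$ and $a_k\in\tau(X_{n_k})$ with $a_k\to a$ in $\tau(Y)$. The Fell topology on closed subsets of $Y$ is generated by the sets $\{A: A\cap K=\emptyset\}$ ($K$ compact) and $\{A: A\cap U\ne\emptyset\}$ ($U$ open). Element-rooted metrization $\tau^{\mathrm{erm}}$: a choice, for each bcm space $X$, of a metric $d^{\tau^{\mathrm{erm}}}_{X}$ on $\tau(X)\times X$ inducing the product topology such that $\tau_f\times f$ is distance-preserving for every isometric embedding $f\colon X\to Y$. It is stable if there is $\Theta\colon[0,\infty)\to[0,\infty)$ with $\lim_{\varepsilon\to0}\Theta(\varepsilon)=\Theta(0)=0$ such that: for all bcm spaces $X,Y,M_1,M_2$, isometric embeddings $f_i\colon X\to M_i$, $g_i\colon Y\to M_i$ ($i=1,2$) and $\varepsilon\ge 0$ with $d_{M_2}(f_2(x),g_2(y))\le d_{M_1}(f_1(x),g_1(y))+\varepsilon$ for all $x\in X,y\in Y$, one has $$d^{\tau^{\mathrm{erm}}}_{M_2}\bigl((\tau_{f_2}(a),f_2(x)),(\tau_{g_2}(b),g_2(y))\bigr)\le d^{\tau^{\mathrm{erm}}}_{M_1}\bigl((\tau_{f_1}(a),f_1(x)),(\tau_{g_1}(b),g_1(y))\bigr)+\Theta(\varepsilon)$$ for all $(a,x)\in\tau(X)\times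 X$, $(b,y)\in\tau(Y)\times Y$. $\tau$ is stably metrizable if it admits a stable element-rooted metrization. Space-rooted metrization: a choice, for each rooted bcm space $(X,\rho_X)$, of a metric on $\tau(X)$ inducing the given topology, such that $\tau_f$ is distance-preserving for every root-preserving isometric embedding $f\colon(X,\rho_X)\to(Y,\rho_Y)$ (with respect to the metrics assigned to $(X,\rho_X)$ and $(Y,\rho_Y)$). It is complete if all these metrics are complete. $\tau$ is Polish with preserved roots if there exist another structure $\tilde\tau$, a topological embedding $\eta\colon\tau\Rightarrow\tilde\tau$ (a family of topological embeddings $\eta_X\colon\tau(X)\to\tilde\tau(X)$ with $\eta_Y\circ\tau_f=\tilde\tau_f\circ\eta_X$ for every isometric embedding $f\colon X\to Y$), and a sequence $(\tilde\tau_k)_{k\ge1}$, where each $\tilde\tau_k$ assigns to every rooted bcm space $(X,\rho_X)$ a subset $\tilde\tau_k(X,\rho_X)\subseteq\tilde\tau(X)$ with $\tilde\tau_f(\tilde\tau_k(X,\rho_X))\subseteq\tilde\tau_k(Y,\rho_Y)$ for every root-preserving isometric embedding $f\colon(X,\rho_X)\to(Y,\rho_Y)$, such that: (P1) $\tilde\tau$ is continuous and admits a complete space-rooted metrization; (P2) each $\tilde\tau_k(X,\rho_X)$ is open in $\tilde\tau(X)$, and $\tilde\tau_k$ is pullback-stable: $\tilde\tau_f^{-1}(\tilde\tau_k(Y,\rho_Y))=\tilde\tau_k(X,\rho_X)$ for every root-preserving isometric embedding $f\colon(X,\rho_X)\to(Y,\rho_Y)$; (P3) $\eta_X(\tau(X))=\bigcap_{k\ge1}\tilde\tau_k(X,\rho_X)$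 for every rooted bcm space $(X,\rho_X)$. Such a $\tau$ is automatically embedding-continuous. $\mathfrak{M}_\bullet(\tau)$: the set of (representatives of) equivalence classes of triples $(X,\rho_X,a_X)$, with $(X,\rho_X)$ a rooted bcm space and $a_X\in\tau(X)$, where $(X,\rho_X,a_X)\sim(Y,\rho_Y,a_Y)$ iff there is a root-preserving isometry $f\colon X\to Y$ with $\tau_f(a_X)=a_Y$. Hausdorff metric on compact subsets (including $\emptyset$) of a metric space $M$: $d^H_M(A,B)=\inf\{\varepsilon\ge0: A\subseteq B^\varepsilon, B\subseteq A^\varepsilon\}$, where $A^\varepsilon=\{x:\exists y\in A, d_M(x,y)\le\varepsilon\}$ and $\inf\emptyset=\infty$. For a bcm space $M$, closed $A,B\subseteq M$ and $x,y\in M$, $$d^F_{M}((A,x),(B,y))=d_M(x,y)\vee\int_0^\infty e^{-r}\bigl(1\wedge d^H_M(A\cap D_M(x,r),B\cap D_M(y,r))\bigr)dr,$$ and $d^F_{M,\rho}(A,B)=d^F_M((A,\rho),(B,\rho))$. The local GH-type topology with non-preserved roots is the topology on $\mathfrak{M}_\bullet(\tau)$ induced by the metric $$\check d(\mathcal{X},\mathcal{Y})=\inf_{f,g,Z}\bigl\{d^F_{Z}\bigl((f(X),f(\rho_X)),(g(Y),g(\rho_Y))\bigr)\vee d^{\tau^{\mathrm{erm}}}_{Z}\bigl((\tau_f(a_X),f(\rho_X)),(\tau_g(a_Y),g(\rho_Y))\bigr)\bigr\}$$ (infimum over bcm spaces $Z$ and isometric embeddings $f\colon X\to Z$, $g\colon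 Y\to Z$); the one with preserved roots is induced by the metric $$d(\mathcal{X},\mathcal{Y})=\inf_{f,g,Z}\bigl\{d^F_{Z,\rho_Z}(f(X),g(Y))\vee d^{\tau^{\mathrm{erm}}}_{Z}\bigl((\tau_f(a_X),\rho_Z),(\tau_g(a_Y),\rho_Z)\bigr)\bigr\}$$ (infimum over rooted bcm spaces $(Z,\rho_Z)$ and root-preserving isometric embeddings $f\colon X\to Z$, $g\colon Y\to Z$), where $\mathcal{X}=(X,\rho_X,a_X)$, $\mathcal{Y}=(Y,\rho_Y,a_Y)$. For embedding-continuous $\tau$ these are metrics, and the topologies do not depend on the choice of metrization.
   Formalization: In (P1), each space τ̃(X) is additionally assumed separable; without this the claim fails, e.g. for the constant structure τ(X)=D with D uncountable discrete, where 𝔐_•(τ) is not separable. *)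

(* Defs.v *)
From HB Require Import structures.
From mathcomp Require Import all_boot all_order all_algebra.
From mathcomp Require Import all_classical all_reals all_analysis.

Set Implicit Arguments.
Unset Strict Implicit.
Unset Printing Implicit Defensive.

Import Order.TTheory GRing.Theory Num.Theory.
Import numFieldNormedType.Exports.

Local Open Scope classical_set_scope.
Local Open Scope ring_scope.

(** * Metrics as plain functions

    Metrizations put metrics on spaces that already carry a topology, and the
    space of equivalence classes of marked spaces carries two candidate
    metrics, so metrics are handled as functions [d : T -> T -> R].  Subsets
    are written [T -> Prop], the unfolding of [set T], and countability as an
    injection into [nat], because the space of equivalence classes ranges over
    all metric spaces and lives in a universe too large for [set] (hence for
    [countable]). *)

Section plain_metrics.
Context {R : realType}.

Record is_metric (T : Type) (d : T -> T -> R) : Prop := IsMetric {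
  dist_ge0 : forall x y, 0 <= d x y ;
  dist_eq0 : forall x y, d x y = 0 <-> x = y ;
  dist_sym : forall x y, d x y = d y x ;
  dist_triangle : forall y x z, d x z <= d x y + d y z }.

Definition metric_open (T : Type) (d : T -> T -> R) (U : T -> Prop) : Prop :=
  forall x, U x -> exists2 e : R, 0 < e & forall y, d x y < e -> U y.

Definition metric_complete (T : Type) (d : T -> T -> R) : Prop :=
  forall u : nat -> T,
    (forall e : R, 0 < e -> \forall m & n \near \oo, d (u m) (u n) < e) ->
    exists l : T, forall e : R, 0 < e -> \forall n \near \oo, d (u n) l < e.

Definition induces (T : topologicalType) (d : T -> T -> R) : Prop :=
  is_metric d /\ forall U : set T, open U <-> metric_open d U.

(** [O] is the family of open sets of a separable, completely metrizable
    topology. *)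
Definition polish_topology (T : Type) (O : (T -> Prop) -> Prop) : Prop :=
  (exists D : T -> Prop,
     (exists c : T -> nat,
        forall x y, D x -> D y -> c x = c y -> x = y) /\
     (forall U, O U -> (exists x, U x) -> exists x, D x /\ U x)) /\
  exists d : T -> T -> R,
    [/\ is_metric d, metric_complete d & forall U, O U <-> metric_open d U].

End plain_metrics.

Definition metrizable (R : realType) (T : topologicalType) : Prop :=
  exists d : T -> T -> R, induces d.

Definition topological_embedding (S T : topologicalType) (f : S -> T) : Prop :=
  [/\ injective f, continuous f &
      forall U : set S, open U ->
        exists2 V : set T, open V & f @` U = V `&` range f].

(** * Fell topology on closed subsets *)

Definition closed_subset (Y : topologicalType) : Type := {A : set Y | closed A}.

Section fell_topology.
Context (Y : topologicalType).

HB.instance Definition _ := gen_eqMixin (closed_subset Y).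
HB.instance Definition _ := gen_choiceMixin (closed_subset Y).

Definition fell_subbase : set (set (closed_subset Y)) :=
  [set [set A | sval A `&` K = set0] | K in [set K : set Y | compact K]] `|`
  [set [set A | sval A `&` U !=set0] | U in [set U : set Y | open U]].

HB.instance Definition _ := @isSubBaseTopological.Build (closed_subset Y)
  (set (closed_subset Y)) fell_subbase id.

End fell_topology.

(** * Boundedly-compact metric spaces *)

Definition Dball (R : realType) (M : metricType R) (x : M) (r : R) : set M :=
  [set y | mdist x y <= r].

Record bcm (R : realType) := Bcm {
  bcm_space :> metricType R ;
  bcm_nonempty : [set: bcm_space] !=set0 ;
  bcm_compact : forall (x : bcm_space) (r : R), compact (Dball x r) }.

Record rbcm (R : realType) := Rbcm {
  rbcm_space :> bcm R ;
  root : rbcm_space }.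

Record isoemb (R : realType) (X Y : bcm R) := Isoemb {
  isoemb_fun :> X -> Y ;
  isoembP : forall x x', mdist (isoemb_fun x) (isoemb_fun x') = mdist x x' }.

Section bcm_category.
Context {R : realType}.

Definition id_emb (X : bcm R) : isoemb X X :=
  @Isoemb R X X id (fun _ _ => erefl).

Lemma comp_emb_subproof (X Y Z : bcm R) (g : isoemb Y Z) (f : isoemb X Y) x x' :
  mdist ((g \o f) x) ((g \o f) x') = mdist x x'.
Proof. by rewrite /= !isoembP. Qed.

Definition comp_emb (X Y Z : bcm R) (g : isoemb Y Z) (f : isoemb X Y) :
  isoemb X Z := Isoemb (comp_emb_subproof g f).

Definition root_preserving (X Y : rbcm R) (f : isoemb X Y) : Prop :=
  f (root X) = root Y.

Lemma isoemb_continuous (X Y : bcm R) (f : isoemb X Y) : continuous f.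
Proof.
move=> x A; rewrite -nbhs_ballE => -[e e0]; rewrite ballEmdist => sA.
rewrite -nbhs_ballE; exists e => //; rewrite ballEmdist => y /= xy.
by apply: sA => /=; rewrite isoembP.
Qed.

Lemma isoemb_range_closed (X Y : bcm R) (f : isoemb X Y) : closed (range f).
Proof.
move=> y cly; have [x0 _] := bcm_nonempty X.
pose r := mdist (f x0) y + 1.
have cK : closed (f @` Dball x0 r).
  apply: compact_closed; first exact: metric_hausdorff.
  apply: continuous_compact; last exact: bcm_compact.
  exact/continuous_subspaceT/isoemb_continuous.
suff [x _ <-] : (f @` Dball x0 r) y by exists x.
apply: cK => B yB.
have yb1 : nbhs y (ball y (1 : R)) by exact: nbhsx_ballx.
have [_ [[x _ <-]] [Bfx]] := cly _ (filterI yB yb1).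
rewrite ballEmdist /= => yfx; exists (f x); split => //; exists x => //.
rewrite /Dball /= -(isoembP f) (le_trans (metric_triangle _ y _)) //.
by rewrite lerD2l ltW.
Qed.

Definition closed_image (X Y : bcm R) (f : isoemb X Y) : closed_subset Y :=
  exist _ (range f) (isoemb_range_closed (f := f)).

End bcm_category.

(** * Structures *)

Record gh_structure (R : realType) := GhStructure {
  gh_obj :> bcm R -> topologicalType ;
  gh_map : forall X Y : bcm R, isoemb X Y -> gh_obj X -> gh_obj Y ;
  gh_metrizable : forall X : bcm R, metrizable R (gh_obj X) ;
  gh_embedding : forall (X Y : bcm R) (f : isoemb X Y),
    topological_embedding (gh_map f) ;
  gh_id : forall (X : bcm R) (a : gh_obj X), gh_map (id_emb X) a = a ;
  gh_comp : forall (X Y Z : bcm R) (g : isoemb Y Z) (f : isoemb X Y)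
    (a : gh_obj X), gh_map (comp_emb g f) a = gh_map g (gh_map f a) }.

Section structures.
Context {R : realType}.
Implicit Type tau : gh_structure R.

Definition embedding_continuous tau : Prop :=
  forall (X Y : bcm R) (f_ : nat -> isoemb X Y) (f : isoemb X Y),
    {family compact, (fun n => f_ n : X -> Y) @ \oo --> (f : X -> Y)} ->
    forall a : tau X, gh_map (f_ n) a @[n --> \oo] --> gh_map f a.

Definition upper_semicontinuous tau : Prop :=
  forall (Y X : bcm R) (X_ : nat -> bcm R)
    (f_ : forall n, isoemb (X_ n) Y) (f : isoemb X Y),
    closed_image (f_ n) @[n --> \oo] --> closed_image f ->
    forall (a_ : forall n, tau (X_ n)) (a : tau Y),
      gh_map (f_ n) (a_ n) @[n --> \oo] --> a ->
      exists b : tau X, gh_map f b = a.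

Definition lower_semicontinuous tau : Prop :=
  forall (Y X : bcm R) (X_ : nat -> bcm R)
    (f_ : forall n, isoemb (X_ n) Y) (f : isoemb X Y),
    closed_image (f_ n) @[n --> \oo] --> closed_image f ->
    forall a : tau X,
      exists (n_ : nat -> nat) (a_ : forall k, tau (X_ (n_ k))),
        {homo n_ : i j / (i < j)%N} /\
        gh_map (f_ (n_ k)) (a_ k) @[k --> \oo] --> gh_map f a.

Definition continuous_structure tau : Prop :=
  [/\ embedding_continuous tau, upper_semicontinuous tau &
      lower_semicontinuous tau].

(** ** Metrizations *)

Record erm tau := Erm {
  erm_dist : forall X : bcm R, (tau X * X)%type -> (tau X * X)%type -> R ;
  erm_induces : forall X : bcm R, induces (erm_dist (X := X)) ;
  erm_map : forall (X Y : bcm R) (f : isoemb X Y) (a b : tau X) (x y : X),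
    erm_dist (gh_map f a, f x) (gh_map f b, f y) = erm_dist (a, x) (b, y) }.

Definition stable_erm tau (E : erm tau) : Prop :=
  exists Theta : R -> R,
    [/\ forall e, 0 <= e -> 0 <= Theta e,
        Theta 0 = 0,
        Theta e @[e --> 0^'+] --> (0 : R) &
        forall (X Y M1 M2 : bcm R) (f1 : isoemb X M1) (f2 : isoemb X M2)
          (g1 : isoemb Y M1) (g2 : isoemb Y M2) (e : R), 0 <= e ->
          (forall (x : X) (y : Y),
             mdist (f2 x) (g2 y) <= mdist (f1 x) (g1 y) + e) ->
          forall (a : tau X) (x : X) (b : tau Y) (y : Y),
            erm_dist E (gh_map f2 a, f2 x) (gh_map g2 b, g2 y) <=
            erm_dist E (gh_map f1 a, f1 x) (gh_map g1 b, g1 y) + Theta e].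

Definition stably_metrizable tau : Prop := exists E : erm tau, stable_erm E.

Record srm tau := Srm {
  srm_dist : forall X : rbcm R, tau X -> tau X -> R ;
  srm_induces : forall X : rbcm R, induces (srm_dist (X := X)) ;
  srm_map : forall (X Y : rbcm R) (f : isoemb X Y), root_preserving f ->
    forall a b : tau X,
      srm_dist (X := Y) (gh_map f a) (gh_map f b) = srm_dist (X := X) a b }.

Definition complete_srm tau (S : srm tau) : Prop :=
  forall X : rbcm R, metric_complete (srm_dist S (X := X)).

(** ** Polish structures *)

Record structure_embedding tau tau' := StructureEmbedding {
  se_map :> forall X : bcm R, tau X -> tau' X ;
  se_embedding : forall X : bcm R, topological_embedding (se_map (X := X)) ;
  se_natural : forall (X Y : bcm R) (f : isoemb X Y) (a : tau X),
    se_map (gh_map f a) = gh_map f (se_map a) }.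

Arguments se_map {tau tau'} _ X _ : rename.

Record rooted_substructure tau := RootedSubstructure {
  rs_set :> forall X : rbcm R, set (tau X) ;
  rs_map : forall (X Y : rbcm R) (f : isoemb X Y), root_preserving f ->
    gh_map f @` @rs_set X `<=` @rs_set Y }.

Arguments rs_set {tau} _ X _ : rename.

Definition open_substructure tau (s : rooted_substructure tau) : Prop :=
  forall X : rbcm R, open (s X).

Definition pullback_stable tau (s : rooted_substructure tau) : Prop :=
  forall (X Y : rbcm R) (f : isoemb X Y), root_preserving f ->
    gh_map f @^-1` s Y = s X.

Definition separable_structure tau : Prop :=
  forall X : bcm R, exists2 D : set (tau X), countable D & dense D.

(** Separability of [tau'] cannot be dropped: on a constant structure whose
    value is an uncountable discrete space, continuity, completeness and stable
    metrizability all hold, but the space of classes is not separable. *)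
Definition polish_preserved_roots tau : Prop :=
  exists (tau' : gh_structure R) (eta : structure_embedding tau tau')
    (tau_ : nat -> rooted_substructure tau'),
    [/\ [/\ continuous_structure tau', separable_structure tau' &
            exists S : srm tau', complete_srm S],
        forall k, open_substructure (tau_ k) /\ pullback_stable (tau_ k) &
        forall X : rbcm R, range (eta X) = \bigcap_k tau_ k X].

(** * Equivalence classes of rooted spaces carrying an element of [tau] *)

Record marked tau := Marked {
  mk_space :> rbcm R ;
  mk_elt : tau mk_space }.

Definition marked_equiv tau (t u : marked tau) : Prop :=
  exists f : isoemb t u,
    [/\ bijective f, root_preserving f & gh_map f (mk_elt t) = mk_elt u].

Definition Mbullet tau : Type :=
  {C : marked tau -> Prop | exists t, C = marked_equiv t}.

Definition Mrepr tau (C : Mbullet tau) : marked tau :=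
  projT1 (cid (proj2_sig C)).

End structures.

(** * Gromov-Hausdorff-type distances *)

Section distances.
Context {R : realType}.

Definition fattening (M : metricType R) (A : set M) (e : R) : set M :=
  [set x | exists2 y, A y & mdist x y <= e].

Definition hausdorff_dist (M : metricType R) (A B : set M) : \bar R :=
  ereal_inf [set e%:E | e in [set e : R |
    [/\ 0 <= e, A `<=` fattening B e & B `<=` fattening A e]]].

(** The integrand is at most [expR (- r)], so the integral is finite and
    [fine] loses nothing. *)
Definition dF (M : metricType R) (p q : (set M * M)%type) : R :=
  Num.max (mdist p.2 q.2)
    (fine (\int[lebesgue_measure]_(r in `[0%R, +oo[)
       ((expR (- r))%:E *
        mine 1 (hausdorff_dist (p.1 `&` Dball p.2 r)
                               (q.1 `&` Dball q.2 r))))%E).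

Variables (tau : gh_structure R) (E : erm tau).

Definition pre_dist_nonpreserved (s t : marked tau) : R :=
  inf [set v | exists (Z : bcm R) (f : isoemb s Z) (g : isoemb t Z),
    v = Num.max
      (dF (range f, f (root s)) (range g, g (root t)))
      (erm_dist E (gh_map f (mk_elt s), f (root s))
                  (gh_map g (mk_elt t), g (root t)))].

Definition pre_dist_preserved (s t : marked tau) : R :=
  inf [set v | exists (Z : rbcm R) (f : isoemb s Z) (g : isoemb t Z),
    [/\ root_preserving f, root_preserving g &
     v = Num.max
      (dF (range f, root Z) (range g, root Z))
      (erm_dist E (gh_map f (mk_elt s), root Z)
                  (gh_map g (mk_elt t), root Z))]].

Definition dist_nonpreserved (C D : Mbullet tau) : R :=
  pre_dist_nonpreserved (Mrepr C) (Mrepr D).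

Definition dist_preserved (C D : Mbullet tau) : R :=
  pre_dist_preserved (Mrepr C) (Mrepr D).

Definition open_nonpreserved : (Mbullet tau -> Prop) -> Prop :=
  metric_open dist_nonpreserved.

Definition open_preserved : (Mbullet tau -> Prop) -> Prop :=
  metric_open dist_preserved.

End distances.

(* Main.v *)
(* A triple converges to another one, in either topology, if and only if all
   the spaces embed isometrically into one boundedly compact space in which the
   images converge in the Fell topology and the elements of [tau] converge; the
   common space is obtained by gluing the spaces realizing the distances along
   the limit.  Stability of an element-rooted metrization makes it possible to
   move the roots onto each other at a small cost, so that the roots can be
   assumed to coincide in the common space; hence the two topologies agree and
   do not depend on the metrization.

   On the triples of the continuous structure [tau'], the complete space-rooted
   metrization yields another metric for this convergence.  It is complete: the
   spaces of a fast Cauchy sequence are glued into a chain, the completion of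
   which contains the limit space, and upper semicontinuity puts the limit of
   the elements into it.  It is separable by lower semicontinuity, since each
   space is a limit of spaces taken from a countable list.  Finally the triples
   of [tau] form a G-delta subspace of the triples of [tau']. *)
Require Import Defs.
From HB Require Import structures.
From mathcomp Require Import all_boot all_order all_algebra.
From mathcomp Require Import all_classical all_reals all_analysis.
From mathcomp Require Import measurable_realfun.
From mathcomp Require Import ring lra zify.

Set Implicit Arguments.
Unset Strict Implicit.
Unset Printing Implicit Defensive.

Import Order.TTheory GRing.Theory Num.Theory.
Import numFieldNormedType.Exports.

Local Open Scope classical_set_scope.
Local Open Scope ring_scope.

(** * Completion of a pseudometric space *)

(** Each term of a sequence comes with its own common space, and values taken in different spaces
    have to be compared. A metrization sees only cross distances: two pairs of embeddings with the
    same cross distances factor through one minimal span ([span_universal]), hence give the same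
    value ([erm_transport], [srm_transport]). Most constructions therefore act on a [coupling], a
    function of two points that can be chained, glued or altered before a space realizing it is
    built.

    The obstacle is bounded compactness of what is glued. A chain has infinitely many levels, and
    its completion is boundedly compact once every ball is, up to any [e], approximated by finitely
    many of them ([chain_compact]). This is why closeness of spaces is measured by [near_pts], where
    one parameter gives both the precision and the inverse radius. The integral [dF] is used only
    through its comparison with [near_pts], in [dF_close] and [dF_small]. *)

Record pseudometric (R : realType) (T : Type) := Pseudometric {
  pmdist :> T -> T -> R ;
  pmdistxx : forall x, pmdist x x = 0 ;
  pmdist_sym : forall x y, pmdist x y = pmdist y x ;
  pmdist_triangle : forall y x z, pmdist x z <= pmdist x y + pmdist y z }.

Section completion.
Context {R : realType} {T : Type}.
Implicit Type p : pseudometric R T.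

Lemma pmdist_lip p x y z : `|p x z - p y z| <= p x y.
Proof.
have h1 := pmdist_triangle p y x z; have h2 := pmdist_triangle p x y z.
by rewrite (pmdist_sym p y x) in h2; rewrite ler_norml; apply/andP; split; lra.
Qed.

(* A point of the completion is encoded by its distance function to the points
   of [T]; this yields the Hausdorff quotient and the completion at once. *)
Definition completion p : Type :=
  {h : T -> R | forall e : R, 0 < e -> exists t, forall u, `|h u - p t u| <= e}.

Definition completion_dist p (h k : completion p) : R :=
  sup [set `|sval h u - sval k u| | u in [set: T]].

Variable p : pseudometric R T.
Implicit Types h k : completion p.

Lemma completion_has_sup h k :
  has_sup [set `|sval h u - sval k u| | u in [set: T]].
Proof.
have [t ht] := svalP h _ ltr01; have [s ks] := svalP k _ ltr01.
split; first by exists (`|sval h t - sval k t|); exists t.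
exists (2 + p t s) => _ [u _ <-].
have := pmdist_lip p t s u; have := ht u; have := ks u.
by rewrite !ler_norml => /andP[? ?] /andP[? ?] /andP[? ?]; apply/andP; split; lra.
Qed.

Lemma completion_dist_ub h k u : `|sval h u - sval k u| <= completion_dist h k.
Proof. by apply: ub_le_sup; [case: (completion_has_sup h k)|exists u]. Qed.

Lemma completion_dist_le h k c :
  (forall u, `|sval h u - sval k u| <= c) -> completion_dist h k <= c.
Proof.
move=> hc; apply: ge_sup; first by case: (completion_has_sup h k).
by move=> _ [u _ <-].
Qed.

Lemma completion_distxx h : completion_dist h h = 0.
Proof.
apply/eqP; rewrite eq_le; apply/andP; split.
  by apply: completion_dist_le => u; rewrite subrr normr0.
have [t _] := svalP h _ ltr01.
exact: le_trans (completion_dist_ub h h t).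
Qed.

Lemma completion_dist_sym h k : completion_dist h k = completion_dist k h.
Proof. by congr sup; apply: eq_imagel => u _; rewrite distrC. Qed.

Lemma completion_dist_triangle k h l :
  completion_dist h l <= completion_dist h k + completion_dist k l.
Proof.
apply: completion_dist_le => u; rewrite (le_trans (ler_distD (sval k u) _ _))//.
by rewrite lerD// completion_dist_ub.
Qed.

Lemma completion_dist_eq0 h k : completion_dist h k = 0 -> h = k.
Proof.
move=> hk; apply: eq_sig_hprop => [f|]; first exact: Prop_irrelevance.
apply/funext => u.
have := completion_dist_ub h k u; rewrite hk normr_le0 subr_eq0.
by move/eqP.
Qed.

HB.instance Definition _ := gen_eqMixin (completion p).
HB.instance Definition _ := gen_choiceMixin (completion p).
HB.instance Definition _ := @isMetric.Build R (completion p)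
  (@completion_dist p) completion_distxx completion_dist_eq0
  completion_dist_sym completion_dist_triangle.

Lemma completion_pt_subproof t e :
  0 < e -> exists s, forall u, `|p t u - p s u| <= e.
Proof. by move=> /ltW e0; exists t => u; rewrite subrr normr0. Qed.

Definition completion_pt t : completion p :=
  exist _ (p t) (completion_pt_subproof t).

(** Evaluating the supremum at [t], where [p t] vanishes, gives one bound; the other is the triangle
    inequality for some [p s] uniformly close to [h]. *)
Lemma completion_pt_dist t h : mdist h (completion_pt t) = sval h t.
Proof.
apply/eqP; rewrite eq_le; apply/andP; split.
  apply: completion_dist_le => u /=; apply/ler_addgt0Pr => e e0.
  have e20 : 0 < e / 2 by rewrite divr_gt0.
  have [s hs] := svalP h _ e20; have := pmdist_lip p s t u.
  have := hs t; have := hs u.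
  rewrite !ler_norml => /andP[? ?] /andP[? ?] /andP[? ?].
  by apply/andP; split; lra.
have := completion_dist_ub h (completion_pt t) t.
by rewrite /= pmdistxx subr0; apply: le_trans; exact: ler_norm.
Qed.

Lemma completion_pt_isom s t : mdist (completion_pt s) (completion_pt t) = p s t.
Proof. by rewrite completion_pt_dist. Qed.

Lemma completion_pt_dense h e :
  0 < e -> exists t, mdist h (completion_pt t) <= e.
Proof.
move=> e0; have [t ht] := svalP h _ e0; exists t.
rewrite completion_pt_dist; have := ht t; rewrite pmdistxx subr0.
by apply: le_trans; exact: ler_norm.
Qed.

Lemma completion_complete (F : set_system (completion p)) : ProperFilter F ->
  (forall e : R, 0 < e -> exists h, F [set k | mdist h k <= e]) ->
  exists h : completion p, F --> h.
Proof.
move=> FF Fc.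
(* The limit is the pointwise infimum of the upper bounds [h u + e] over the closed balls that
   belong to the filter; any two such balls meet, so each of them also bounds the limit from
   below. *)
pose S u : set R :=
  [set v | exists (e : R) h, [/\ 0 < e, F [set k | mdist h k <= e] & v = sval h u + e]].
have close h k e e' : F [set l | mdist h l <= e] -> F [set l | mdist k l <= e'] ->
    forall u, `|sval h u - sval k u| <= e + e'.
  move=> Fh Fk u; have [l [/= hl kl]] := filter_ex (filterI Fh Fk).
  rewrite (le_trans (completion_dist_ub h k u))//.
  by rewrite (le_trans (metric_triangle h l k))// (metric_sym l) lerD.
have S0 u : S u !=set0.
  by have [h Fh] := Fc _ ltr01; exists (sval h u + 1); exists 1, h.
have S_lb u : has_lbound (S u).
  have [h Fh] := Fc _ ltr01; exists (sval h u - 1) => _ [e [k [e0 Fk ->]]].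
  by have := close _ _ _ _ Fh Fk u; rewrite ler_norml => /andP[? ?]; lra.
pose l u := inf (S u).
have lP h (e : R) : 0 < e -> F [set k | mdist h k <= e] ->
    forall u, `|l u - sval h u| <= e.
  move=> e0 Fh u.
  have : sval h u - e <= l u.
    apply: lb_le_inf => // _ [e' [k [e'0 Fk ->]]].
    by have := close _ _ _ _ Fh Fk u; rewrite ler_norml => /andP[? ?]; lra.
  have : l u <= sval h u + e by apply: ge_inf => //; exists e, h.
  by rewrite ler_norml => ? ?; apply/andP; split; lra.
have lrep (e : R) : 0 < e -> exists t, forall u, `|l u - p t u| <= e.
  move=> e0; have e20 : 0 < e / 2 by rewrite divr_gt0.
  have [h Fh] := Fc _ e20; have [t ht] := svalP h _ e20; exists t => u.
  have := lP _ _ e20 Fh u; have := ht u.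
  by rewrite !ler_norml => /andP[? ?] /andP[? ?]; apply/andP; split; lra.
exists (exist _ l lrep : completion p).
apply/metricType_numDomainType.fcvgrPdist_lt => e e0.
have e30 : 0 < e / 3 by rewrite divr_gt0.
have [h Fh] := Fc _ e30.
apply: filterS (Fh) => k /= hk.
have lh : mdist (exist _ l lrep : completion p) h <= e / 3.
  by apply: completion_dist_le => u /=; exact: lP Fh u.
by rewrite (le_lt_trans (metric_triangle _ h _))//; lra.
Qed.

End completion.

(** An ultrafilter on the ball is pushed into [K] by [pi] and clusters there at some [z]; being
    ultra, it contains the points whose image is near [z]. It is thus Cauchy, and completeness
    supplies the limit. *)
Lemma compact_Dball_approx (R : realType) (M : metricType R) (x : M) (r : R) :
  (forall F : set_system M, ProperFilter F ->
     (forall e : R, 0 < e -> exists h, F [set k | mdist h k <= e]) ->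
     exists h : M, F --> h) ->
  (forall e : R, 0 < e -> exists2 K : set M, compact K &
     forall y, mdist x y <= r -> exists2 z, K z & mdist z y <= e) ->
  compact (Dball x r).
Proof.
move=> Mc Kc; rewrite compact_ultra => F UF FD.
have [|l Fl] := Mc F _.
  move=> e e0; have e30 : 0 < e / 3 by rewrite divr_gt0.
  have [K cK DK] := Kc _ e30.
  have /choice[pi piP] : forall y, exists z,
      mdist x y <= r -> K z /\ mdist z y <= e / 3.
    move=> y; have [/DK[z Kz zy]|xy] := pselect (mdist x y <= r); first by exists z.
    by exists x => /xy.
  have FK : F (pi @^-1` K) by apply: filterS (FD) => y /piP[].
  have [z [Kz clz]] := cK (pi @ F) _ FK.
  exists z; have [Fz|Fz] := in_ultra_setVsetC [set y | mdist z (pi y) < e / 3] UF.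
    apply: filterS (filterI FD Fz) => y [/piP[_ py] /= zpy].
    by rewrite (le_trans (metric_triangle z (pi y) y))//; lra.
  have zb : nbhs z (ball z (e / 3)) by exact: nbhsx_ballx.
  have pF : F (pi @^-1` [set w | ~ mdist z w < e / 3]) by [].
  by have [w [/= ? ]] := clz _ _ pF zb; rewrite ballEmdist.
exists l; split => //; rewrite /Dball/=; apply/ler_addgt0Pr => /= e e0.
have Fe : F [set y | mdist l y < e].
  by move/metricType_numDomainType.fcvgrPdist_lt : Fl; apply.
have [y [/= xy ly]] := filter_ex (filterI FD Fe).
by rewrite (le_trans (metric_triangle x y l))// (metric_sym y) lerD// ltW.
Qed.

(** * Infima of real functions *)

Section inf_fun.
Context {R : realType}.

Definition inf_fun (T : Type) (g : T -> R) : R := inf [set g t | t in [set: T]].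

Lemma inf_fun_le (T : Type) (g : T -> R) t : (forall t, 0 <= g t) -> inf_fun g <= g t.
Proof. by move=> g0; apply: ge_inf; [exists 0 => _ [s _ <-]|exists t]. Qed.

Lemma le_inf_fun (T : Type) (t : T) (g : T -> R) a :
  (forall t, a <= g t) -> a <= inf_fun g.
Proof. by move=> ag; apply: lb_le_inf; [exists (g t), t|move=> _ [s _ <-]]. Qed.

Lemma le_inf_funD (S T : Type) (s : S) (t : T) (g : S -> R) (h : T -> R) a :
  (forall s t, a <= g s + h t) -> a <= inf_fun g + inf_fun h.
Proof.
move=> agh; rewrite -lerBlDr; apply: (le_inf_fun s) => s'.
by rewrite lerBlDr -lerBlDl; apply: (le_inf_fun t) => t'; rewrite lerBlDl.
Qed.

End inf_fun.

(** * Couplings and chains of metric spaces *)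

(** Cross distances that extend the two metrics to a pseudometric on the disjoint union: the axioms
    are the triangle inequalities involving both spaces. The value 0 is allowed and identifies
    points. *)
Record coupling (R : realType) (X Y : metricType R) := Coupling {
  cpl :> X -> Y -> R ;
  cpl_lipl : forall x' x y, cpl x y <= mdist x x' + cpl x' y ;
  cpl_lipr : forall y' x y, cpl x y <= cpl x y' + mdist y' y ;
  cpl_distl : forall y x x', mdist x x' <= cpl x y + cpl x' y ;
  cpl_distr : forall x y y', mdist y y' <= cpl x y + cpl x y' }.

Lemma cpl_ge0 (R : realType) (X Y : metricType R) (c : coupling X Y) x y : 0 <= c x y.
Proof. by have := cpl_distl c y x x; rewrite mdistxx; lra. Qed.

Section chain.
Context {R : realType} {X_ : nat -> bcm R}.
Variable c_ : forall n, coupling (X_ n) (X_ n.+1).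

(** The value 0 for distinct indices is a dummy: [chain_up x y] is meaningful for [n <= m] only,
    where it is the infimum of the lengths of the paths climbing from [x] to [y] one level at a
    time. *)
Definition level_dist n (x : X_ n) m (y : X_ m) : R :=
  match @eqP _ n m with
  | ReflectT e => mdist (eq_rect n (fun i => X_ i : Type) x m e) y
  | ReflectF _ => 0
  end.

Lemma level_distE n (x y : X_ n) : level_dist x y = mdist x y.
Proof. by rewrite /level_dist; case: eqP => // e; rewrite (eq_irrelevance e erefl). Qed.

Fixpoint chain_up n (x : X_ n) m : X_ m -> R :=
  match m with
  | 0 => level_dist x (m := 0)
  | m'.+1 => fun y => if (n <= m')%N
      then inf_fun (fun z : X_ m' => chain_up x z + c_ m' z y)
      else level_dist x y
  end.

Lemma chain_upxx n (x y : X_ n) : chain_up x y = mdist x y.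
Proof. by case: n x y => [|n] x y /=; rewrite ?ltnn level_distE. Qed.

Lemma chain_upS n m (x : X_ n) (y : X_ m.+1) : (n <= m)%N ->
  chain_up x y = inf_fun (fun z : X_ m => chain_up x z + c_ m z y).
Proof. by move=> /= ->. Qed.

Lemma chain_up_ge0 n m (x : X_ n) (y : X_ m) : 0 <= chain_up x y.
Proof.
have ld k (z : X_ k) : 0 <= level_dist x z.
  by rewrite /level_dist; case: eqP => // e; exact: mdist_ge0.
elim: m y => [|m IH] y //=; case: ifP => // _.
have [z _] := bcm_nonempty (X_ m); apply: (le_inf_fun z) => z'.
by rewrite addr_ge0// cpl_ge0.
Qed.

Lemma chain_upS_le n m (x : X_ n) (z : X_ m) (y : X_ m.+1) : (n <= m)%N ->
  chain_up x y <= chain_up x z + c_ m z y.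
Proof.
move=> nm; rewrite chain_upS//.
apply: (inf_fun_le (g := fun z : X_ m => chain_up x z + c_ m z y)) => t.
by rewrite addr_ge0// ?cpl_ge0// chain_up_ge0.
Qed.

Lemma chain_up_lip n m (x : X_ n) (y y' : X_ m) : (n <= m)%N ->
  chain_up x y <= chain_up x y' + mdist y' y.
Proof.
case: m y y' => [|m] y y'; rewrite leq_eqVlt => /orP[/eqP nm|].
- by subst n; rewrite !chain_upxx metric_triangle.
- by [].
- by subst n; rewrite !chain_upxx metric_triangle.
rewrite ltnS => nm; rewrite -lerBlDr (chain_upS x y')//.
have [z _] := bcm_nonempty (X_ m); apply: (le_inf_fun z) => z'.
rewrite lerBlDr -addrA; apply: le_trans (chain_upS_le x z' y nm) _.
by rewrite lerD2l cpl_lipr.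
Qed.

Lemma chain_up_dist n m (x : X_ n) (y y' : X_ m) : (n <= m)%N ->
  mdist y y' <= chain_up x y + chain_up x y'.
Proof.
elim: m y y' => [|m IH] y y'; rewrite leq_eqVlt => /orP[/eqP nm|].
- by subst n; rewrite !chain_upxx (metric_sym x y) metric_triangle.
- by [].
- by subst n; rewrite !chain_upxx (metric_sym x y) metric_triangle.
rewrite ltnS => nm; rewrite !chain_upS//.
have [z _] := bcm_nonempty (X_ m); apply: (le_inf_funD z z) => w w'.
have := IH w w' nm; have := cpl_distr (c_ m) w y y'.
by have := cpl_lipl (c_ m) w' w y'; lra.
Qed.

Lemma chain_up_trans n m k (x : X_ n) (y : X_ m) (z : X_ k) :
  (n <= m)%N -> (m <= k)%N -> chain_up x z <= chain_up x y + chain_up y z.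
Proof.
move=> nm; elim: k z => [|k IH] z; rewrite leq_eqVlt => /orP[/eqP mk|].
- by subst m; rewrite (chain_upxx y) chain_up_lip.
- by [].
- by subst m; rewrite (chain_upxx y) chain_up_lip.
rewrite ltnS => mk; rewrite (chain_upS y)// -lerBlDl.
have [w _] := bcm_nonempty (X_ k); apply: (le_inf_fun w) => w'.
rewrite lerBlDl addrA; apply: le_trans (chain_upS_le x w' z (leq_trans nm mk)) _.
by rewrite lerD2r IH.
Qed.

(** Here the intermediate point lies above both ends. It is lowered one level at a time; [cpl_distl]
    bounds the gap between the two points of the lower level from which [y] is reached. *)
Lemma chain_up_back n m k (x : X_ n) (y : X_ m) (z : X_ k) :
  (n <= k)%N -> (k <= m)%N -> chain_up x z <= chain_up x y + chain_up z y.
Proof.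
move=> nk; elim: m y => [|m IH] y; rewrite leq_eqVlt => /orP[/eqP km|].
- by subst k; rewrite (chain_upxx z) (metric_sym z) chain_up_lip.
- by [].
- by subst k; rewrite (chain_upxx z) (metric_sym z) chain_up_lip.
rewrite ltnS => km; rewrite (chain_upS z)// (chain_upS x) ?(leq_trans nk)//.
have [w _] := bcm_nonempty (X_ m); apply: (le_inf_funD w w) => v v'.
have := IH v km; have := chain_up_lip z v' v km.
have := cpl_distl (c_ m) y v v'; have := chain_up_lip z v v' km.
by rewrite (metric_sym v'); lra.
Qed.

(** Here the intermediate point lies below both ends: [chain_up_dist] settles the case of ends on
    the same level, and the upper end is then raised. *)
Lemma chain_up_fork n m k (x : X_ n) (y : X_ m) (z : X_ k) :
  (m <= n)%N -> (n <= k)%N -> chain_up x z <= chain_up y x + chain_up y z.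
Proof.
move=> mn; elim: k z => [|k IH] z; rewrite leq_eqVlt => /orP[/eqP nk|].
- by subst n; rewrite (chain_upxx x) chain_up_dist.
- by [].
- by subst n; rewrite (chain_upxx x) chain_up_dist.
rewrite ltnS => nk; rewrite (chain_upS y) ?(leq_trans mn)// -lerBlDl.
have [w _] := bcm_nonempty (X_ k); apply: (le_inf_fun w) => w'.
rewrite lerBlDl addrA; apply: le_trans (chain_upS_le x w' z nk) _.
by rewrite lerD2r IH.
Qed.

Definition chain_fun (u v : {n & X_ n}) : R :=
  if (tag u <= tag v)%N then chain_up (tagged u) (tagged v)
  else chain_up (tagged v) (tagged u).

Lemma chain_funE n m (x : X_ n) (y : X_ m) : (n <= m)%N ->
  chain_fun (existT _ n x) (existT _ m y) = chain_up x y.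
Proof. by rewrite /chain_fun /= => ->. Qed.

Lemma chain_funC u v : chain_fun u v = chain_fun v u.
Proof.
case: u v => n x [m y]; rewrite /chain_fun /=.
case: ltngtP => // nm; subst m.
by rewrite !chain_upxx metric_sym.
Qed.

Lemma chain_funxx u : chain_fun u u = 0.
Proof. by case: u => n x; rewrite chain_funE// chain_upxx mdistxx. Qed.

Lemma chain_fun_triangle v u w : chain_fun u w <= chain_fun u v + chain_fun v w.
Proof.
wlog uw : u w / (tag u <= tag w)%N.
  have /orP[uw|wu] := leq_total (tag u) (tag w) => [/(_ u w uw)//|/(_ w u wu)].
  by rewrite (chain_funC w u) (chain_funC w v) (chain_funC v u) addrC.
case: u v w uw => n x [m y] [k z] /= nk.
have [nm|/ltnW mn] := leqP n m; last first.
  rewrite (chain_funC (existT _ n x) (existT _ m y)).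
  by rewrite !chain_funE ?chain_up_fork// (leq_trans mn).
have [mk|/ltnW km] := leqP m k; first by rewrite !chain_funE// chain_up_trans.
rewrite (chain_funC (existT _ m y)) !chain_funE//; exact: chain_up_back.
Qed.

Definition chain_dist : pseudometric R {n & X_ n} :=
  Pseudometric chain_funxx chain_funC chain_fun_triangle.

Definition chain_space : metricType R := completion chain_dist.

Definition chain_pt n (x : X_ n) : chain_space :=
  completion_pt chain_dist (existT _ n x).

Lemma chain_pt_isom n (x y : X_ n) : mdist (chain_pt x) (chain_pt y) = mdist x y.
Proof. by rewrite completion_pt_isom /= chain_funE// chain_upxx. Qed.

Lemma chain_pt_cpl n (x : X_ n) (y : X_ n.+1) :
  mdist (chain_pt x) (chain_pt y) = c_ n x y.
Proof.
rewrite completion_pt_isom /= chain_funE// chain_upS//.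
apply/eqP; rewrite eq_le; apply/andP; split.
  apply: le_trans (inf_fun_le x _) _ => [t|].
    by rewrite addr_ge0 ?cpl_ge0 ?chain_up_ge0.
  by rewrite chain_upxx mdistxx add0r.
by apply: (le_inf_fun x) => z; rewrite chain_upxx cpl_lipl.
Qed.

Lemma chain_pt_dense (h : chain_space) (e : R) : 0 < e ->
  exists n (x : X_ n), mdist h (chain_pt x) <= e.
Proof. by move=> /(completion_pt_dense h)[[n x] hx]; exists n, x. Qed.

End chain.

(** * Isometric embeddings and closed subspaces *)

Lemma isom_continuous (R : realType) (M N : metricType R) (f : M -> N) :
  (forall x y, mdist (f x) (f y) = mdist x y) -> continuous f.
Proof.
move=> fP x; apply/metricType_numDomainType.cvgrPdist_lt => e e0.
apply/metricType_numDomainType.nbhs_mdistP; exists e => // y /=.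
by rewrite fP.
Qed.

Lemma isoemb_inj (R : realType) (X Y : bcm R) (f : isoemb X Y) : injective f.
Proof. by move=> x y fxy; apply: mdist_positivity; rewrite -(isoembP f) fxy mdistxx. Qed.

Lemma isoemb_ext (R : realType) (X Y : bcm R) (f g : isoemb X Y) : f =1 g -> f = g.
Proof.
case: f g => f fP [g gP] /= /funext fg; subst g.
by congr Isoemb; exact: Prop_irrelevance.
Qed.

Section sub_bcm.
Context {R : realType} {Z : bcm R} (A : set Z).

Definition sub_space : Type := {z : Z | A z}.

Definition sub_dist (x y : sub_space) : R := mdist (sval x) (sval y).

Lemma sub_distxx x : sub_dist x x = 0. Proof. exact: mdistxx. Qed.

Lemma sub_dist_sym x y : sub_dist x y = sub_dist y x. Proof. exact: metric_sym. Qed.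

Lemma sub_dist_triangle y x z : sub_dist x z <= sub_dist x y + sub_dist y z.
Proof. exact: metric_triangle. Qed.

Lemma sub_dist_eq0 x y : sub_dist x y = 0 -> x = y.
Proof.
move/mdist_positivity => xy; apply: eq_sig_hprop => // z; exact: Prop_irrelevance.
Qed.

HB.instance Definition _ := gen_eqMixin sub_space.
HB.instance Definition _ := gen_choiceMixin sub_space.
HB.instance Definition _ := @isMetric.Build R sub_space
  sub_dist sub_distxx sub_dist_eq0 sub_dist_sym sub_dist_triangle.

Hypotheses (A0 : A !=set0) (cA : closed A).

Lemma sub_nonempty : [set: sub_space] !=set0.
Proof. by have [z Az] := A0; exists (exist _ z Az). Qed.

Lemma sub_compact (x : sub_space) (r : R) : compact (Dball x r).
Proof.
move=> F FF FD; pose i (y : sub_space) : Z := sval y.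
have iF : F (i @^-1` Dball (i x) r) by apply: filterS (FD) => y.
have [z [Dz clz]] := bcm_compact (fmap_proper_filter i FF) iF.
have Az : A z.
  apply: cA => B Bz; have iA : F (i @^-1` A) by apply: filterS FD => y _; exact: svalP.
  by have [w []] := clz _ _ iA Bz; exists w.
exists (exist _ z Az : sub_space); split=> // B C FB.
move=> /metricType_numDomainType.nbhs_mdistP[e /= e0 eC].
have iB : F (i @^-1` (i @` B)) by apply: filterS FB => y By; exists y.
have zb : nbhs z (ball z e) by exact: nbhsx_ballx.
have [w [[y By <-]]] := clz _ _ iB zb; rewrite ballEmdist /= => zy.
by exists y; split => //; exact: eC.
Qed.

Definition sub_bcm : bcm R := Bcm sub_nonempty sub_compact.

Definition sub_incl : isoemb sub_bcm Z :=
  @Isoemb R sub_bcm Z (fun x => sval x) (fun _ _ => erefl).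

End sub_bcm.

Section chain_bcm.
Context {R : realType} {X_ : nat -> bcm R}.
Variable c_ : forall n, coupling (X_ n) (X_ n.+1).

(** Each level is boundedly compact, so finitely many levels contribute a compact set near a ball,
    and the hypothesis makes this set approximate the ball. *)
Lemma chain_compact n0 (x0 : X_ n0) :
  (forall r e : R, 0 < e -> exists N, forall n (x : X_ n),
     mdist (chain_pt c_ x0) (chain_pt c_ x) <= r ->
     exists m (y : X_ m),
       (m <= N)%N /\ mdist (chain_pt c_ y) (chain_pt c_ x) <= e) ->
  forall (h : chain_space c_) (r : R), compact (Dball h r).
Proof.
move=> tb h r; apply: compact_Dball_approx => [F|e e0]; first exact: completion_complete.
have e20 : 0 < e / 2 by rewrite divr_gt0.
pose r' := mdist (chain_pt c_ x0) h + r + e / 2.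
have [N NP] := tb r' _ e20.
pose b n : X_ n := projT1 (cid (bcm_nonempty (X_ n))).
(* The radius around [b n] is large enough to reach every point of the level within [r' + e / 2] of
   [x0], wherever [b n] lies. *)
pose K := \bigcup_(n in `I_N.+1) (@chain_pt R X_ c_ n @`
  Dball (b n) (mdist (chain_pt c_ (b n)) (chain_pt c_ x0) + (r' + e / 2))).
exists K.
  rewrite /K bigcup_mkord; apply: big_ind => [||n _].
  - exact: compact0.
  - exact: compactU.
  apply: continuous_compact; last exact: bcm_compact.
  by apply: continuous_subspaceT; apply: isom_continuous; exact: chain_pt_isom.
move=> k hk; have [n [x kx]] := chain_pt_dense k e20.
have x0x : mdist (chain_pt c_ x0) (chain_pt c_ x) <= r'.
  have := metric_triangle (chain_pt c_ x0) h (chain_pt c_ x).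
  by have := metric_triangle h k (chain_pt c_ x); rewrite /r'; lra.
have [m [y [mN yx]]] := NP _ _ x0x.
exists (chain_pt c_ y).
  exists m => //; exists y => //; rewrite /Dball /= -(chain_pt_isom c_).
  rewrite (le_trans (metric_triangle _ (chain_pt c_ x0) _))// lerD2l//.
  have := metric_triangle (chain_pt c_ x0) (chain_pt c_ x) (chain_pt c_ y).
  by rewrite (metric_sym (chain_pt c_ x)); lra.
have := metric_triangle (chain_pt c_ y) (chain_pt c_ x) k.
by rewrite (metric_sym (chain_pt c_ x) k); lra.
Qed.

Lemma chain_bcm_ex n0 (x0 : X_ n0) :
  (forall r e : R, 0 < e -> exists N, forall n (x : X_ n),
     mdist (chain_pt c_ x0) (chain_pt c_ x) <= r ->
     exists m (y : X_ m),
       (m <= N)%N /\ mdist (chain_pt c_ y) (chain_pt c_ x) <= e) ->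
  exists (Z : bcm R) (f_ : forall n, isoemb (X_ n) Z),
    forall n (x : X_ n) (y : X_ n.+1), mdist (f_ n x) (f_ n.+1 y) = c_ n x y.
Proof.
move=> /chain_compact cZ.
have Z0 : [set: chain_space c_] !=set0 by exists (chain_pt c_ x0).
exists (Bcm Z0 cZ).
exists (fun n => @Isoemb R (X_ n) (Bcm Z0 cZ) _ (@chain_pt_isom R X_ c_ n)).
by move=> n x y /=; exact: chain_pt_cpl.
Qed.

End chain_bcm.

(** * Gluing boundedly compact spaces *)

Section couplings.
Context {R : realType}.

Section emb_coupling.
Context {X Y Z : bcm R} (f : isoemb X Z) (g : isoemb Y Z).
Let c (x : X) (y : Y) : R := mdist (f x) (g y).

Lemma emb_lipl x' x y : c x y <= mdist x x' + c x' y.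
Proof. by rewrite -(isoembP f) metric_triangle. Qed.

Lemma emb_lipr y' x y : c x y <= c x y' + mdist y' y.
Proof. by rewrite -(isoembP g) metric_triangle. Qed.

Lemma emb_distl y x x' : mdist x x' <= c x y + c x' y.
Proof. by rewrite -(isoembP f) /c (metric_sym (f x')) metric_triangle. Qed.

Lemma emb_distr x y y' : mdist y y' <= c x y + c x y'.
Proof. by rewrite -(isoembP g) /c (metric_sym (f x) (g y)) metric_triangle. Qed.

Definition emb_coupling : coupling X Y :=
  Coupling emb_lipl emb_lipr emb_distl emb_distr.

End emb_coupling.

Definition id_coupling (X : bcm R) : coupling X X :=
  emb_coupling (id_emb X) (id_emb X).

Section glue_coupling.
Context {X Z W : bcm R} (f : isoemb X Z) (g : isoemb X W).
Let c (z : Z) (w : W) : R := inf_fun (fun x => mdist z (f x) + mdist (g x) w).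
Let x0 : X := projT1 (cid (bcm_nonempty X)).

Let c_le x z w : c z w <= mdist z (f x) + mdist (g x) w.
Proof.
apply: (inf_fun_le (g := fun x => mdist z (f x) + mdist (g x) w)) => t.
by rewrite addr_ge0// mdist_ge0.
Qed.

Lemma glue_lipl z' z w : c z w <= mdist z z' + c z' w.
Proof.
rewrite -lerBlDl; apply: (le_inf_fun x0) => x; rewrite lerBlDl.
by rewrite (le_trans (c_le x z w))// addrA lerD2r metric_triangle.
Qed.

Lemma glue_lipr w' z w : c z w <= c z w' + mdist w' w.
Proof.
rewrite -lerBlDr; apply: (le_inf_fun x0) => x; rewrite lerBlDr.
by rewrite (le_trans (c_le x z w))// -addrA lerD2l metric_triangle.
Qed.

Lemma glue_distl w z z' : mdist z z' <= c z w + c z' w.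
Proof.
apply: (le_inf_funD x0 x0) => x x'.
have := metric_triangle z (f x) z'; have := metric_triangle (f x) (f x') z'.
have := metric_triangle (g x) w (g x').
by rewrite !isoembP (metric_sym (f x') z') (metric_sym w); lra.
Qed.

Lemma glue_distr z w w' : mdist w w' <= c z w + c z w'.
Proof.
apply: (le_inf_funD x0 x0) => x x'.
have := metric_triangle w (g x) w'; have := metric_triangle (g x) (g x') w'.
have := metric_triangle (f x) z (f x').
by rewrite !isoembP (metric_sym w (g x)) (metric_sym (f x) z); lra.
Qed.

(** Amalgamation along [X]: every way from [Z] to [W] crosses at a point of [X], so [f x] and [g x]
    coincide after gluing. *)
Definition glue_coupling : coupling Z W :=
  Coupling glue_lipl glue_lipr glue_distl glue_distr.

Lemma glue_couplingE x : glue_coupling (f x) (g x) = 0.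
Proof.
apply/eqP; rewrite eq_le cpl_ge0 andbT.
by rewrite (le_trans (c_le x _ _))// !mdistxx addr0.
Qed.

End glue_coupling.

(** A chain is infinite, so this one continues with copies of [W] joined by [id_coupling]. The
    copies of a point are at distance 0, hence equal, and three levels suffice for compactness. *)
Lemma chain3 (X Y W : bcm R) (c : coupling X Y) (c' : coupling Y W) :
  exists (Z : bcm R) (f : isoemb X Z) (g : isoemb Y Z) (h : isoemb W Z),
    (forall x y, mdist (f x) (g y) = c x y) /\
    (forall y w, mdist (g y) (h w) = c' y w).
Proof.
pose N n : bcm R := match n with 0 => X | 1 => Y | _ => W end.
pose d n : coupling (N n) (N n.+1) :=
  match n with 0 => c | 1 => c' | _ => id_coupling W end.
have [x0 _] := bcm_nonempty X.
have [|Z [f_ fP]] := @chain_bcm_ex R N d 0 x0.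
  move=> r e e0; exists 2 => n x _.
  have [n2|n2] := leqP n 2; first by exists n, x; rewrite mdistxx ltW.
  suff [y yx] : exists y : N 2, chain_pt d y = chain_pt d x.
    by exists 2, y; rewrite yx mdistxx ltW.
  elim: n n2 x => // n IH; rewrite ltnS leq_eqVlt => /orP[/eqP n2|n2].
    subst n => x; exists x; apply: mdist_positivity.
    by rewrite (chain_pt_cpl d (n := 2)) /= mdistxx.
  case: n IH n2 => // -[//|n] IH n2 x; have [y yx] := IH n2 x.
  exists y; rewrite yx; apply: mdist_positivity.
  by rewrite (chain_pt_cpl d (n := n.+2)) /= mdistxx.
exists Z, (f_ 0), (f_ 1), (f_ 2); split => [x y|y w].
  exact: (fP 0 x y).
exact: (fP 1 y w).
Qed.

(* The disjoint union of [X] and [Y] with cross distances given by [c], up to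
   points at distance 0. *)
Record coupling_span (X Y : bcm R) (c : coupling X Y) := CouplingSpan {
  span_space : bcm R ;
  span_l : isoemb X span_space ;
  span_r : isoemb Y span_space ;
  span_cpl : forall x y, mdist (span_l x) (span_r y) = c x y ;
  span_cover : forall z, (exists x, span_l x = z) \/ (exists y, span_r y = z) }.

Lemma coupling_span_ex (X Y : bcm R) (c : coupling X Y) :
  exists s : coupling_span c, True.
Proof.
have [Z [f [g [_ [fgP _]]]]] := chain3 c (id_coupling Y).
pose A : set Z := range f `|` range g.
have A0 : A !=set0 by have [x _] := bcm_nonempty X; exists (f x); left; exists x.
have cA : closed A by apply: closedU; exact: isoemb_range_closed.
have Af x : A (f x) by left; exists x.
have Ag y : A (g y) by right; exists y.
pose W := sub_bcm A0 cA.
pose f' : isoemb X W := @Isoemb R X W (fun x => exist _ (f x) (Af x)) (isoembP f).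
pose g' : isoemb Y W := @Isoemb R Y W (fun y => exist _ (g y) (Ag y)) (isoembP g).
unshelve eexists (@CouplingSpan X Y c W f' g' fgP _) => //.
move=> [z Az]; have [[x _ xz]|[y _ yz]] := Az; [left; exists x|right; exists y];
  by apply: eq_sig_hprop => // t; exact: Prop_irrelevance.
Qed.

Definition the_span (X Y : bcm R) (c : coupling X Y) : coupling_span c :=
  projT1 (cid (coupling_span_ex c)).

(** By [span_cover] the factorization is forced. It is well defined because points identified in the
    span have cross distance 0, hence are identified in [M] too. *)
Lemma span_universal (X Y M : bcm R) (c : coupling X Y) (s : coupling_span c)
    (f : isoemb X M) (g : isoemb Y M) :
  (forall x y, mdist (f x) (g y) = c x y) ->
  exists h : isoemb (span_space s) M,
    comp_emb h (span_l s) = f /\ comp_emb h (span_r s) = g.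
Proof.
move=> fgP.
have /choice[h hP] : forall z : span_space s, exists m : M,
    (forall x, span_l s x = z -> m = f x) /\ (forall y, span_r s y = z -> m = g y).
  move=> z; have [[x xz]|[y yz]] := span_cover z.
    exists (f x); split => [x' x'z|y' y'z].
      by have -> : x = x' by apply: (isoemb_inj (f := span_l s)); rewrite xz.
    by apply: mdist_positivity; rewrite fgP -(span_cpl s) xz y'z mdistxx.
  exists (g y); split => [x' x'z|y' y'z].
    by apply: mdist_positivity; rewrite metric_sym fgP -(span_cpl s) yz x'z mdistxx.
  by have -> : y = y' by apply: (isoemb_inj (f := span_r s)); rewrite yz.
have hl x : h (span_l s x) = f x by exact: (hP _).1.
have hr y : h (span_r s y) = g y by exact: (hP _).2.
have hisom z z' : mdist (h z) (h z') = mdist z z'.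
  have [[x <-]|[y <-]] := span_cover z; have [[x' <-]|[y' <-]] := span_cover z';
    rewrite ?hl ?hr ?isoembP// ?fgP ?span_cpl//.
  by rewrite metric_sym fgP -(span_cpl s) metric_sym.
by exists (Isoemb hisom); split; apply: isoemb_ext => x /=.
Qed.

(** Both pairs factor through the same span, and [erm_map] carries the metric of the span to [M] and
    to [M']. *)
Lemma erm_transport (tau : gh_structure R) (E : erm tau) (X Y M M' : bcm R)
    (f : isoemb X M) (g : isoemb Y M) (f' : isoemb X M') (g' : isoemb Y M')
    (a : tau X) (b : tau Y) (x : X) (y : Y) :
  (forall x y, mdist (f x) (g y) = mdist (f' x) (g' y)) ->
  erm_dist E (gh_map f a, f x) (gh_map g b, g y) =
  erm_dist E (gh_map f' a, f' x) (gh_map g' b, g' y).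
Proof.
move=> fg; pose s := the_span (emb_coupling f g).
have [h [hf hg]] := @span_universal X Y M _ s f g (fun _ _ => erefl).
have [h' [hf' hg']] := @span_universal X Y M' _ s f' g' (fun x y => esym (fg x y)).
have -> : gh_map f a = gh_map h (gh_map (span_l s) a) by rewrite -gh_comp hf.
have -> : gh_map g b = gh_map h (gh_map (span_r s) b) by rewrite -gh_comp hg.
have -> : gh_map f' a = gh_map h' (gh_map (span_l s) a) by rewrite -gh_comp hf'.
have -> : gh_map g' b = gh_map h' (gh_map (span_r s) b) by rewrite -gh_comp hg'.
have -> : f x = h (span_l s x) by exact: esym (congr1 (fun k : isoemb _ _ => k x) hf).
have -> : g y = h (span_r s y) by exact: esym (congr1 (fun k : isoemb _ _ => k y) hg).
have -> : f' x = h' (span_l s x) by exact: esym (congr1 (fun k : isoemb _ _ => k x) hf').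
have -> : g' y = h' (span_r s y) by exact: esym (congr1 (fun k : isoemb _ _ => k y) hg').
by rewrite !erm_map.
Qed.

Lemma srm_transport (tau : gh_structure R) (S : srm tau) (X Y M M' : rbcm R)
    (f : isoemb X M) (g : isoemb Y M) (f' : isoemb X M') (g' : isoemb Y M')
    (a : tau X) (b : tau Y) :
  root_preserving f -> root_preserving g ->
  root_preserving f' -> root_preserving g' ->
  (forall x y, mdist (f x) (g y) = mdist (f' x) (g' y)) ->
  srm_dist S (X := M) (gh_map f a) (gh_map g b) =
  srm_dist S (X := M') (gh_map f' a) (gh_map g' b).
Proof.
move=> rf rg rf' rg' fg; pose s := the_span (emb_coupling f g).
have [h [hf hg]] := @span_universal X Y M _ s f g (fun _ _ => erefl).
have [h' [hf' hg']] := @span_universal X Y M' _ s f' g' (fun x y => esym (fg x y)).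
have -> : gh_map f a = gh_map h (gh_map (span_l s) a) by rewrite -gh_comp hf.
have -> : gh_map g b = gh_map h (gh_map (span_r s) b) by rewrite -gh_comp hg.
have -> : gh_map f' a = gh_map h' (gh_map (span_l s) a) by rewrite -gh_comp hf'.
have -> : gh_map g' b = gh_map h' (gh_map (span_r s) b) by rewrite -gh_comp hg'.
pose W := Rbcm (span_l s (Defs.root X)).
have rh : @root_preserving R W M h.
  exact: etrans (congr1 (fun k : isoemb X M => k (Defs.root X)) hf) rf.
have rh' : @root_preserving R W M' h'.
  exact: etrans (congr1 (fun k : isoemb X M' => k (Defs.root X)) hf') rf'.
by rewrite (srm_map S rh) (srm_map S rh').
Qed.

(** A point of one ball may be matched by any point of the other space, inside or outside the
    corresponding ball; this avoids the jumps that occur when a ball is cut at its border. *)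
Definition near_pts (X Y : metricType R) (x0 : X) (y0 : Y) (c : X -> Y -> R)
    (e : R) : Prop :=
  (forall x, mdist x0 x <= e^-1 -> exists y, c x y <= e) /\
  (forall y, mdist y0 y <= e^-1 -> exists x, c x y <= e).

Lemma near_pts_le (X Y : metricType R) (x0 : X) (y0 : Y) c (e e' : R) :
  0 < e -> e <= e' -> near_pts x0 y0 c e -> near_pts x0 y0 c e'.
Proof.
move=> e0 ee' [h1 h2]; have ee : e'^-1 <= e^-1 by rewrite lef_pV2// posrE (lt_le_trans e0).
split=> [x hx|y hy].
  by have [|y cy] := h1 x; [exact: le_trans ee|exists y; exact: le_trans ee'].
by have [|x cx] := h2 y; [exact: le_trans ee|exists x; exact: le_trans ee'].
Qed.

(** The spans of [X_ n] and [X] are chained along their copies of [X], which become a single copy.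
    In a given ball all late levels are close to this copy, which already lies in level 0; this
    bounds the levels that compactness has to consider. *)
Lemma common_space (X : bcm R) (X_ : nat -> bcm R) (c_ : forall n, coupling (X_ n) X)
    (x0 : X) (x_ : forall n, X_ n) :
  (forall e : R, 0 < e -> \forall n \near \oo, near_pts (x_ n) x0 (c_ n) e) ->
  (forall e : R, 0 < e -> \forall n \near \oo, c_ n (x_ n) x0 <= e) ->
  exists (Z : bcm R) (f_ : forall n, isoemb (X_ n) Z) (f : isoemb X Z),
    forall n x y, mdist (f_ n x) (f y) = c_ n x y.
Proof.
move=> nearc rootc; pose s n := the_span (c_ n).
pose d n := glue_coupling (span_r (s n)) (span_r (s n.+1)).
have copies n x : chain_pt d (span_r (s n) x) = chain_pt d (span_r (s 0) x).
  elim: n => // n <-; apply: mdist_positivity.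
  by rewrite metric_sym chain_pt_cpl glue_couplingE.
have [|Z [F FP]] := @chain_bcm_ex R _ d 0 (span_r (s 0) x0).
  (* The radius [e'^-1] has to be at least [r + 1], because passing from the root of [X] to that of
     [X_ n] costs up to 1. *)
  move=> r e e0; pose e' := Num.min e (`|r| + 1)^-1.
  have r1 : 0 < `|r| + 1 by rewrite ltr_wpDl.
  have e'0 : 0 < e' by rewrite /e' lt_min e0 invr_gt0.
  have er : r + 1 <= e'^-1.
    apply: (@le_trans _ _ (`|r| + 1)); first by rewrite lerD2r ler_norm.
    by rewrite -[leLHS]invrK lef_pV2 ?posrE ?invr_gt0// /e' ge_min lexx orbT.
  have [N _ NP] := nearc _ e'0; have [N' _ N'P] := rootc _ ltr01.
  exists (maxn N N') => n z x0z.
  have [nN|] := leqP n (maxn N N'); first by exists n, z; rewrite mdistxx ltW.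
  rewrite gtn_max => /andP[/ltnW nN /ltnW nN'].
  have [[x xz]|[y yz]] := span_cover z; last first.
    by exists 0%N, (span_r (s 0) y); rewrite -(copies n) yz mdistxx ltW.
  have x0x : mdist (x_ n) x <= e'^-1.
    rewrite -(isoembP (span_l (s n))) (le_trans _ er)//.
    rewrite (le_trans (metric_triangle _ (span_r (s n) x0) _))// addrC lerD//.
      by rewrite xz -(chain_pt_isom d) copies.
    by rewrite span_cpl; exact: N'P.
  have [y cxy] := (NP _ nN).1 x x0x.
  exists 0%N, (span_r (s 0) y); split=> //; rewrite -(copies n) chain_pt_isom -xz.
  by rewrite metric_sym span_cpl (le_trans cxy)// /e' ge_min lexx.
have Fcopies n x : F n (span_r (s n) x) = F 0%N (span_r (s 0) x).
  elim: n => // n <-; apply: mdist_positivity.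
  by rewrite metric_sym FP glue_couplingE.
exists Z, (fun n => comp_emb (F n) (span_l (s n))), (comp_emb (F 0%N) (span_r (s 0))).
by move=> n x y /=; rewrite -(Fcopies n) isoembP span_cpl.
Qed.

End couplings.

(** * The Fell distance *)

Section integrals.
Context {R : realType}.

(* The integrand of [dF] is not known to be measurable; the integral of a
   nonnegative function is a supremum over simple functions, hence monotone
   without measurability. *)
Lemma ge0_le_integral_nonmeas d (T : measurableType d)
    (mu : {measure set T -> \bar R}) (D : set T) (f g : T -> \bar R) :
  (forall x, D x -> (0 <= f x)%E) -> (forall x, D x -> (f x <= g x)%E) ->
  (\int[mu]_(x in D) f x <= \int[mu]_(x in D) g x)%E.
Proof.
move=> f0 fg.
have g0 x : D x -> (0 <= g x)%E by move=> Dx; exact: le_trans (f0 _ Dx) (fg _ Dx).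
rewrite !ge0_integralE//; apply: ereal_sup_le => _ [h /= hf <-]; exists h => //= x.
apply: le_trans (hf x) _; rewrite /patch; case: ifPn => // /set_mem Dx.
exact: fg.
Qed.

Let mu := @lebesgue_measure R.
Let D : set R := `[0, +oo[.

Lemma integral_expRM (k : R) : 0 < k ->
  (\int[mu]_(x in D) (k%:E * (expR (- k * x))%:E))%E = 1%E.
Proof.
move=> k0; rewrite -(integral_exponential_pdf k0) integral_mkcond.
apply: eq_integral => x _; rewrite /exponential_pdf /patch -EFinM.
by case: ifP.
Qed.

Lemma measurable_expRM (k : R) : measurable_fun D (fun x : R => (expR (- k * x))%:E).
Proof.
apply/measurable_EFinP; exact: measurableT_comp.
Qed.

Lemma integral_expRM' (c k : R) : 0 <= c -> 0 < k ->
  (\int[mu]_(x in D) (c%:E * (expR (- k * x))%:E))%E = (c / k)%:E.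
Proof.
move=> c0 k0; rewrite ge0_integralZl_EFin//; [|exact: measurable_itv|exact: measurable_expRM].
suff -> : (\int[mu]_(x in D) (expR (- k * x))%:E = (k^-1)%:E)%E by [].
have := integral_expRM k0.
rewrite ge0_integralZl_EFin ?(ltW k0)//; [|exact: measurable_itv|exact: measurable_expRM].
have : (0 <= \int[mu]_(x in D) (expR (- k * x))%:E)%E.
  by apply: integral_ge0 => x _; rewrite lee_fin expR_ge0.
case: (\int[mu]_(x in D) _)%E => [r _| |//].
  rewrite -EFinM => -[kr]; congr EFin; apply: (mulfI (lt0r_neq0 k0)).
  by rewrite kr divff ?lt0r_neq0.
by rewrite gt0_muley ?lte_fin// => _ [].
Qed.

End integrals.

(** Without a finite net, the sets of points far from finite subsets generate a proper filter on
    [K]; a cluster point [z] contradicts its member [far [:: z]]. *)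
Lemma compact_net (R : realType) (M : metricType R) (K : set M) (e : R) :
  compact K -> 0 < e ->
  exists s : seq M, (forall z, z \in s -> K z) /\
    forall x, K x -> exists2 z, z \in s & mdist z x < e.
Proof.
move=> cK e0; apply: contrapT => nonet.
pose far (s : seq M) := K `&` [set x | forall z, z \in s -> e <= mdist z x].
pose F := filter_from [set s : seq M | forall z, z \in s -> K z] far.
have FF : ProperFilter F.
  apply: filter_from_proper; last first.
    move=> s sK; apply: contrapT => /set0P/negP/negPn/eqP s0; apply: nonet; exists s.
    split => // x Kx; apply: contrapT => xs.
    suff : far s x by rewrite s0.
    by split => // z zs; rewrite leNgt; apply/negP => zx; apply: xs; exists z.
  apply: filter_from_filter; first by exists [::].
  move=> s t sK tK; exists (s ++ t) => /=.
    by move=> z; rewrite mem_cat => /orP[/sK|/tK].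
  by move=> x [Kx xst]; split; split=> // z zs; apply: xst; rewrite mem_cat zs ?orbT.
have FK : F K by exists [::] => // x [].
have [z [Kz clz]] := cK F FF FK.
have Fz : F (far [:: z]).
  by exists [:: z] => // y; rewrite inE => /eqP ->.
have [x [[_ /(_ z)]]] := clz _ _ Fz (nbhsx_ballx z e e0).
by rewrite ballEmdist /= inE eqxx => /(_ isT); rewrite leNgt => /negP.
Qed.

Section fell_distance.
Context {R : realType} {M : metricType R}.
Implicit Types (A B : set M) (x y : M).
Let D : set R := `[0, +oo[.

Let integrand A x B y (r : R) : \bar R :=
  ((expR (- r))%:E * mine 1 (hausdorff_dist (A `&` Dball x r) (B `&` Dball y r)))%E.

Lemma hausdorff_dist_ge0 A B : (0 <= hausdorff_dist A B)%E.
Proof. by apply: le_ereal_inf_tmp => _ [e [e0 _ _] <-]; rewrite lee_fin. Qed.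

Let min_ge0 A B : (0 <= mine 1 (hausdorff_dist A B))%E.
Proof. by rewrite le_min lee01 hausdorff_dist_ge0. Qed.

Let integrand_ge0 A x B y r : (0 <= integrand A x B y r)%E.
Proof. by rewrite mule_ge0// lee_fin expR_ge0. Qed.

Let integrand_le A x B y r : (integrand A x B y r <= (expR (- r))%:E)%E.
Proof.
rewrite -[leRHS]mule1 lee_wpmul2l ?lee_fin ?expR_ge0//.
by rewrite ge_min lexx.
Qed.

Let fin_int A x B y : (\int[lebesgue_measure]_(r in D) integrand A x B y r)%E \is a fin_num.
Proof.
rewrite ge0_fin_numE; last by apply: integral_ge0 => r _; exact: integrand_ge0.
apply: (@le_lt_trans _ _ 1%E); last exact: ltry.
rewrite -(@integral_expRM R 1)//; apply: ge0_le_integral_nonmeas => r _.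
  exact: integrand_ge0.
by rewrite mul1e mulN1r.
Qed.

Lemma dF_ge0 A x B y : 0 <= dF (A, x) (B, y).
Proof. by rewrite le_max mdist_ge0. Qed.

Lemma dF_sym A x B y : dF (A, x) (B, y) = dF (B, y) (A, x).
Proof.
rewrite /dF /= (metric_sym x y); congr (Num.max _ (fine _)).
apply: eq_integral => r _; congr (_ * mine 1 _)%E; congr ereal_inf.
by congr image; apply/seteqP; split => e /= [? ? ?].
Qed.

(** If the Hausdorff distance were at least [e] at every radius [r >= e^-1], the unit interval from
    [e^-1] to [e^-1 + 1] alone would contribute [e * expR (- (e^-1 + 1))] to the integral. *)
Lemma dF_close A x B y (e : R) : 0 < e -> e <= 1 ->
  dF (A, x) (B, y) < e * expR (- (e^-1 + 1)) ->
  forall a, A a -> mdist x a <= e^-1 -> exists2 b, B b & mdist a b <= e.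
Proof.
move=> e0 e1; rewrite gt_max => /andP[_ dF_lt].
set k := e * _ in dF_lt; have k0 : 0 < k by rewrite mulr_gt0// expR_gt0.
have ei0 : 0 < e^-1 by rewrite invr_gt0.
suff [r re he] : exists2 r, e^-1 <= r &
    (hausdorff_dist (A `&` Dball x r) (B `&` Dball y r) < e%:E)%E.
  have [_ [e' [e'0 AB _] <-]] := ereal_inf_lt he; rewrite lte_fin => e'e a Aa xa.
  have [|b [Bb _] ab] := AB a; first by split => //; exact: le_trans re.
  by exists b => //; rewrite (le_trans ab)// ltW.
apply: contrapT => hge.
have {}hge r : e^-1 <= r ->
    (e%:E <= hausdorff_dist (A `&` Dball x r) (B `&` Dball y r))%E.
  by move=> er; rewrite leNgt; apply/negP => he; apply: hge; exists r.
pose I : set R := `[e^-1, e^-1 + 1]%classic.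
suff : (k%:E <= \int[lebesgue_measure]_(r in D) integrand A x B y r)%E.
  by rewrite -(fineK (fin_int A x B y)) lee_fin leNgt dF_lt.
apply: (@le_trans _ _ (\int[lebesgue_measure]_(r in D) (k%:E * (\1_I r)%:E))%E).
  rewrite ge0_integralZl_EFin ?(ltW k0)//; last 2 first.
  - exact: measurable_itv.
  - by apply/measurable_EFinP; apply: measurable_indic; exact: measurable_itv.
  rewrite integral_indic; [|exact: measurable_itv..].
  rewrite (_ : I `&` D = I); last first.
    apply/seteqP; split => r /=; rewrite /I /D /= !in_itv/= ?andbT; first by case.
    by move=> rI; split=> //; case/andP: rI => /(le_trans (ltW ei0)).
  have muI : lebesgue_measure I = 1%E.
    rewrite /I lebesgue_measure_itv /= lte_fin ltrDl ltr01 -EFinB.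
    by rewrite (addrC e^-1) addrK.
  suff : (k%:E <= k%:E * lebesgue_measure I)%E by [].
  by rewrite muI mule1.
apply: ge0_le_integral_nonmeas => r Dr.
  by rewrite -EFinM lee_fin mulr_ge0// ltW.
rewrite indicE; case: (boolP (r \in I)) => [/set_mem|_]; last first.
  by rewrite mule0; exact: integrand_ge0.
rewrite /I /= in_itv /= => /andP[er re].
rewrite mule1 /integrand /k mulrC EFinM lee_pmul ?lee_fin ?expR_ge0 ?(ltW e0)//.
  by rewrite ler_expR lerN2.
by rewrite le_min lee_fin e1 hge.
Qed.

(* The ball of radius [r] cuts the [c]-cell of [A] around [z] at its border only
   if [r] is close to this radius.  Finitely many cells suffice in a compact
   ball, so the exceptional [r] form a set of small measure. *)
Definition entry_radius A x (c : R) (z : M) : R :=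
  inf [set mdist x q | q in [set q | A q /\ mdist z q < c]].

(** The point [a] bounds the entry radius by [r + e], so when [r] is more than [e] away from it,
    [r - e] still exceeds it: the cell has a point well inside the ball. *)
Lemma entry_radius_shift A x (c e r : R) z a : 0 <= e ->
  ~ (entry_radius A x c z - e <= r <= entry_radius A x c z + e) ->
  A a -> mdist z a < c -> mdist x a <= r + e ->
  exists q, [/\ A q, mdist x q <= r - e & mdist a q <= c *+ 2].
Proof.
move=> e0 nr Aa za xa; set m := entry_radius A x c z in nr.
have ma : m <= mdist x a.
  by apply: ge_inf; [exists 0 => _ [q _ <-]; exact: mdist_ge0|exists a].
have mr : m < r - e.
  by rewrite ltNge; apply/negP => mr; apply: nr; apply/andP; split; lra.
have [|_ [q [Aq zq] <-] xq] := inf_lt _ mr; first by exists (mdist x a); exists a.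
exists q; split => //; first exact: ltW.
have := metric_triangle a z q; rewrite (metric_sym a z) mulr2n => h.
by apply: le_trans h _; rewrite lerD// ltW.
Qed.

(** A match may leave the ball by [e]; it is kept inside by passing through a point [q] at depth
    [e], at an additional cost [c]. *)
Lemma hausdorff_dist_Dball A B x (c e r : R) : 0 <= e -> e <= c ->
  (forall a, A a -> mdist x a <= r + e ->
     exists q, [/\ A q, mdist x q <= r - e & mdist a q <= c]) ->
  (forall b, B b -> mdist x b <= r -> exists2 a, A a & mdist a b <= e) ->
  (forall a, A a -> mdist x a <= r -> exists2 b, B b & mdist a b <= e) ->
  (hausdorff_dist (B `&` Dball x r) (A `&` Dball x r) <= (c *+ 2)%:E)%E.
Proof.
move=> e0 ec shift BA AB; rewrite mulr2n.
apply: ge_ereal_inf; exists (c + c)%:E => //; exists (c + c) => //; split.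
- by lra.
- move=> b [Bb]; rewrite /Dball /= => xb.
  have [a Aa ab] := BA b Bb xb.
  have [|q [Aq xq aq]] := shift a Aa.
    by have := metric_triangle x b a; rewrite (metric_sym b); lra.
  exists q; first by split => //; rewrite /Dball /=; lra.
  by have := metric_triangle b a q; rewrite (metric_sym b a); lra.
move=> a [Aa]; rewrite /Dball /= => xa.
have [|q [Aq xq aq]] := shift a Aa; first by lra.
have [|b Bb qb] := AB q Aq; first by lra.
exists b; first by split => //; rewrite /Dball /=; have := metric_triangle x q b; lra.
by have := metric_triangle a q b; lra.
Qed.

(** Three contributions, each at most [k / 4]: the radii up to [r0] at which the Hausdorff distance
    is at most [k / 4], the radii within [e] of the entry radius of one of the finitely many cells,
    and the tail beyond [r0]. *)
Lemma dF_small A x (k : R) : (forall r, compact (Dball x r)) -> 0 < k ->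
  exists2 e : R, 0 < e & forall B,
    (forall b, B b -> mdist x b <= e^-1 -> exists2 a, A a & mdist a b <= e) ->
    (forall a, A a -> mdist x a <= e^-1 -> exists2 b, B b & mdist a b <= e) ->
    dF (B, x) (A, x) <= k.
Proof.
move=> cD k0; have k80 : 0 < k / 8 by rewrite divr_gt0.
have k160 : 0 < k / 16 by rewrite divr_gt0.
have [r0 r00 hr0] : exists2 r : R, 0 < r & expR (- 2^-1 * r) * 2 <= k / 4.
  (* The bound [1 + x <= expR x] at [x = r0 / 2 = 8 / k] gives the required smallness. *)
  exists (16 / k); first by rewrite divr_gt0.
  have hexp : 8 / k < expR (2^-1 * (16 / k)).
    have := expR_ge1Dx (2^-1 * (16 / k)).
    by rewrite (_ : 2^-1 * (16 / k) = 8 / k); [lra|field; exact: lt0r_neq0].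
  rewrite mulNr expRN.
  have : (expR (2^-1 * (16 / k)))^-1 <= (8 / k)^-1.
    by rewrite lef_pV2 ?posrE ?expR_gt0 ?divr_gt0// ltW.
  by rewrite invf_div; lra.
have [s [_ sP]] := compact_net (cD (r0 + 1)) k160.
pose m := entry_radius A x (k / 16).
(* In this order: [r0 + e] stays within the ball covered by the net; [e] is at most the diameter
   bound [k / 8] of the cells; the radii up to [r0] fall under the hypotheses on [B]; the
   exceptional intervals have total length at most [k / 4]. *)
pose e := Num.min (Num.min 1 (k / 8)) (Num.min (r0 + 1)^-1 (k / 8 / (size s).+1%:R)).
have r10 : 0 < r0 + 1 by lra.
have e0 : 0 < e by rewrite /e !lt_min ltr01 k80 invr_gt0 r10 divr_gt0.
have e1 : e <= 1 by rewrite /e !ge_min lexx.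
have e8 : e <= k / 8 by rewrite /e !ge_min lexx orbT.
have er : r0 + 1 <= e^-1.
  by rewrite -[leLHS]invrK lef_pV2 ?posrE ?invr_gt0// /e !ge_min lexx !orbT.
have es : e *+ (size s) <= k / 8.
  apply: (@le_trans _ _ (k / 8 / (size s).+1%:R *+ (size s).+1)); last first.
    by rewrite -mulr_natr divfK.
  rewrite (@le_trans _ _ (e *+ (size s).+1))//; first by rewrite ler_wpMn2l// ltW.
  by rewrite lerMn2r /e !ge_min lexx !orbT.
exists e => // B BA AB.
rewrite /dF /= mdistxx ge_max ltW//=.
rewrite -lee_fin (fineK (fin_int B x A x)).
pose J z : set R := `[m z - e, m z + e]%classic.
(* In the last summand half of the exponent is evaluated at [r0], which makes the factor small, and
   the other half keeps the tail integrable. *)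
pose g r := (((k / 4)%:E * (expR (- 1 * r))%:E + \sum_(z <- s) (\1_(J z) r)%:E) +
   (expR (- 2^-1 * r0))%:E * (expR (- 2^-1 * r))%:E)%E.
have mJ (z : M) : measurable_fun D (EFin \o (\1_(J z) : R -> R)).
  by apply/measurable_EFinP; apply: measurable_indic; exact: measurable_itv.
have sJ0 r : (0 <= \sum_(z <- s) (\1_(J z) r)%:E :> \bar R)%E.
  by apply: sume_ge0 => z _; rewrite lee_fin.
apply: (@le_trans _ _ (\int[lebesgue_measure]_(r in D) g r)%E); last first.
  rewrite ge0_integralD//=; last 4 first.
  - exact: measurable_itv.
  - by move=> r _; rewrite adde_ge0// -EFinM lee_fin mulr_ge0 ?expR_ge0// ltW// divr_gt0.
  - apply: emeasurable_funD; last exact: emeasurable_sum.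
    by apply: measurable_funeM; exact: measurable_expRM.
  - by apply: measurable_funeM; exact: measurable_expRM.
  rewrite ge0_integralD//=; last 4 first.
  - exact: measurable_itv.
  - by move=> r _; rewrite -EFinM lee_fin mulr_ge0 ?expR_ge0// ltW// divr_gt0.
  - by apply: measurable_funeM; exact: measurable_expRM.
  - exact: emeasurable_sum.
  rewrite !integral_expRM' ?expR_ge0 ?divr_ge0 ?(ltW k0)//.
  rewrite ge0_integral_sum//; last exact: measurable_itv.
  apply: (@le_trans _ _ ((k / 4)%:E + (e *+ 2 *+ size s)%:E + (k / 4)%:E)%E); last first.
    by rewrite -!EFinD lee_fin -mulrnA mulnC mulrnA; lra.
  rewrite divr1 invrK leeD ?lee_fin// leeD//.
  apply: (@le_trans _ _ (\sum_(z <- s) (e *+ 2)%:E)%E); last first.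
    by rewrite sumEFin big_const_seq count_predT iter_addr_0.
  apply: lee_sum => z _; rewrite integral_indic; [|exact: measurable_itv..].
  apply: (@le_trans _ _ (lebesgue_measure (J z))).
    apply: le_measure; rewrite ?inE; [|exact: measurable_itv|exact: subIsetl].
    by apply: measurableI; exact: measurable_itv.
  by rewrite /J lebesgue_measure_itv /= -EFinB; case: ifP => _; rewrite lee_fin; lra.
apply: ge0_le_integral_nonmeas => r; first by rewrite integrand_ge0.
rewrite /D /= in_itv /= andbT => r_ge0.
have g1 : (0 <= (k / 4)%:E * (expR (- 1 * r))%:E :> \bar R)%E.
  by rewrite -EFinM lee_fin mulr_ge0 ?expR_ge0// ltW// divr_gt0.
have g3 : (0 <= (expR (- 2^-1 * r0))%:E * (expR (- 2^-1 * r))%:E :> \bar R)%E.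
  by rewrite -EFinM lee_fin mulr_ge0 ?expR_ge0.
have [rr0|rr0] := ltP r0 r.
  apply: le_trans (integrand_le B x A x r) _.
  rewrite /g -[leLHS]add0e leeD ?adde_ge0// -EFinM lee_fin -expRD ler_expR; lra.
have [[z zs zr]|nJ] := pselect (exists2 z, z \in s & J z r).
  apply: le_trans (integrand_le B x A x r) _.
  apply: (@le_trans _ _ 1%E); first by rewrite lee_fin -expR0 ler_expR; lra.
  rewrite /g -[leLHS]adde0 leeD// -[leLHS]add0e leeD//.
  rewrite (big_rem z zs) /= indicE mem_set// -[leLHS]adde0 leeD//.
  by apply: sume_ge0 => w _; rewrite lee_fin.
have hle : (hausdorff_dist (B `&` Dball x r) (A `&` Dball x r) <= (k / 4)%:E)%E.
  have -> : k / 4 = k / 8 *+ 2 by rewrite -mulr_natr; field.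
  apply: (hausdorff_dist_Dball (e := e)) => //.
  - exact: ltW.
  - move=> a Aa xa.
    have [|z zs za] := sP a; first by rewrite /Dball /=; clear -xa rr0 e1; lra.
    have -> : k / 8 = k / 16 *+ 2 by rewrite -mulr_natr; field.
    apply: entry_radius_shift Aa za xa; first exact: ltW.
    by move=> rz; apply: nJ; exists z; rewrite // /J /= in_itv.
  - by move=> b Bb xb; apply: BA => //; clear -xb rr0 er; lra.
  by move=> a Aa xa; apply: AB => //; clear -xa rr0 er; lra.
rewrite /g -[leLHS]adde0 leeD// -[leLHS]adde0 leeD// mulN1r muleC.
rewrite /integrand lee_wpmul2l ?lee_fin ?expR_ge0//.
by rewrite ge_min hle orbT.
Qed.

End fell_distance.

(** * Sequences in metrizable spaces *)

Section plain_metric_cvg.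
Context {R : realType} {T : topologicalType} (d : T -> T -> R).
Hypothesis dT : induces d.

Lemma induces_cvg (u : nat -> T) (x : T) :
  u n @[n --> \oo] --> x <-> forall e : R, 0 < e -> \forall n \near \oo, d x (u n) < e.
Proof.
case: dT => dm od; split => [ux e e0|du A].
  apply: (ux [set y | d x y < e]); apply: open_nbhs_nbhs; split; last first.
    by rewrite /= (_ : d x x = 0)//; apply/(dist_eq0 dm).
  apply/od => y /= xy; exists (e - d x y); first by rewrite subr_gt0.
  move=> z yz; apply: le_lt_trans (dist_triangle dm y x z) _; lra.
rewrite nbhsE => -[U [oU Ux] UA]; have [e e0 eU] := (od U).1 oU x Ux.
by apply: filterS (du e e0) => n /eU /UA.
Qed.

End plain_metric_cvg.

Lemma metrizable_hausdorff (R : realType) (T : topologicalType) :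
  metrizable R T -> hausdorff_space T.
Proof.
move=> [d [dm od]] x y xy; apply/(dist_eq0 dm); apply: contrapT => /eqP dxy.
have d0 : 0 < d x y / 2 by rewrite divr_gt0// lt_neqAle eq_sym dxy (dist_ge0 dm).
have nb z : nbhs z [set w | d z w < d x y / 2].
  apply: open_nbhs_nbhs; split; last by rewrite /= (_ : d z z = 0)//; apply/(dist_eq0 dm).
  apply/od => w /= zw; exists (d x y / 2 - d z w); first by rewrite subr_gt0.
  move=> v wv; apply: le_lt_trans (dist_triangle dm w z v) _; lra.
have [z [/= xz yz]] := xy _ _ (nb x) (nb y).
by have := dist_triangle dm z x y; rewrite (dist_sym dm z); lra.
Qed.

(** * From closeness on large balls to Fell convergence *)

Section fell_convergence.
Context {R : realType} {Z X : bcm R} {X_ : nat -> bcm R}.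
Variables (f_ : forall n, isoemb (X_ n) Z) (f : isoemb X Z).
Variables (x_ : forall n, X_ n) (x0 : X).
Hypothesis f_x : forall n, f_ n (x_ n) = f x0.
Hypothesis near_f : forall e : R, 0 < e ->
  \forall n \near \oo, near_pts (x_ n) x0 (fun x y => mdist (f_ n x) (f y)) e.

(** A point of [K] has a ball of some radius [d] free of [range f]; a point of [range (f_ n)] close
    to it would have a partner of [range f] in that ball. Compactness makes the index uniform over
    [K]. *)
Lemma near_fell_miss (K : set Z) : compact K -> range f `&` K = set0 ->
  \forall n \near \oo, range (f_ n) `&` K = set0.
Proof.
move=> cK fK; have [[k0 Kk0]|K0] := pselect (K !=set0); last first.
  near=> n; apply/seteqP; split => // z [_ Kz]; apply: K0; by exists z.
have : \forall n \near \oo, K `<=` ~` range (f_ n).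
  apply: ((compact_near_coveringP K).1 cK nat \oo (fun n => ~` range (f_ n))) => z Kz.
  have nz : nbhs z (~` range f).
    apply: open_nbhs_nbhs; split; first exact/closed_openC/isoemb_range_closed.
    by move=> fz; suff : set0 z by []; rewrite -fK.
  have [d /= d0 dz] := (metricType_numDomainType.nbhs_mdistP _ _).1 nz.
  pose r := mdist (f x0) z + d; pose e := Num.min (d / 3) r^-1.
  have r0 : 0 < r by rewrite /r ltr_wpDl ?mdist_ge0.
  have e0 : 0 < e by rewrite /e lt_min divr_gt0// invr_gt0.
  have er : r <= e^-1 by rewrite -[leLHS]invrK lef_pV2 ?posrE ?invr_gt0// ge_min lexx orbT.
  have ed : e <= d / 3 by rewrite ge_min lexx.
  exists ([set w | mdist z w < d / 3],
    [set n | near_pts (x_ n) x0 (fun x y => mdist (f_ n x) (f y)) e]).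
    split; last exact: near_f.
    by apply/metricType_numDomainType.nbhs_mdistP; exists (d / 3) => //=; rewrite divr_gt0.
  move=> [w n] /= [zw [nf _]] [y _ yw].
  have [|x yx] := nf y.
    rewrite (le_trans _ er)// -(isoembP (f_ n)) f_x yw /r.
    by have := metric_triangle (f x0) z w; lra.
  apply: (dz (f x)); last by exists x.
  by rewrite /=; have := metric_triangle z w (f x); rewrite -yw in zw *; lra.
apply: filterS => n Kn; apply/seteqP; split => // z [fz Kz].
exact: Kn Kz fz.
Unshelve. all: by end_near. Qed.

Lemma near_fell_hit (U : set Z) : open U -> range f `&` U !=set0 ->
  \forall n \near \oo, range (f_ n) `&` U !=set0.
Proof.
move=> oU [_ [[x _ <-] Ufx]].
have [d /= d0 dU] := (metricType_numDomainType.nbhs_mdistP _ _).1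
  (open_nbhs_nbhs (conj oU Ufx)).
pose r := mdist x0 x + 1; pose e := Num.min (d / 2) r^-1.
have r0 : 0 < r by rewrite /r ltr_wpDl ?mdist_ge0.
have e0 : 0 < e by rewrite /e lt_min divr_gt0// invr_gt0.
have er : r <= e^-1 by rewrite -[leLHS]invrK lef_pV2 ?posrE ?invr_gt0// ge_min lexx orbT.
have ed : e <= d / 2 by rewrite ge_min lexx.
apply: filterS (near_f e0) => n [_ fn]; have [|y yx] := fn x.
  by rewrite (le_trans _ er)// /r; lra.
exists (f_ n y); split; first by exists y.
by apply: dU => /=; rewrite metric_sym; lra.
Qed.

Lemma near_fell : closed_image (f_ n) @[n --> \oo] --> closed_image f.
Proof.
move=> A; rewrite nbhsE => -[U [[D' D'P <-] [V VD' fV]] UA].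
suff : \forall n \near \oo, V (closed_image (f_ n)).
  by apply: filterS => n Vn; apply: UA; exists V.
have [D sD VE] := D'P V VD'.
rewrite -VE; apply: filter_bigI => S SD.
have := sD S SD; have : S (closed_image f) by move: fV; rewrite -VE; exact.
move=> Sf /[!inE] -[[K cK SE]|[W oW SE]]; rewrite -SE in Sf *.
  exact: near_fell_miss.
exact: near_fell_hit.
Qed.

End fell_convergence.

(** * Spans of rooted spaces and convergence of marked spaces *)

Lemma dep_choice (I : Type) (T : I -> Type) (P : forall i, T i -> Prop) :
  (forall i, exists x, P i x) -> exists f : forall i, T i, forall i, P i (f i).
Proof. by move=> h; exists (fun i => projT1 (cid (h i))) => i; exact: projT2 (cid (h i)). Qed.

Section rooted_spans.
Context {R : realType}.

Record rspan (X Y : rbcm R) := Rspan {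
  rspan_space : rbcm R ;
  rspan_l : isoemb X rspan_space ;
  rspan_r : isoemb Y rspan_space ;
  rspan_lP : root_preserving rspan_l ;
  rspan_rP : root_preserving rspan_r }.

Definition near_span (X Y : rbcm R) (s : rspan X Y) (e : R) : Prop :=
  near_pts (Defs.root X) (Defs.root Y) (fun x y => mdist (rspan_l s x) (rspan_r s y)) e.

Section redirect.
Context {X Y : metricType R} (c : coupling X Y) (x0 : X) (y0 : Y).
Let dc (x : X) (y : Y) : R := Num.min (mdist x x0 + mdist y0 y) (c x y + c x0 y0).

Let dcP x y : dc x y = mdist x x0 + mdist y0 y \/ dc x y = c x y + c x0 y0.
Proof. by rewrite /dc; case: leP => _; [left|right]. Qed.

Lemma redirect_lipl x' x y : dc x y <= mdist x x' + dc x' y.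
Proof.
have [->|->] := dcP x' y; rewrite ge_min.
  by apply/orP; left; have := metric_triangle x x' x0; lra.
by apply/orP; right; have := cpl_lipl c x' x y; lra.
Qed.

Lemma redirect_lipr y' x y : dc x y <= dc x y' + mdist y' y.
Proof.
have [->|->] := dcP x y'; rewrite ge_min.
  by apply/orP; left; have := metric_triangle y0 y' y; lra.
by apply/orP; right; have := cpl_lipr c y' x y; lra.
Qed.

Lemma redirect_distl y x x' : mdist x x' <= dc x y + dc x' y.
Proof.
have h0 := mdist_ge0 y0 y.
have h1 := metric_triangle x x0 x'; have h2 := metric_sym x0 x'.
have h3 := cpl_distl c y x0 x; have h4 := cpl_distl c y x0 x'.
have h5 := cpl_lipr c y0 x0 y; have h6 := cpl_distl c y x x'; have h7 := cpl_ge0 c x0 y0.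
by have [->|->] := dcP x y; have [->|->] := dcP x' y; rewrite ?(metric_sym x0 x) in h3 *; lra.
Qed.

Lemma redirect_distr x y y' : mdist y y' <= dc x y + dc x y'.
Proof.
have h0 := mdist_ge0 x x0.
have h1 := metric_triangle y y0 y'; have h2 := metric_sym y y0.
have h3 := cpl_distr c x y0 y; have h4 := cpl_distr c x y0 y'.
have h5 := cpl_lipl c x0 x y0; have h6 := cpl_distr c x y y'; have h7 := cpl_ge0 c x0 y0.
by have [->|->] := dcP x y; have [->|->] := dcP x y'; lra.
Qed.

(* Identifies [x0] with [y0] at the cost of perturbing the other cross
   distances by at most [c x0 y0]. *)
Definition redirect : coupling X Y :=
  Coupling redirect_lipl redirect_lipr redirect_distl redirect_distr.

Lemma redirect_root : redirect x0 y0 = 0.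
Proof.
apply/eqP; rewrite eq_le cpl_ge0 andbT.
by rewrite /= /dc ge_min !mdistxx addr0 lexx.
Qed.

Lemma redirect_le x y : redirect x y <= c x y + c x0 y0.
Proof. by rewrite /= /dc ge_min lexx orbT. Qed.

Lemma redirect_near (e : R) : 0 < e -> near_pts x0 y0 c e -> c x0 y0 <= e ->
  near_pts x0 y0 redirect (e *+ 2).
Proof.
move=> e0 [h1 h2] ce.
have ei : (e *+ 2)^-1 <= e^-1 by rewrite lef_pV2 ?posrE ?pmulrn_rgt0//; lra.
split => [x hx|y hy].
  have [|y cxy] := h1 x; first exact: le_trans ei.
  by exists y; rewrite (le_trans (redirect_le _ _))//; lra.
have [|x cxy] := h2 y; first exact: le_trans ei.
by exists x; rewrite (le_trans (redirect_le _ _))//; lra.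
Qed.

End redirect.

Lemma coupling_rspan (X Y : rbcm R) (c : coupling X Y) :
  c (Defs.root X) (Defs.root Y) = 0 ->
  exists s : rspan X Y, forall x y, mdist (rspan_l s x) (rspan_r s y) = c x y.
Proof.
move=> c0; pose s := the_span c.
pose Z := Rbcm (span_l s (Defs.root X)).
have lP : @root_preserving R X Z (span_l s) by [].
have rP : @root_preserving R Y Z (span_r s).
  by apply: mdist_positivity; rewrite metric_sym /= span_cpl.
by exists (Rspan lP rP) => x y /=; exact: span_cpl.
Qed.

(** The wedge of the two spaces at their roots. It keeps the infima from running over the empty set
    and is the default wherever a span must be chosen. *)
Lemma rspan_ex (X Y : rbcm R) : exists s : rspan X Y, True.
Proof.
pose w (x : X) (y : Y) : R := mdist x (Defs.root X) + mdist (Defs.root Y) y.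
have wlipl x' x y : w x y <= mdist x x' + w x' y.
  by have := metric_triangle x x' (Defs.root X); rewrite /w; lra.
have wlipr y' x y : w x y <= w x y' + mdist y' y.
  by have := metric_triangle (Defs.root Y) y' y; rewrite /w; lra.
have wdistl y x x' : mdist x x' <= w x y + w x' y.
  have := metric_triangle x (Defs.root X) x'; have := metric_sym (Defs.root X) x'.
  by have := mdist_ge0 (Defs.root Y) y; rewrite /w; lra.
have wdistr x y y' : mdist y y' <= w x y + w x y'.
  have := metric_triangle y (Defs.root Y) y'; have := metric_sym y (Defs.root Y).
  by have := mdist_ge0 x (Defs.root X); rewrite /w; lra.
have [|s _] := @coupling_rspan X Y (Coupling wlipl wlipr wdistl wdistr); last by exists s.
by rewrite /= /w !mdistxx addr0.
Qed.

End rooted_spans.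

Section convergence.
Context {R : realType}.

Lemma near_oo_lt (N : nat) (P : nat -> Prop) :
  (forall n, (N <= n)%N -> P n) -> \forall n \near \oo, P n.
Proof. by move=> NP; exists N. Qed.

Lemma near_invS (e : R) : 0 < e -> \forall n \near \oo, n.+1%:R^-1 < e.
Proof. by move=> e0; exact: (near_infty_natSinv_lt (PosNum e0)). Qed.

Lemma dF_near_pts (X Y Z : bcm R) (f : isoemb X Z) (g : isoemb Y Z) x y (e : R) :
  0 < e -> e <= 1 ->
  dF (range f, f x) (range g, g y) < e * expR (- (e^-1 + 1)) ->
  near_pts x y (fun x y => mdist (f x) (g y)) e.
Proof.
move=> e0 e1 he; split => [x' hx|y' hy].
  have [||_ [y' _ <-]] := dF_close e0 e1 he (a := f x'); first by exists x'.
    by rewrite isoembP.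
  by exists y'.
rewrite dF_sym in he.
have [||_ [x' _ <-]] := dF_close e0 e1 he (a := g y'); first by exists y'.
  by rewrite isoembP.
by rewrite metric_sym; exists x'.
Qed.

(** The order of quantifiers matters: [e] is chosen before [Y] and [g], so one [e] serves all terms
    of a sequence. *)
Lemma near_pts_dF (X Z : bcm R) (f : isoemb X Z) x (k : R) : 0 < k ->
  exists2 e : R, 0 < e & forall (Y : bcm R) (g : isoemb Y Z) y, g y = f x ->
    near_pts y x (fun y x => mdist (g y) (f x)) e ->
    dF (range g, f x) (range f, f x) <= k.
Proof.
move=> k0; have [e e0 eP] := @dF_small R Z (range f) (f x) k (fun r => @bcm_compact R Z (f x) r) k0.
exists e => // Y g y gy [h1 h2]; apply: eP.
  move=> _ [y' _ <-]; rewrite -gy isoembP => /h1[x' hx].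
  by exists (f x'); [exists x'|rewrite metric_sym].
move=> _ [x' _ <-]; rewrite isoembP => /h2[y' hy].
by exists (g y'); [exists y'|rewrite metric_sym].
Qed.

Variable tau : gh_structure R.
Implicit Types s t : marked tau.

(** No metrization occurs here, so this notion links distances built from different ones. Fell
    convergence is replaced by the quantitative [near_pts], from which [near_fell] recovers it. *)
Definition marked_cvg (s_ : nat -> marked tau) (s : marked tau) : Prop :=
  exists (Z : rbcm R) (f_ : forall n, isoemb (s_ n) Z) (f : isoemb s Z),
    [/\ forall n, root_preserving (f_ n), root_preserving f,
     forall e : R, 0 < e -> \forall n \near \oo, near_pts (Defs.root (s_ n))
       (Defs.root s) (fun x y => mdist (f_ n x) (f y)) e &
     gh_map (f_ n) (mk_elt (s_ n)) @[n --> \oo] --> gh_map f (mk_elt s)].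

Lemma rspan_common (s_ : nat -> rbcm R) (s : rbcm R) (sp : forall n, rspan (s_ n) s) :
  (forall e : R, 0 < e -> \forall n \near \oo, near_span (sp n) e) ->
  exists (Z : rbcm R) (f_ : forall n, isoemb (s_ n) Z) (f : isoemb s Z),
    [/\ forall n, root_preserving (f_ n), root_preserving f &
     forall n x y, mdist (f_ n x) (f y) = mdist (rspan_l (sp n) x) (rspan_r (sp n) y)].
Proof.
move=> sp_near.
have sp_root n : mdist (rspan_l (sp n) (Defs.root (s_ n))) (rspan_r (sp n) (Defs.root s)) = 0.
  by rewrite (rspan_lP (sp n)) (rspan_rP (sp n)) mdistxx.
have [| |Z [f_ [f fP]]] := @common_space R s s_
    (fun n => emb_coupling (rspan_l (sp n)) (rspan_r (sp n)))
    (Defs.root s) (fun n => Defs.root (s_ n)).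
- exact: sp_near.
- by move=> e e0; apply: (@near_oo_lt 0) => n _ /=; rewrite sp_root ltW.
exists (Rbcm (f (Defs.root s))), f_, f; split => // n.
by apply: mdist_positivity; rewrite /= fP /= sp_root.
Qed.

(** The spans vary with [n]; after transport to one space [Z] the distances belong to a single
    metric inducing the product topology, and the first projection gives convergence in [tau Z]. *)
Lemma marked_cvg_erm (E : erm tau) (s_ : nat -> marked tau) s
    (sp : forall n, rspan (s_ n) s) :
  (forall e : R, 0 < e -> \forall n \near \oo, near_span (sp n) e) ->
  (forall e : R, 0 < e -> \forall n \near \oo,
    erm_dist E (gh_map (rspan_l (sp n)) (mk_elt (s_ n)), Defs.root (rspan_space (sp n)))
      (gh_map (rspan_r (sp n)) (mk_elt s), Defs.root (rspan_space (sp n))) < e) ->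
  marked_cvg s_ s.
Proof.
move=> sp_near spE; have [Z [f_ [f [rf_ rf fP]]]] := rspan_common sp_near.
exists Z, f_, f; split => //.
  move=> e e0; apply: filterS (sp_near e e0) => n; rewrite /near_span.
  rewrite (_ : (fun _ _ => _) = fun x y => mdist (f_ n x) (f y))//.
  by do 2 apply/funext => ?; rewrite fP.
have dZ := erm_induces E Z.
have pcvg : (gh_map (f_ n) (mk_elt (s_ n)), Defs.root Z) @[n --> \oo] -->
    (gh_map f (mk_elt s), Defs.root Z).
  apply/(induces_cvg dZ) => e e0; apply: filterS (spE e e0) => n.
  rewrite (dist_sym (dZ.1)) -{1}(rf_ n) -rf.
  rewrite -{1}(rspan_lP (sp n)) -(rspan_rP (sp n)).
  by rewrite (erm_transport E _ _ _ _ (fP n)).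
exact: (cvg_comp _ _ pcvg cvg_fst).
Qed.

Lemma marked_cvg_srm (S : srm tau) (s_ : nat -> marked tau) s
    (sp : forall n, rspan (s_ n) s) :
  (forall e : R, 0 < e -> \forall n \near \oo, near_span (sp n) e) ->
  (forall e : R, 0 < e -> \forall n \near \oo,
    srm_dist S (X := rspan_space (sp n)) (gh_map (rspan_l (sp n)) (mk_elt (s_ n)))
      (gh_map (rspan_r (sp n)) (mk_elt s)) < e) ->
  marked_cvg s_ s.
Proof.
move=> sp_near spS; have [Z [f_ [f [rf_ rf fP]]]] := rspan_common sp_near.
exists Z, f_, f; split => //.
  move=> e e0; apply: filterS (sp_near e e0) => n; rewrite /near_span.
  rewrite (_ : (fun _ _ => _) = fun x y => mdist (f_ n x) (f y))//.
  by do 2 apply/funext => ?; rewrite fP.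
have dZ := srm_induces S Z.
apply/(induces_cvg dZ) => e e0; apply: filterS (spS e e0) => n.
rewrite (dist_sym (dZ.1)).
by rewrite (srm_transport S _ _ (rf_ n) rf (rspan_lP (sp n)) (rspan_rP (sp n)) (fP n)).
Qed.

Section preserved.
Variable E : erm tau.

Lemma pre_dist_preserved_cvg (s_ : nat -> marked tau) s :
  (forall e : R, 0 < e -> \forall n \near \oo, pre_dist_preserved E (s_ n) s < e) <->
  marked_cvg s_ s.
Proof.
split=> [ds|[Z [f_ [f [rf_ rf nf cf]]]] e e0].
  have /dep_choice[sp spP] : forall n, exists sp : rspan (s_ n) s, Num.max
      (dF (range (rspan_l sp), Defs.root (rspan_space sp))
          (range (rspan_r sp), Defs.root (rspan_space sp)))
      (erm_dist E (gh_map (rspan_l sp) (mk_elt (s_ n)), Defs.root (rspan_space sp))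
          (gh_map (rspan_r sp) (mk_elt s), Defs.root (rspan_space sp)))
      < pre_dist_preserved E (s_ n) s + n.+1%:R^-1.
    move=> n; have n0 : (0 : R) < n.+1%:R^-1 by rewrite invr_gt0.
    have : pre_dist_preserved E (s_ n) s < pre_dist_preserved E (s_ n) s + n.+1%:R^-1.
      by rewrite ltrDl.
    rewrite {1}/pre_dist_preserved => /inf_lt[|_ [Z [f [g [rf rg ->]]]] lt_v].
      have [sp _] := rspan_ex (s_ n) s.
      by eexists; exists (rspan_space sp), (rspan_l sp), (rspan_r sp); split;
        [exact: rspan_lP|exact: rspan_rP|reflexivity].
    by exists (Rspan rf rg).
  have small e : 0 < e -> \forall n \near \oo,
      pre_dist_preserved E (s_ n) s + n.+1%:R^-1 < e.
    move=> e0; have e20 : 0 < e / 2 by rewrite divr_gt0.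
    by apply: filterS2 (ds _ e20) (near_invS e20) => n dn nn; rewrite [ltRHS]splitr ltrD.
  apply: (marked_cvg_erm (E := E) (sp := sp)) => e e0.
    pose e1 := Num.min e 1.
    have e10 : 0 < e1 by rewrite lt_min e0 ltr01.
    have e1e : e1 <= e by rewrite ge_min lexx.
    have e11 : e1 <= 1 by rewrite ge_min lexx orbT.
    have k0 : 0 < e1 * expR (- (e1^-1 + 1)) by rewrite mulr_gt0// expR_gt0.
    apply: filterS (small _ k0) => n hn; apply: (near_pts_le e10 e1e).
    apply: dF_near_pts => //.
    have := lt_trans (spP n) hn; rewrite gt_max => /andP[+ _].
    by rewrite -{1}(rspan_lP (sp n)) -(rspan_rP (sp n)).
  apply: filterS (small _ e0) => n hn.
  by have := lt_trans (spP n) hn; rewrite gt_max => /andP[].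
have e20 : 0 < e / 2 by rewrite divr_gt0.
have [k k0 kP] := near_pts_dF f (Defs.root s) e20.
have dZ := erm_induces E Z.
have pcvg : (gh_map (f_ n) (mk_elt (s_ n)), Defs.root Z) @[n --> \oo] -->
    (gh_map f (mk_elt s), Defs.root Z).
  by apply: cvg_pair => //; exact: cvg_cst.
move/(induces_cvg dZ)/(_ _ e20) : pcvg => dE.
apply: filterS2 (nf _ k0) dE => n nn dn.
apply: (@le_lt_trans _ _ (e / 2)); last by lra.
pose v := Num.max (dF (range (f_ n), Defs.root Z) (range f, Defs.root Z))
  (erm_dist E (gh_map (f_ n) (mk_elt (s_ n)), Defs.root Z) (gh_map f (mk_elt s), Defs.root Z)).
apply: (@le_trans _ _ v).
  apply: ge_inf; last by exists Z, (f_ n), f.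
  by exists 0 => _ [? [? [? [_ _ ->]]]]; rewrite le_max dF_ge0.
rewrite ge_max; apply/andP; split; last by rewrite (dist_sym dZ.1) ltW.
by rewrite -rf; apply: kP nn; rewrite rf rf_.
Qed.

Lemma pre_dist_preserved_sym s t : pre_dist_preserved E s t = pre_dist_preserved E t s.
Proof.
have swap (Z : rbcm R) (A B : set Z) p q :
    Num.max (dF (A, Defs.root Z) (B, Defs.root Z)) (erm_dist E (X := Z) p q) =
    Num.max (dF (B, Defs.root Z) (A, Defs.root Z)) (erm_dist E (X := Z) q p).
  by rewrite dF_sym (dist_sym (erm_induces E Z).1).
congr inf; apply/seteqP; split => v [Z [f [g [rf rg ->]]]]; exists Z, g, f.
  by split; [exact: rg|exact: rf|exact: swap].
by split; [exact: rg|exact: rf|exact: swap].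
Qed.

Lemma pre_dist_nonpreserved_sym s t :
  pre_dist_nonpreserved E s t = pre_dist_nonpreserved E t s.
Proof.
congr inf; apply/seteqP; split => v [Z [f [g ->]]]; exists Z, g, f;
  by congr (Num.max _ _); [exact: dF_sym|exact: (dist_sym (erm_induces E Z).1)].
Qed.

Lemma pre_dist_nonpreserved_le s t :
  pre_dist_nonpreserved E s t <= pre_dist_preserved E s t.
Proof.
apply: lb_le_inf => [|_ [Z [f [g [rf rg ->]]]]].
  have [sp _] := rspan_ex s t.
  by eexists; exists (rspan_space sp), (rspan_l sp), (rspan_r sp); split;
    [exact: rspan_lP|exact: rspan_rP|reflexivity].
apply: ge_inf; first by exists 0 => _ [? [? [? ->]]]; rewrite le_max dF_ge0.
by exists Z, f, g; rewrite rf rg.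
Qed.

End preserved.

End convergence.

(** * Stability and non-preserved roots *)

Section nonpreserved.
Context {R : realType}.
Variables (tau : gh_structure R) (E' : erm tau).
Hypothesis E'_stable : stable_erm E'.
Implicit Types s t : marked tau.

(** Embeddings nearly optimal for the arbitrary [E] are moved to a common space, where [E] can be
    exchanged for the stable [E']; then [redirect] identifies the roots, and stability bounds its
    effect on [E']. *)
Lemma pre_dist_nonpreserved_cvg (E : erm tau) (s_ : nat -> marked tau) s :
  (forall e : R, 0 < e -> \forall n \near \oo, pre_dist_nonpreserved E (s_ n) s < e) ->
  marked_cvg s_ s.
Proof.
move=> ds.
have /dep_choice[sp spP] : forall n, exists sp : {Z : bcm R & isoemb (s_ n) Z * isoemb s Z}%type,
    Num.max
      (dF (range (projT2 sp).1, (projT2 sp).1 (Defs.root (s_ n)))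
          (range (projT2 sp).2, (projT2 sp).2 (Defs.root s)))
      (erm_dist E (gh_map (projT2 sp).1 (mk_elt (s_ n)), (projT2 sp).1 (Defs.root (s_ n)))
                  (gh_map (projT2 sp).2 (mk_elt s), (projT2 sp).2 (Defs.root s)))
    < pre_dist_nonpreserved E (s_ n) s + n.+1%:R^-1.
  move=> n.
  have : pre_dist_nonpreserved E (s_ n) s < pre_dist_nonpreserved E (s_ n) s + n.+1%:R^-1.
    by rewrite ltrDl.
  rewrite {1}/pre_dist_nonpreserved => /inf_lt[|_ [Z [f [g ->]]] lt_v].
    have [sp _] := rspan_ex (s_ n) s.
    by eexists; exists (rspan_space sp), (rspan_l sp), (rspan_r sp); reflexivity.
  by exists (existT _ Z (f, g)).
pose fn n : isoemb (s_ n) (projT1 (sp n)) := (projT2 (sp n)).1.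
pose gn n : isoemb s (projT1 (sp n)) := (projT2 (sp n)).2.
have small e : 0 < e -> \forall n \near \oo,
    pre_dist_nonpreserved E (s_ n) s + n.+1%:R^-1 < e.
  move=> e0; have e20 : 0 < e / 2 by rewrite divr_gt0.
  by apply: filterS2 (ds _ e20) (near_invS e20) => n dn nn; rewrite [ltRHS]splitr ltrD.
pose c n := emb_coupling (fn n) (gn n).
have c_near e : 0 < e -> \forall n \near \oo, near_pts (Defs.root (s_ n)) (Defs.root s) (c n) e.
  move=> e0; pose e1 := Num.min e 1.
  have e10 : 0 < e1 by rewrite lt_min e0 ltr01.
  have e1e : e1 <= e by rewrite ge_min lexx.
  have e11 : e1 <= 1 by rewrite ge_min lexx orbT.
  have k0 : 0 < e1 * expR (- (e1^-1 + 1)) by rewrite mulr_gt0// expR_gt0.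
  apply: filterS (small _ k0) => n hn; apply: (near_pts_le e10 e1e).
  apply: dF_near_pts => //.
  by have := lt_trans (spP n) hn; rewrite gt_max => /andP[+ _].
have c_root e : 0 < e -> \forall n \near \oo, c n (Defs.root (s_ n)) (Defs.root s) <= e.
  move=> e0; apply: filterS (small _ e0) => n hn.
  have := lt_trans (spP n) hn; rewrite gt_max => /andP[+ _].
  by rewrite gt_max => /andP[/ltW].
have [Z [F_ [F FP]]] := common_space c_near c_root.
have dZ := erm_induces E Z; have dZ' := erm_induces E' Z.
have pcvg : (gh_map (F_ n) (mk_elt (s_ n)), F_ n (Defs.root (s_ n))) @[n --> \oo] -->
    (gh_map F (mk_elt s), F (Defs.root s)).
  apply/(induces_cvg dZ) => e e0; apply: filterS (small _ e0) => n hn.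
  rewrite (dist_sym (dZ.1)) (erm_transport E _ _ _ _ (FP n)).
  by have := lt_trans (spP n) hn; rewrite gt_max => /andP[].
(* [E] and [E'] induce the same product topology over [Z], hence have the same convergent
   sequences. *)
move/(induces_cvg dZ') : pcvg => pcvg.
pose rc n := redirect (c n) (Defs.root (s_ n)) (Defs.root s).
have /dep_choice[rs rsP] : forall n, exists rs : rspan (s_ n) s,
    forall x y, mdist (rspan_l rs x) (rspan_r rs y) = rc n x y.
  by move=> n; apply: coupling_rspan; exact: redirect_root.
have [Th [Th_ge0 Th0 Th_cvg ThP]] := E'_stable.
apply: (marked_cvg_erm (E := E') (sp := rs)) => e e0.
  have e20 : 0 < e / 2 by rewrite divr_gt0.
  apply: filterS2 (c_near _ e20) (c_root _ e20) => n nn rn.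
  rewrite /near_span (_ : (fun _ _ => _) = rc n); last first.
    by do 2 apply/funext => ?; rewrite rsP.
  have -> : e = e / 2 *+ 2 by rewrite -mulr_natr divfK.
  exact: redirect_near.
have e20 : 0 < e / 2 by rewrite divr_gt0.
(* The limit of [Th] along [0^'+] ignores the point 0, yet the roots may already coincide; this case
   is covered by [Th0]. *)
have [d d0 dP] : exists2 d : R, 0 < d & forall k, 0 <= k -> k < d -> Th k < e / 2.
  have : \forall k \near 0^'+, Th k < e / 2.
    move/cvgrPdist_lt/(_ _ e20) : Th_cvg; apply: filterS => k; rewrite sub0r normrN.
    by apply: le_lt_trans; exact: ler_norm.
  rewrite near_withinE => /nbhs_ballP[d /= d0 dT]; exists d => // k k0 kd.
  have [<-|k0'] := eqVneq 0 k; first by rewrite Th0.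
  apply: dT; last by rewrite lt_neqAle k0' k0.
  by rewrite /ball /= sub0r normrN ger0_norm.
have d20 : 0 < d / 2 by rewrite divr_gt0.
apply: filterS2 (pcvg _ e20) (c_root _ d20) => n pn rn.
have c0 : 0 <= c n (Defs.root (s_ n)) (Defs.root s) by exact: cpl_ge0.
have hd x y : mdist (rspan_l (rs n) x) (rspan_r (rs n) y) <=
    mdist (F_ n x) (F y) + c n (Defs.root (s_ n)) (Defs.root s).
  by rewrite rsP FP; exact: redirect_le.
have := ThP _ _ _ _ _ _ _ _ _ c0 hd (mk_elt (s_ n)) (Defs.root (s_ n))
  (mk_elt s) (Defs.root s).
rewrite (rspan_lP (rs n)) (rspan_rP (rs n)) => /le_lt_trans; apply.
rewrite (dist_sym dZ'.1) [ltRHS]splitr ltrD//.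
by apply: dP => //; lra.
Qed.

End nonpreserved.

(** Stated for an arbitrary function [d], hence directly applicable to both distances on classes. If
    openness fails at [x], points outside [U] within [1 / (n + 1)] of [x] form a sequence against
    the condition. *)
Lemma metric_open_seq (R : realType) (T : Type) (d : T -> T -> R) (U : T -> Prop) :
  metric_open d U <->
  forall (u : nat -> T) x, U x ->
    (forall e : R, 0 < e -> \forall n \near \oo, d x (u n) < e) ->
    exists n, U (u n).
Proof.
split=> [oU u x Ux ux|oU x Ux].
  have [e e0 eU] := oU x Ux; have [n _ nP] := ux e e0.
  by exists n; apply: eU; exact: (nP n (leqnn n)).
apply: contrapT => nU.
have /choice[u uP] : forall n : nat, exists y, d x y < n.+1%:R^-1 /\ ~ U y.
  move=> n; apply: contrapT => h; apply: nU; exists n.+1%:R^-1; first by rewrite invr_gt0.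
  by move=> y xy; apply: contrapT => Uy; apply: h; exists y.
have [|n] := oU u x Ux; last exact: (uP n).2.
by move=> e e0; apply: filterS (near_invS e0) => n; apply: lt_trans; exact: (uP n).1.
Qed.

(** * The rooted distance of a space-rooted metrization *)

Section rooted_distance.
Context {R : realType} {tau : gh_structure R}.
Variable S : srm tau.
Implicit Types s t u : marked tau.

Definition span_dist s t (sp : rspan s t) : R :=
  srm_dist S (X := rspan_space sp) (gh_map (rspan_l sp) (mk_elt s)) (gh_map (rspan_r sp) (mk_elt t)).

Definition rdist_bound s t : set R :=
  [set e | 0 < e /\ (1 <= e \/ exists sp : rspan s t, near_span sp e /\ span_dist sp <= e)].

Definition rdist s t : R := inf (rdist_bound s t).

Lemma srm_distxx (X : rbcm R) (a : tau X) : srm_dist S a a = 0.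
Proof. by apply/(dist_eq0 (srm_induces S X).1). Qed.

Lemma rdist_bound1 s t : rdist_bound s t 1.
Proof. by split; rewrite ?ltr01//; left. Qed.

Lemma rdist_bound_le s t e e' : e <= e' -> rdist_bound s t e -> rdist_bound s t e'.
Proof.
move=> ee' [e0 h]; split; first exact: lt_le_trans ee'.
case: h => [e1|[sp [sn sd]]]; first by left; exact: le_trans ee'.
by right; exists sp; split; [exact: near_pts_le sn|exact: le_trans ee'].
Qed.

Lemma rdist_ge0 s t : 0 <= rdist s t.
Proof. by apply: lb_le_inf => [|e [/ltW]//]; exists 1; exact: rdist_bound1. Qed.

Lemma rdist_le s t e : rdist_bound s t e -> rdist s t <= e.
Proof. by move=> he; apply: ge_inf => //; exists 0 => x [/ltW]. Qed.

Lemma rdist_lt s t e : rdist s t < e -> rdist_bound s t e.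
Proof.
move/inf_lt => [|e' be' /ltW ee']; first by exists 1; exact: rdist_bound1.
exact: rdist_bound_le be'.
Qed.

Lemma rdist_bound_sym s t e : rdist_bound s t e -> rdist_bound t s e.
Proof.
move=> [e0 [e1|[[Z f g rf rg] [[sn1 sn2] sd]]]]; split=> //; [by left|right].
exists (Rspan rg rf); split; last by rewrite /span_dist (dist_sym (srm_induces S _).1).
split=> [x /sn2[y yx]|x /sn1[y yx]]; exists y; by rewrite /= metric_sym.
Qed.

Lemma rdist_sym s t : rdist s t = rdist t s.
Proof. by congr inf; apply/seteqP; split => e; exact: rdist_bound_sym. Qed.

Lemma rspan_comp s t u (sp : rspan s t) (sp' : rspan t u) :
  exists sq : rspan s u,
    (forall x y z, mdist (rspan_l sq x) (rspan_r sq z) <=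
       mdist (rspan_l sp x) (rspan_r sp y) + mdist (rspan_l sp' y) (rspan_r sp' z)) /\
    span_dist sq <= span_dist sp + span_dist sp'.
Proof.
have [Z [f [g [h [fg gh]]]]] := chain3 (emb_coupling (rspan_l sp) (rspan_r sp))
  (emb_coupling (rspan_l sp') (rspan_r sp')).
pose W := Rbcm (f (Defs.root s)).
have rf : @root_preserving R s W f by [].
have rg : @root_preserving R t W g.
  by apply: mdist_positivity; rewrite metric_sym fg /= rspan_lP rspan_rP mdistxx.
have rh : @root_preserving R u W h.
  apply: mdist_positivity; rewrite /= -[f _]rg metric_sym gh /=.
  by rewrite rspan_lP rspan_rP mdistxx.
exists (Rspan rf rh); split=> [x y z|] /=.
  by rewrite -[X in _ <= X + _]fg -[X in _ <= _ + X]gh metric_triangle.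
rewrite /span_dist /=.
have -> := srm_transport S (mk_elt s) (mk_elt t) (rspan_lP sp) (rspan_rP sp) rf rg
  (fun x y => esym (fg x y)).
have -> := srm_transport S (mk_elt t) (mk_elt u) (rspan_lP sp') (rspan_rP sp') rg rh
  (fun x y => esym (gh x y)).
exact: (dist_triangle (srm_induces S W).1).
Qed.

Lemma near_span_root (s t : rbcm R) (sp : rspan s t) x y :
  mdist (Defs.root t) y <= mdist (Defs.root s) x + mdist (rspan_l sp x) (rspan_r sp y).
Proof.
rewrite -(isoembP (rspan_r sp)) -(isoembP (rspan_l sp)) rspan_lP rspan_rP.
exact: metric_triangle.
Qed.

Lemma near_span_root' (s t : rbcm R) (sp : rspan s t) x y :
  mdist (Defs.root s) x <= mdist (Defs.root t) y + mdist (rspan_l sp x) (rspan_r sp y).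
Proof.
rewrite -(isoembP (rspan_r sp)) -(isoembP (rspan_l sp)) rspan_lP rspan_rP.
by rewrite (metric_sym (rspan_l sp x)) metric_triangle.
Qed.

(* Keeps the points of the ball of radius [1 / (e + e')] within the range of the
   second of two composed spans. *)
Lemma radius_shift (e e' : R) : 0 < e -> 0 < e' -> e + e' <= 1 ->
  (e + e')^-1 + e <= e'^-1.
Proof.
move=> e0 e'0 ee1; have ee0 : 0 < e + e' by rewrite addr_gt0.
rewrite -(ler_pM2r ee0) mulrDl mulVf ?lt0r_neq0// -(ler_pM2r e'0).
rewrite mulrAC mulVf ?lt0r_neq0// mul1r.
have h1 : e' * (e + e') <= 1 by rewrite mulr_ile1// ?ltW//; lra.
have h2 : e * (e' * (e + e')) <= e by rewrite ler_piMr// ltW.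
by lra.
Qed.

Lemma rdist_boundD s t u e e' : rdist_bound s t e -> rdist_bound t u e' ->
  rdist_bound s u (e + e').
Proof.
move=> [e0 h] [e'0 h']; split; first by rewrite addr_gt0.
have [ee1|/ltW ee1] := lerP 1 (e + e'); [by left|right].
case: h => [e1|[sp [[n1 n2] sd]]]; first by exfalso; lra.
case: h' => [e1|[sp' [[m1 m2] sd']]]; first by exfalso; lra.
have [sq [sqP sqd]] := rspan_comp sp sp'.
exists sq; split; last by rewrite (le_trans sqd)// lerD.
have r1 := radius_shift e0 e'0 ee1.
have r2 : (e + e')^-1 + e' <= e^-1 by rewrite (addrC e e'); apply: radius_shift; rewrite // addrC.
split=> [x hx|z hz].
  have [|y xy] := n1 x; first by lra.
  have [|z yz] := m1 y; first by have := near_span_root sp x y; lra.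
  by exists z; have := sqP x y z; lra.
have [|y yz] := m2 z; first by lra.
have [|x xy] := n2 y; first by have := near_span_root' sp' y z; lra.
by exists x; have := sqP x y z; lra.
Qed.

Lemma rdist_triangle t s u : rdist s u <= rdist s t + rdist t u.
Proof.
apply/ler_addgt0Pr => e e0; have e20 : 0 < e / 2 by rewrite divr_gt0.
have h1 : rdist_bound s t (rdist s t + e / 2) by apply: rdist_lt; rewrite ltrDl.
have h2 : rdist_bound t u (rdist t u + e / 2) by apply: rdist_lt; rewrite ltrDl.
by have := rdist_le (rdist_boundD h1 h2); lra.
Qed.

Lemma marked_equiv_rdist s t : marked_equiv s t -> rdist s t = 0.
Proof.
move=> [f [[g fK gK] rf fa]]; apply/eqP; rewrite eq_le rdist_ge0 andbT.
apply/ler_addgt0Pr => e e0; rewrite add0r; apply: rdist_le; split => //; right.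
have rid : @root_preserving R t t (id_emb t) by [].
exists (Rspan rf rid); rewrite /span_dist /= fa gh_id srm_distxx ltW//; split => //.
split=> [x _|y _]; first by exists (f x); rewrite /= mdistxx ltW.
by exists (g y); rewrite /= gK mdistxx ltW.
Qed.

Lemma rdistxx s : rdist s s = 0.
Proof.
apply: marked_equiv_rdist; exists (id_emb s); split => //; last exact: gh_id.
by exists id.
Qed.

Lemma rdist_cvg (s_ : nat -> marked tau) s :
  (forall e : R, 0 < e -> \forall n \near \oo, rdist (s_ n) s < e) <-> marked_cvg s_ s.
Proof.
split=> [ds|[Z [f_ [f [rf_ rf nf cf]]]] e e0].
  pose e_ n := rdist (s_ n) s + n.+1%:R^-1.
  have e_gt0 n : 0 < e_ n by rewrite /e_ ltr_wpDl ?rdist_ge0// invr_gt0.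
  have small e : 0 < e -> \forall n \near \oo, e_ n < e.
    move=> e0; have e20 : 0 < e / 2 by rewrite divr_gt0.
    by apply: filterS2 (ds _ e20) (near_invS e20) => n dn nn; rewrite [ltRHS]splitr ltrD.
  (* When [e_ n >= 1] the bound carries no information and any span is taken; this concerns finitely
     many [n]. *)
  have /dep_choice[sp spP] : forall n, exists sp : rspan (s_ n) s,
      e_ n < 1 -> near_span sp (e_ n) /\ span_dist sp <= e_ n.
    move=> n; have [_ [e1|[sp spP]]] : rdist_bound (s_ n) s (e_ n).
    - by apply: rdist_lt; rewrite /e_ ltrDl.
    - by have [sp _] := rspan_ex (s_ n) s; exists sp; rewrite ltNge e1.
    - by exists sp.
  apply: (marked_cvg_srm (S := S) (sp := sp)) => e e0.
    apply: filterS2 (small _ e0) (small _ ltr01) => n ne n1.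
    by apply: near_pts_le (spP n n1).1; [exact: e_gt0|exact: ltW].
  apply: filterS2 (small _ e0) (small _ ltr01) => n ne n1.
  exact: le_lt_trans (spP n n1).2 ne.
have e20 : 0 < e / 2 by rewrite divr_gt0.
have dZ := srm_induces S Z.
move/(induces_cvg dZ)/(_ _ e20) : cf => dE.
apply: filterS2 (nf _ e20) dE => n nn dn.
apply: (@le_lt_trans _ _ (e / 2)); last by lra.
apply: rdist_le; split => //; right; exists (Rspan (rf_ n) rf); split => //.
by rewrite /span_dist /= (dist_sym dZ.1) ltW.
Qed.

End rooted_distance.

(** * Limits of isometric embeddings and uniqueness of limits *)

Section arzela.
Context {R : realType}.

Lemma compact_Dball (X : metricType R) (x0 : X) (K : set X) : compact K ->
  exists r : R, forall x, K x -> mdist x0 x <= r.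
Proof.
move=> cK; have [s [_ sP]] := compact_net cK (@ltr01 R).
exists (\sum_(z <- s) mdist x0 z + 1) => x /sP[z zs zx].
apply: le_trans (metric_triangle x0 z x) _; rewrite lerD// ?(ltW zx)//.
by rewrite (big_rem z zs) /= lerDl sumr_ge0// => w _; exact: mdist_ge0.
Qed.

Lemma family_compact_cvg (X Z : bcm R) (g_ : nat -> X -> Z) (g : X -> Z) (x0 : X) :
  (forall r e : R, 0 < e -> \forall k \near \oo,
     forall x, mdist x0 x <= r -> mdist (g x) (g_ k x) < e) ->
  {family compact, g_ @ \oo --> g}.
Proof.
move=> gP; apply/fam_cvgP => K /(compact_Dball x0)[r Kr] P.
rewrite uniform_nbhs => -[A [entA AP]].
move: entA; rewrite -entourage_ballE => -[e /= e0 eA].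
apply: filterS (gP r e e0) => k gk; apply: AP => x Kx.
by apply: eA; rewrite /= ballEmdist /=; exact: gk (Kr _ Kx).
Qed.

(** An Arzela-Ascoli argument: pointwise limits along an ultrafilter define [g], and since all maps
    are isometric, closeness on a [1 / (k + 1)]-net of the ball of radius [k] gives closeness
    [3 / (k + 1)] on the whole ball. *)
Lemma isoemb_extract (X Z : bcm R) (f_ : nat -> isoemb X Z) (x0 : X) (z0 : Z) :
  (forall n, f_ n x0 = z0) ->
  exists (n_ : nat -> nat) (g : isoemb X Z), (forall k, (k <= n_ k)%N) /\
    forall r e : R, 0 < e -> \forall k \near \oo,
      forall x, mdist x0 x <= r -> mdist (g x) (f_ (n_ k) x) < e.
Proof.
move=> fx0; have [U [UU ooU]] := ultraFilterLemma eventually_filter.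
have /choice[g gP] : forall x, exists z,
    forall e : R, 0 < e -> U [set n | mdist z (f_ n x) < e].
  move=> x; have := @bcm_compact R Z z0 (mdist x0 x) => cD.
  have Ux : U ((fun n => f_ n x) @^-1` Dball z0 (mdist x0 x)).
    by apply: ooU; exists 0%N => // n _; rewrite /Dball /= -(fx0 n) isoembP.
  have [z [_ clz]] := cD _ (fmap_proper_filter (fun n => f_ n x) (ultra_proper (F := U))) Ux.
  exists z => e e0; have [//|Un] := in_ultra_setVsetC [set n | mdist z (f_ n x) < e] UU.
  have Uf : U ((fun n => f_ n x) @^-1` [set w | ~ mdist z w < e]) by [].
  by have [w [/= ? ]] := clz _ _ Uf (nbhsx_ballx z e e0); rewrite ballEmdist.
have gisom x y : mdist (g x) (g y) = mdist x y.
  apply/eqP; rewrite -subr_eq0 -normr_le0; apply/ler_addgt0Pr => e e0.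
  have e20 : 0 < e / 2 by rewrite divr_gt0.
  have [n [/= nx ny]] := filter_ex (filterI (gP x _ e20) (gP y _ e20)).
  have := metric_triangle (g x) (f_ n x) (g y); have := metric_triangle (f_ n x) (f_ n y) (g y).
  have := metric_triangle (f_ n x) (g x) (f_ n y); have := metric_triangle (g x) (g y) (f_ n y).
  rewrite isoembP (metric_sym (f_ n y)) (metric_sym (f_ n x) (g x)).
  by rewrite add0r ler_norml => *; apply/andP; split; lra.
have /choice[n_ nP] : forall k : nat, exists n, (k <= n)%N /\
    forall x, mdist x0 x <= k%:R -> mdist (g x) (f_ n x) <= 3 / k.+1%:R.
  move=> k; have k0 : 0 < k.+1%:R^-1 :> R by rewrite invr_gt0.
  have [s [_ sP]] := compact_net (@bcm_compact R X x0 k%:R) k0.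
  have Us : U [set n | forall z, z \in s -> mdist (g z) (f_ n z) < k.+1%:R^-1].
    elim: s {sP} => [|z s IH]; first by apply: ooU; exists 0%N.
    apply: filterS (filterI (gP z _ k0) IH) => n [/= zn sn] w.
    by rewrite inE => /orP[/eqP ->|/sn].
  have Uk : U [set n | (k <= n)%N] by apply: ooU; exists k.
  have [n [/= kn sn]] := filter_ex (filterI Uk Us).
  exists n; split => // x /sP[z zs zx]; have := sn z zs.
  have := metric_triangle (g x) (g z) (f_ n x); have := metric_triangle (g z) (f_ n z) (f_ n x).
  rewrite gisom isoembP (metric_sym x).
  by move: zx; set c := k.+1%:R^-1; lra.
exists n_, (Isoemb gisom); split => [k|r e e0]; first exact: (nP k).1.
have e30 : 0 < e / 3 by rewrite divr_gt0.
have [M rM] : exists M : nat, r <= M%:R.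
  exists (Num.truncn `|r|).+1; apply: le_trans (ler_norm r) (ltW _).
  by have /andP[] := truncn_itv (normr_ge0 r).
have kM : \forall k \near \oo, (M <= k)%N by exists M.
apply: filterS2 (near_invS e30) kM => k ke Mk x hx.
apply: le_lt_trans ((nP k).2 x _) _; last by move: ke; set c := k.+1%:R^-1; lra.
by rewrite (le_trans hx)// (le_trans rM)// ler_nat.
Qed.

Variable tau : gh_structure R.
Hypothesis tau_cont : embedding_continuous tau.
Implicit Types s t : marked tau.

(** The embeddings of [s] have a limit [g] along a subsequence, with the same range as [f] because
    the images approach each other. Then [g] followed by the inverse of [f] is the isometry, and
    embedding-continuity matches the elements. *)
Lemma marked_cvg_cst s t : marked_cvg (fun _ => s) t -> marked_equiv s t.
Proof.
move=> [Z [f_ [f [rf_ rf nf cf]]]].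
have [n_ [g [nk gP]]] := isoemb_extract rf_.
have n_oo : n_ @ \oo --> \oo.
  by move=> A [N _ NA]; exists N => // k Nk; apply: NA; exact: leq_trans (nk k).
have n_near e : 0 < e -> \forall k \near \oo, near_pts (Defs.root s) (Defs.root t)
    (fun x y => mdist (f_ (n_ k) x) (f y)) e.
  by move=> e0; exact: (n_oo _ (nf e e0)).
have fg : forall x, exists y, f y = g x.
  move=> x; have /isoemb_range_closed : closure (range f) (g x).
    move=> B /metricType_numDomainType.nbhs_mdistP[e /= e0 eB].
    have e20 : 0 < e / 2 by rewrite divr_gt0.
    pose d := Num.min (e / 2) (mdist (Defs.root s) x + 1)^-1.
    have r0 : 0 < mdist (Defs.root s) x + 1 by rewrite ltr_wpDl ?mdist_ge0.
    have d0 : 0 < d by rewrite lt_min e20 invr_gt0.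
    have de : d <= e / 2 by rewrite ge_min lexx.
    have dr : mdist (Defs.root s) x <= d^-1.
      apply: (@le_trans _ _ (mdist (Defs.root s) x + 1)); first by lra.
      by rewrite -[leLHS]invrK lef_pV2 ?posrE ?invr_gt0// ge_min lexx orbT.
    have [k [/= nn gk]] := filter_ex (filterI (n_near _ d0) (gP (mdist (Defs.root s) x) _ e20)).
    have [y xy] := nn.1 x dr; exists (f y); split; first by exists y.
    apply: eB; apply: le_lt_trans (metric_triangle _ (f_ (n_ k) x) _) _.
    by have := gk x (lexx _); lra.
  by move=> [y _ yx]; exists y.
have gf : forall y, exists x, f y = g x.
  move=> y; have /isoemb_range_closed : closure (range g) (f y).
    move=> B /metricType_numDomainType.nbhs_mdistP[e /= e0 eB].
    have e20 : 0 < e / 2 by rewrite divr_gt0.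
    pose d := Num.min (e / 2) (mdist (Defs.root t) y + 1)^-1.
    have r0 : 0 < mdist (Defs.root t) y + 1 by rewrite ltr_wpDl ?mdist_ge0.
    have d0 : 0 < d by rewrite lt_min e20 invr_gt0.
    have de : d <= e / 2 by rewrite ge_min lexx.
    have dr : mdist (Defs.root t) y <= d^-1.
      apply: (@le_trans _ _ (mdist (Defs.root t) y + 1)); first by lra.
      by rewrite -[leLHS]invrK lef_pV2 ?posrE ?invr_gt0// ge_min lexx orbT.
    (* The partner [x] of [y] may lie farther from the root than [y], so [g] is approximated on a
       ball enlarged by [e]. *)
    have [k [/= nn gk]] := filter_ex (filterI (n_near _ d0)
      (gP (mdist (Defs.root t) y + e) _ e20)).
    have [x xy] := nn.2 y dr; exists (g x); split; first by exists x.
    apply: eB; rewrite /= metric_sym.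
    apply: le_lt_trans (metric_triangle _ (f_ (n_ k) x) _) _.
    suff : mdist (g x) (f_ (n_ k) x) < e / 2 by lra.
    apply: gk; rewrite -(isoembP (f_ (n_ k))) rf_ -rf.
    have := metric_triangle (f (Defs.root t)) (f y) (f_ (n_ k) x).
    by rewrite isoembP (metric_sym (f y)); lra.
  by move=> [x _ xy]; exists x.
have [h hP] := choice fg; have [h' h'P] := choice gf.
have h_isom x y : mdist (h x) (h y) = mdist x y.
  by rewrite -(isoembP f) !hP isoembP.
exists (Isoemb h_isom); split.
- exists h' => [x|y] /=.
    by apply: (isoemb_inj (f := g)); rewrite -h'P hP.
  by apply: (isoemb_inj (f := f)); rewrite hP -h'P.
- apply: (isoemb_inj (f := f)); rewrite /= hP rf.
  apply: mdist_positivity; apply/eqP; rewrite eq_le mdist_ge0 andbT.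
  apply/ler_addgt0Pr => e e0; rewrite add0r.
  have [k _ /(_ k (leqnn k)) gk] := gP (mdist (Defs.root s) (Defs.root s)) e e0.
  by have := gk _ (lexx _); rewrite rf_ => /ltW.
have [finj _ _] := gh_embedding tau f.
apply: finj; rewrite -gh_comp.
have -> : comp_emb f (Isoemb h_isom) = g by apply: isoemb_ext => x /=; exact: hP.
have c1 : gh_map (f_ (n_ k)) (mk_elt s) @[k --> \oo] --> gh_map f (mk_elt t).
  exact: (cvg_comp _ _ n_oo cf).
have c2 : gh_map (f_ (n_ k)) (mk_elt s) @[k --> \oo] --> gh_map g (mk_elt s).
  by apply: (tau_cont (f_ := fun k => f_ (n_ k))); exact: (family_compact_cvg gP).
exact: (cvg_unique (metrizable_hausdorff (gh_metrizable tau Z)) c2 c1).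
Qed.

End arzela.

(** * Completeness *)

Section dyadic.
Context {R : realType}.

Definition halfpow (k : nat) : R := 2^-1 ^+ k.

Lemma halfpow_gt0 k : 0 < halfpow k.
Proof. by rewrite exprn_gt0// invr_gt0. Qed.

Lemma halfpowS k : halfpow k.+1 = halfpow k / 2.
Proof. by rewrite /halfpow exprSr. Qed.

Lemma halfpow_le k m : (k <= m)%N -> halfpow m <= halfpow k.
Proof.
elim: m => [|m IH]; rewrite leq_eqVlt => /orP[/eqP ->//|//].
by rewrite ltnS => /IH; rewrite halfpowS; have := halfpow_gt0 m; lra.
Qed.

Lemma halfpow_le1 k : halfpow k <= 1.
Proof. exact: halfpow_le (leq0n k). Qed.

Lemma halfpow_near (e : R) : 0 < e -> \forall k \near \oo, halfpow k < e.
Proof.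
move=> e0; apply: filterS (near_invS e0) => k; apply: le_lt_trans.
rewrite /halfpow exprVn lef_pV2 ?posrE ?exprn_gt0// -natrX ler_nat.
exact: ltn_expl.
Qed.

Lemma halfpowV_near (b : R) : \forall k \near \oo, b <= (halfpow k.+1)^-1.
Proof.
have b0 : 0 < (`|b| + 1)^-1 by rewrite invr_gt0 ltr_wpDl.
apply: filterS (halfpow_near b0) => k kb.
apply: (@le_trans _ _ (`|b| + 1)); first by have := ler_norm b; lra.
rewrite -[leLHS]invrK lef_pV2 ?posrE ?halfpow_gt0//.
by rewrite halfpowS; have := halfpow_gt0 k; lra.
Qed.

End dyadic.

Section walks.
Context {R : realType} {X_ : nat -> rbcm R} {M : metricType R}.
Variables (F_ : forall k, X_ k -> M) (p : M).
Hypothesis F_isom : forall k (x y : X_ k), mdist (F_ x) (F_ y) = mdist x y.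
Hypothesis F_root : forall k, F_ (Defs.root (X_ k)) = p.
Hypothesis F_near : forall k, near_pts (Defs.root (X_ k)) (Defs.root (X_ k.+1))
  (fun x y => mdist (F_ x) (F_ y)) (halfpow k.+1).

Let radius_le k m : (k <= m)%N -> (halfpow k.+1 : R)^-1 <= (halfpow m.+1)^-1.
Proof. by move=> km; rewrite lef_pV2 ?posrE ?halfpow_gt0// halfpow_le. Qed.

(** The steps add up to the telescoping sum [halfpow k - halfpow m], at most 1; the summand 1 in the
    hypothesis absorbs this drift, and the admissible radii grow with the level. *)
Lemma walk_up k m (x : X_ k) : (k <= m)%N ->
  mdist p (F_ x) + 1 <= (halfpow k.+1)^-1 ->
  exists y : X_ m, mdist (F_ x) (F_ y) <= halfpow k - halfpow m.
Proof.
move=> + hx; elim: m => [|m IH]; rewrite leq_eqVlt => /orP[/eqP km|//].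
- by subst k; exists x; rewrite mdistxx subrr.
- by subst k; exists x; rewrite mdistxx subrr.
rewrite ltnS => km; have [y xy] := IH km.
have hk := halfpow_le1 (R := R) k; have hm := halfpow_gt0 (R := R) m.
have [|z yz] := (F_near m).1 y.
  rewrite -F_isom F_root (le_trans (metric_triangle _ (F_ x) _))//.
  by rewrite (le_trans _ (radius_le km))//; lra.
exists z; have := metric_triangle (F_ x) (F_ y) (F_ z); rewrite halfpowS in yz *; lra.
Qed.

(** Downwards the admissible radii shrink, so the condition is imposed for the smallest one, that of
    level [k]. *)
Lemma walk_down k m (x : X_ m) : (k <= m)%N ->
  mdist p (F_ x) + (halfpow k - halfpow m) <= (halfpow k.+1)^-1 ->
  exists y : X_ k, mdist (F_ x) (F_ y) <= halfpow k - halfpow m.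
Proof.
elim: m x => [|m IH] x; rewrite leq_eqVlt => /orP[/eqP km|//].
- by subst k; exists x; rewrite mdistxx subrr.
- by subst k; exists x; rewrite mdistxx subrr.
rewrite ltnS => km hx.
have hk := halfpow_le (R := R) km; have hm := halfpow_gt0 (R := R) m.
have [|y yx] := (F_near m).2 x.
  rewrite -F_isom F_root (le_trans _ (radius_le km))//.
  by rewrite halfpowS in hx; lra.
rewrite halfpowS in hx yx *.
have xy := metric_sym (F_ x) (F_ y).
have [|z yz] := IH y km.
  by have := metric_triangle p (F_ x) (F_ y); lra.
by exists z; have := metric_triangle (F_ x) (F_ y) (F_ z); lra.
Qed.

End walks.

Section completeness.
Context {R : realType} {tau : gh_structure R}.
Variable S : srm tau.
Hypothesis tau_usc : upper_semicontinuous tau.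
Hypothesis S_complete : complete_srm S.
Implicit Types s t u : marked tau.

Lemma summable_marked_cvg (v : nat -> marked tau) :
  (forall k, rdist S (v k) (v k.+1) < halfpow k.+1) -> exists l, marked_cvg v l.
Proof.
move=> vP.
have /dep_choice[sp spP] : forall k, exists sp : rspan (v k) (v k.+1),
    near_span sp (halfpow k.+1) /\ span_dist S sp <= halfpow k.+1.
  move=> k; have [_ [|//]] := rdist_lt (vP k).
  by rewrite halfpowS; have := halfpow_le1 (R := R) k; lra.
pose c k := emb_coupling (rspan_l (sp k)) (rspan_r (sp k)).
have c_root k : c k (Defs.root (v k)) (Defs.root (v k.+1)) = 0.
  by rewrite /= rspan_lP rspan_rP mdistxx.
have [|Z [F_ FP]] := @chain_bcm_ex R v c 0 (Defs.root (v 0)).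
  have pt_root k : chain_pt c (Defs.root (v k)) = chain_pt c (Defs.root (v 0)).
    elim: k => // k <-; apply: mdist_positivity.
    by rewrite metric_sym chain_pt_cpl c_root.
  have pt_near k : near_pts (Defs.root (v k)) (Defs.root (v k.+1))
      (fun x y => mdist (chain_pt c x) (chain_pt c y)) (halfpow k.+1).
    rewrite (_ : (fun _ _ => _) = c k); first exact: (spP k).1.
    by do 2 apply/funext => ?; rewrite chain_pt_cpl.
  move=> r e e0.
  (* From all levels beyond [N] the points of the ball of radius [r] can be walked down to level [N]
     at a cost below [e], which is the bound on levels that compactness requires. *)
  have [N [/= Ne Nr]] := filter_ex (filterI (halfpow_near e0) (halfpowV_near (r + 1))).
  exists N => n x x0x.
  have [nN|/ltnW Nn] := leqP n N; first by exists n, x; rewrite mdistxx ltW.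
  have := @walk_down R v _ (fun k => @chain_pt R v c k) _ (@chain_pt_isom R v c) pt_root
    pt_near N n x Nn.
  have hN := halfpow_le1 (R := R) N; have hn := halfpow_gt0 (R := R) n.
  case=> [|y xy]; first by lra.
  by exists N, y; split => //; rewrite metric_sym; lra.
pose z0 := F_ 0%N (Defs.root (v 0)).
have F_root k : F_ k (Defs.root (v k)) = z0.
  elim: k => // k <-; apply: mdist_positivity.
  by rewrite metric_sym FP c_root.
have F_isom k (x y : v k) : mdist (F_ k x) (F_ k y) = mdist x y by exact: isoembP.
have F_near k : near_pts (Defs.root (v k)) (Defs.root (v k.+1))
    (fun x y => mdist (F_ k x) (F_ k.+1 y)) (halfpow k.+1).
  rewrite (_ : (fun _ _ => _) = c k); first exact: (spP k).1.
  by do 2 apply/funext => ?; rewrite FP.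
have up := @walk_up R v _ F_ z0 F_isom F_root F_near.
have down := @walk_down R v _ F_ z0 F_isom F_root F_near.
pose W := Rbcm z0.
have rF k : @root_preserving R (v k) W (F_ k) by exact: F_root.
pose a_ k : tau W := gh_map (F_ k) (mk_elt (v k)).
have dW := srm_induces S W.
have a_step k : srm_dist S (a_ k) (a_ k.+1) <= halfpow k.+1.
  apply: le_trans (spP k).2; rewrite /span_dist.
  by rewrite (srm_transport S _ _ (rF k) (rF k.+1) (rspan_lP (sp k)) (rspan_rP (sp k)) (FP k)).
have a_cauchy k m : (k <= m)%N -> srm_dist S (a_ k) (a_ m) <= halfpow k - halfpow m.
  elim: m => [|m IH]; rewrite leq_eqVlt => /orP[/eqP ->|//]; rewrite ?srm_distxx ?subrr//.
  rewrite ltnS => /IH km; have := dist_triangle dW.1 (a_ m) (a_ k) (a_ m.+1).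
  by have := a_step m; rewrite halfpowS; lra.
have [a aP] : exists a : tau W, a_ n @[n --> \oo] --> a.
  have [e e0|a aP] := @S_complete W a_.
    have [N _ NP] := halfpow_near e0.
    exists ([set n | (N <= n)%N], [set n | (N <= n)%N]); first by split; exists N.
    move=> [m n] /= [Nm Nn]; wlog mn : m n Nm Nn / (m <= n)%N.
      move=> wh; have [|/ltnW nm] := leqP m n; first exact: wh.
      by rewrite (dist_sym dW.1); exact: wh.
    have := a_cauchy m n mn; have := NP m Nm; have := halfpow_gt0 (R := R) n.
    by rewrite /=; lra.
  exists a; apply/(induces_cvg dW) => e e0; apply: filterS (aP e e0) => n.
  by rewrite (dist_sym dW.1).
(* The lower limit of the images: its points are approached by all late spaces. It is the underlying
   set of the limit space. *)
pose L : set Z := [set z | forall e : R, 0 < e ->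
  \forall n \near \oo, exists x : v n, mdist z (F_ n x) <= e].
have Lz0 : L z0.
  move=> e e0; apply: (@near_oo_lt 0) => n _.
  by exists (Defs.root (v n)); rewrite F_root mdistxx ltW.
have L0 : L !=set0 by exists z0.
have cL : closed L.
  move=> z clz e e0; have e20 : 0 < e / 2 by rewrite divr_gt0.
  have [w [Lw]] := clz _ (nbhsx_ballx z (e / 2) e20); rewrite ballEmdist /= => zw.
  apply: filterS (Lw _ e20) => n [x wx]; exists x.
  by have := metric_triangle z w (F_ n x); lra.
pose X := sub_bcm L0 cL; pose i : isoemb X Z := sub_incl L0 cL.
pose x0 : X := exist _ z0 Lz0.
have F_i_near e : 0 < e -> \forall n \near \oo,
    near_pts (Defs.root (v n)) x0 (fun x y => mdist (F_ n x) (i y)) e.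
  move=> e0; have e20 : 0 < e / 2 by rewrite divr_gt0.
  have ei : 0 < e^-1 by rewrite invr_gt0.
  apply: filterS2 (halfpow_near e20) (halfpowV_near (e^-1 + e + 2)) => k ke kr.
  have hk := halfpow_le1 (R := R) k; have hk0 := halfpow_gt0 (R := R) k.
  split=> [x hx|[z Lz] hz].
    have zx : mdist z0 (F_ k x) <= e^-1 by rewrite -(F_root k) F_isom.
    (* Points reached from [x] at each later level, chosen independently. They stay within
       [halfpow k] of [x], so they cluster at some [z], the partner of [x]; below level [k] the root
       is a dummy. *)
    have /dep_choice[y yP] : forall m, exists y : v m,
        (k <= m)%N -> mdist (F_ k x) (F_ m y) <= halfpow k - halfpow m.
      move=> m; have [km|mk] := leqP k m; last by exists (Defs.root (v m)).
      by have [|y xy] := up k m x km; [lra|exists y].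
    have yD : ((fun m => F_ m (y m)) @ \oo) (Dball (F_ k x) (halfpow k)).
      exists k => // m /= km; rewrite /Dball /= (le_trans (yP m km))//.
      by rewrite gerBl ltW// halfpow_gt0.
    have [z [Dz clz]] := bcm_compact (fmap_proper_filter _ _) yD.
    (* One point [F_ m (y m)] near [z] with [m] large is enough: walking up from it reaches every
       level [n >= m] at a cost below [d / 2]. *)
    have Lz : L z.
      move=> d d0; have d20 : 0 < d / 2 by rewrite divr_gt0.
      have [m0 [/= m0k m0d m0r]] : exists m0, [/\ (k <= m0)%N,
          (forall m, (m0 <= m)%N -> halfpow m < d / 2) &
          (forall m, (m0 <= m)%N -> e^-1 + 2 <= (halfpow m.+1)^-1)].
        have [N1 _ N1P] := halfpow_near d20; have [N2 _ N2P] := halfpowV_near (e^-1 + 2).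
        exists (k + (N1 + N2))%N; split; first exact: leq_addr.
          by move=> m hm; apply: N1P; apply: leq_trans hm; rewrite addnCA leq_addr.
        by move=> m hm; apply: N2P; apply: leq_trans hm; rewrite addnA leq_addl.
      have tail : ((fun m => F_ m (y m)) @ \oo)
          [set w | exists2 m, (m0 <= m)%N & w = F_ m (y m)].
        by exists m0 => // m hm; exists m.
      have [w [[m hm ->]]] := clz _ _ tail (nbhsx_ballx z (d / 2) d20).
      rewrite ballEmdist /= => zm; exists m => // n /= mn.
      have xm := yP m (leq_trans m0k hm).
      have [|y' yy'] := up m n (y m) mn.
        have := metric_triangle z0 (F_ k x) (F_ m (y m)); have := m0r m hm.
        by have := halfpow_gt0 (R := R) m; lra.
      exists y'; have := metric_triangle z (F_ m (y m)) (F_ n y').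
      by have := m0d m hm; have := halfpow_gt0 (R := R) n; lra.
    by exists (exist _ z Lz); rewrite /= (le_trans Dz)//; lra.
  (* Conversely, a point of [L] is approximated at a level above [k], and the approximating point is
     walked down to level [k]. *)
  have [N _ NP] := Lz _ e20.
  have [x zx] := NP (k + N)%N (leq_addl _ _).
  have kN : (k <= k + N)%N by exact: leq_addr.
  have hz' : mdist z0 z <= e^-1 by exact: hz.
  have hn := halfpow_gt0 (R := R) (k + N).
  have [|y xy] := down k (k + N)%N x kN.
    by have := metric_triangle z0 z (F_ (k + N)%N x); lra.
  exists y; rewrite /= metric_sym.
  by have := metric_triangle z (F_ (k + N)%N x) (F_ k y); lra.
have fell : closed_image (F_ n) @[n --> \oo] --> closed_image i.
  exact: (near_fell (x_ := fun n => Defs.root (v n)) (x0 := x0)).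
have [b ba] := tau_usc fell aP.
exists (@Marked R tau (@Rbcm R X x0) b), W, F_, i; split => //.
by rewrite ba.
Qed.

Lemma rdist_complete : metric_complete (rdist S).
Proof.
move=> u uC.
have /choice[N NP] : forall k, exists N, forall m n, (N <= m)%N -> (N <= n)%N ->
    rdist S (u m) (u n) < halfpow k.+1.
  move=> k; have [[A B] [[N1 _ NA] [N2 _ NB]] AB] := uC _ (halfpow_gt0 k.+1).
  exists (maxn N1 N2) => m n; rewrite !geq_max => /andP[m1 m2] /andP[n1 n2].
  by apply: (AB (m, n)); split; [exact: NA|exact: NB].
(* The running maximum makes [n_ m] admissible for every [N k] with [k <= m], so consecutive terms
   of the subsequence are close. *)
pose n_ k := (\max_(i < k.+1) N i)%N.
have Nn k m : (k <= m)%N -> (N k <= n_ m)%N.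
  by rewrite -ltnS => km; exact: (leq_bigmax (Ordinal km)).
have [|l vl] := @summable_marked_cvg (fun k => u (n_ k)).
  by move=> k; apply: NP; exact: Nn.
exists l => e e0; have e20 : 0 < e / 2 by rewrite divr_gt0.
move/(rdist_cvg S)/(_ _ e20) : vl => vl.
have [k [/= ke kl]] := filter_ex (filterI (halfpow_near e20) vl).
exists (N k) => // n /= kn; apply: le_lt_trans (rdist_triangle S (u (n_ k)) _ _) _.
have := NP k n (n_ k) kn (Nn k k (leqnn k)).
by rewrite halfpowS; have := halfpow_gt0 (R := R) k; lra.
Qed.

End completeness.

(** * Separability *)

Section separability.
Context {R : realType}.

(* A code [(k, m, D)] records, up to precision [1 / (k + 1)], the distances
   between the points of a [1 / (k + 1)]-net of the ball of radius [k]. *)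
Definition has_code (X : rbcm R) (c : nat * nat * seq (seq nat)) : Prop :=
  let: (k, m, D) := c in
  exists p : nat -> X, [/\ p 0%N = Defs.root X,
    forall x, mdist (Defs.root X) x <= k%:R ->
      exists2 i, (i < m.+1)%N & mdist x (p i) <= k.+1%:R^-1 &
    D = [seq [seq Num.truncn (k.+1%:R * mdist (p i) (p j)) | j <- iota 0 m.+1]
         | i <- iota 0 m.+1]].

Lemma has_code_ex (X : rbcm R) k : exists m D, has_code X (k, m, D).
Proof.
have k0 : 0 < k.+1%:R^-1 :> R by rewrite invr_gt0.
have [s [_ sP]] := compact_net (@bcm_compact R X (Defs.root X) k%:R) k0.
exists (size s); eexists; exists (nth (Defs.root X) (Defs.root X :: s)); split => //.
move=> x /sP[z zs zx]; exists (index z s).+1; first by rewrite ltnS index_mem.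
by rewrite /= nth_index// metric_sym ltW.
Qed.

Lemma truncn_close (a b c : R) : 0 < c -> 0 <= a -> 0 <= b ->
  Num.truncn (c * a) = Num.truncn (c * b) -> a <= b + c^-1.
Proof.
move=> c0 a0 b0 ab; have ca : 0 <= c * a by rewrite mulr_ge0// ltW.
have cb : 0 <= c * b by rewrite mulr_ge0// ltW.
have /andP[_ h1] := truncn_itv ca; have /andP[h2 _] := truncn_itv cb.
rewrite ab -natr1 in h1.
rewrite -(ler_pM2l c0) mulrDr divff ?lt0r_neq0//; lra.
Qed.

Section net_coupling.
Context {X Y : metricType R} {m : nat} (p : 'I_m.+1 -> X) (q : 'I_m.+1 -> Y) (e : R).
Hypothesis e0 : 0 <= e.
Hypothesis pq : forall i j, mdist (p i) (p j) <= mdist (q i) (q j) + e.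
Hypothesis qp : forall i j, mdist (q i) (q j) <= mdist (p i) (p j) + e.
(** Paths jump from some [p i] to [q i] at cost [e]. The distances of the two nets differ by at most
    [e], so returning through another index makes no shortcut. *)
Let g (x : X) (y : Y) (i : 'I_m.+1) : R := mdist x (p i) + e + mdist (q i) y.
Let c (x : X) (y : Y) : R := inf_fun (g x y).

Let c_le x y i : c x y <= g x y i.
Proof. by apply: inf_fun_le => j; rewrite /g !addr_ge0// mdist_ge0. Qed.

Lemma net_lipl x' x y : c x y <= mdist x x' + c x' y.
Proof.
rewrite -lerBlDl; apply: (le_inf_fun ord0) => i; rewrite lerBlDl.
by apply: le_trans (c_le x y i) _; rewrite /g; have := metric_triangle x x' (p i); lra.
Qed.

Lemma net_lipr y' x y : c x y <= c x y' + mdist y' y.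
Proof.
rewrite -lerBlDr; apply: (le_inf_fun ord0) => i; rewrite lerBlDr.
by apply: le_trans (c_le x y i) _; rewrite /g; have := metric_triangle (q i) y' y; lra.
Qed.

Lemma net_distl y x x' : mdist x x' <= c x y + c x' y.
Proof.
apply: (le_inf_funD ord0 ord0) => i j; rewrite /g.
have := metric_triangle x (p i) x'; have := metric_triangle (p i) (p j) x'.
have := metric_triangle (q i) y (q j); have := pq i j; have := e0.
by rewrite (metric_sym x' (p j)) (metric_sym (q j) y); lra.
Qed.

Lemma net_distr x y y' : mdist y y' <= c x y + c x y'.
Proof.
apply: (le_inf_funD ord0 ord0) => i j; rewrite /g.
have := metric_triangle y (q i) y'; have := metric_triangle (q i) (q j) y'.
have := metric_triangle (p i) x (p j); have := qp i j; have := e0.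
by rewrite (metric_sym y (q i)) (metric_sym (p i) x); lra.
Qed.

Definition net_coupling : coupling X Y :=
  Coupling net_lipl net_lipr net_distl net_distr.

Lemma net_coupling_le x y i :
  net_coupling x y <= mdist x (p i) + e + mdist (q i) y.
Proof. exact: c_le. Qed.

End net_coupling.

(** Net precision and jump cost give [2 / (k + 1)], doubled by [redirect] when it identifies the
    roots. The condition [0 < k] keeps the radius [(k + 1) / 2] within the ball of radius [k]
    covered by the nets. *)
Lemma same_code_span (X Y : rbcm R) k m D : (0 < k)%N ->
  has_code X (k, m, D) -> has_code Y (k, m, D) ->
  exists sp : rspan X Y, near_span sp (2 / k.+1%:R *+ 2).
Proof.
move=> k0 [p [p0 pnet ->]] [q [q0 qnet Dq]].
have e0 : 0 < k.+1%:R^-1 :> R by rewrite invr_gt0.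
have tr i j : (i < m.+1)%N -> (j < m.+1)%N ->
    Num.truncn (k.+1%:R * mdist (p i) (p j)) = Num.truncn (k.+1%:R * mdist (q i) (q j)).
  move=> im jm; have := congr1 (fun s => nth 0%N (nth [::] s i) j) Dq.
  rewrite !(nth_map 0%N [::]) ?size_iota//.
  by rewrite !(nth_map 0%N 0%N) ?size_iota// !nth_iota// !add0n.
have pq (i j : 'I_m.+1) : mdist (p i) (p j) <= mdist (q i) (q j) + k.+1%:R^-1.
  by apply: truncn_close; rewrite ?mdist_ge0 ?tr.
have qp (i j : 'I_m.+1) : mdist (q i) (q j) <= mdist (p i) (p j) + k.+1%:R^-1.
  by apply: truncn_close; rewrite ?mdist_ge0 ?tr.
pose c := net_coupling (ltW e0) pq qp.
have c_root : c (Defs.root X) (Defs.root Y) <= 2 / k.+1%:R.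
  apply: le_trans (net_coupling_le (ltW e0) pq qp _ _ ord0) _.
  by rewrite p0 q0 !mdistxx add0r addr0 ler_pMl// ler1n.
have ek : (2 / k.+1%:R)^-1 <= k%:R :> R.
  rewrite invf_div ler_pdivrMr// -natrM ler_nat; lia.
have c_near : near_pts (Defs.root X) (Defs.root Y) c (2 / k.+1%:R).
  split=> [x hx|y hy].
    have [i im xi] := pnet x (le_trans hx ek); exists (q i).
    apply: le_trans (net_coupling_le (ltW e0) pq qp _ _ (Ordinal im)) _.
    by rewrite /= mdistxx addr0 mulrDl !mul1r lerD2r.
  have [i im yi] := qnet y (le_trans hy ek); exists (p i).
  apply: le_trans (net_coupling_le (ltW e0) pq qp _ _ (Ordinal im)) _.
  by rewrite /= mdistxx add0r mulrDl !mul1r lerD2l metric_sym.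
have [sp spP] := coupling_rspan (redirect_root c (Defs.root X) (Defs.root Y)).
exists sp; rewrite /near_span (_ : (fun _ _ => _) = redirect c (Defs.root X) (Defs.root Y)).
  by apply: redirect_near => //; rewrite divr_gt0.
by do 2 apply/funext => ?; rewrite spP.
Qed.

Context {tau : gh_structure R}.
Variable S : srm tau.
Hypothesis tau_lsc : Defs.lower_semicontinuous tau.
Hypothesis tau_sep : separable_structure tau.
Implicit Types s t : marked tau.

Lemma rdist_separable s0 : exists v : nat -> marked tau,
  forall s (e : R), 0 < e -> exists n, rdist S (v n) s < e.
Proof.
have /choice[X XP] : forall n : nat, exists X : rbcm R,
    forall c, unpickle n = Some c -> (exists Y : rbcm R, has_code Y c) -> has_code X c.
  move=> n; case nc : (unpickle n) => [c|]; last by exists s0.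
  have [[Y Yc]|nY] := pselect (exists Y : rbcm R, has_code Y c).
    by exists Y => _ [<-].
  by exists s0 => _ [<-] /nY.
have /choice[b bP] : forall n : nat, exists b : nat -> marked tau,
    forall U : set (tau (X n)), open U -> U !=set0 ->
      exists j a, U a /\ b j = @Marked R tau (X n) a.
  move=> n; have [D /countable_injP[f fD] dD] := tau_sep (X n).
  have /choice[b bP] : forall j : nat, exists t : marked tau,
      forall a, D a -> f a = j -> t = @Marked R tau (X n) a.
    move=> j; have [[a [Da fa]]|na] := pselect (exists a, D a /\ f a = j).
      exists (@Marked R tau (X n) a) => a' Da' fa'; congr Marked.
      by apply: fD; rewrite ?inE// fa fa'.
    by exists s0 => a Da fa; exfalso; apply: na; exists a.
  exists b => U oU U0; have [a [Ua Da]] := dD U U0 oU.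
  by exists (f a), a; split => //; exact: bP.
exists (fun N => if unpickle N is Some (n, j) then b n j else s0) => s e e0.
have /choice[c cP] : forall k : nat, exists c : nat * seq (seq nat),
    has_code s (k, c.1, c.2).
  by move=> k; have [m [D h]] := has_code_ex s k; exists (m, D).
pose n_ k := pickle (k, (c k).1, (c k).2).
have Xc k : has_code (X (n_ k)) (k, (c k).1, (c k).2).
  by apply: XP; [exact: pickleK|exists s; exact: cP].
have /dep_choice[sp spP] : forall k, exists sp : rspan (X (n_ k)) s,
    (0 < k)%N -> near_span sp (2 / k.+1%:R *+ 2).
  move=> k; have [k0|] := ltnP 0 k; last by have [sp _] := rspan_ex (X (n_ k)) s; exists sp.
  by have [sp spk] := same_code_span k0 (Xc k) (cP k); exists sp.
have sp_near d : 0 < d -> \forall k \near \oo, near_span (sp k) d.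
  move=> d0; have d40 : 0 < d / 4 by rewrite divr_gt0.
  have k0 : \forall k \near \oo, (0 < k)%N by exists 1%N.
  apply: filterS2 (near_invS d40) k0 => k kd k1; apply: near_pts_le (spP k k1).
    by rewrite pmulrn_rgt0// divr_gt0.
  by move: kd; set i := k.+1%:R^-1; rewrite mulr2n; lra.
have [Z [f_ [f [rf_ rf fP]]]] := rspan_common sp_near.
have f_near d : 0 < d -> \forall k \near \oo, near_pts (Defs.root (X (n_ k)))
    (Defs.root s) (fun x y => mdist (f_ k x) (f y)) d.
  move=> d0; apply: filterS (sp_near d d0) => k; rewrite /near_span.
  rewrite (_ : (fun _ _ => _) = fun x y => mdist (f_ k x) (f y))//.
  by do 2 apply/funext => ?; rewrite fP.
have fell : closed_image (f_ k) @[k --> \oo] --> closed_image f.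
  apply: (near_fell (x_ := fun k => Defs.root (X (n_ k))) (x0 := Defs.root s)) => //.
  by move=> k; rewrite rf rf_.
have [m_ [a_ [m_incr acvg]]] := tau_lsc fell (mk_elt s).
have e20 : 0 < e / 2 by rewrite divr_gt0.
have e40 : 0 < e / 4 by rewrite divr_gt0.
have m_ge k : (k <= m_ k)%N.
  by elim: k => // k IH; apply: leq_ltn_trans IH _; exact: m_incr.
have m_oo : m_ @ \oo --> \oo.
  by move=> A [N _ NA]; exists N => // k Nk; apply: NA; exact: leq_trans (m_ge k).
have dZ := srm_induces S Z.
move/(induces_cvg dZ)/(_ _ e40) : acvg => acvg.
have mnear : \forall k \near \oo, near_pts (Defs.root (X (n_ (m_ k))))
    (Defs.root s) (fun x y => mdist (f_ (m_ k) x) (f y)) (e / 2).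
  exact: (m_oo _ (f_near _ e20)).
have [k [/= kn ka]] := filter_ex (filterI mnear acvg).
have dX := srm_induces S (X (n_ (m_ k))).
have [||j [a' [aa' ba']]] := bP (n_ (m_ k)) [set a' | srm_dist S (a_ k) a' < e / 4].
- apply/dX.2 => x /= ax; exists (e / 4 - srm_dist S (a_ k) x); first by rewrite subr_gt0.
  by move=> y xy; have := dist_triangle dX.1 x (a_ k) y; lra.
- by exists (a_ k); rewrite /= srm_distxx.
exists (pickle (n_ (m_ k), j)); rewrite pickleK ba'.
apply: (@le_lt_trans _ _ (e / 2)); last by lra.
apply: rdist_le; split => //; right; exists (Rspan (rf_ (m_ k)) rf); split => //.
rewrite /span_dist /=.
have := dist_triangle dZ.1 (gh_map (f_ (m_ k)) (a_ k)) (gh_map (f_ (m_ k)) a')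
  (gh_map f (mk_elt s)).
rewrite (srm_map S (rf_ (m_ k))) (dist_sym dX.1 a').
rewrite (dist_sym dZ.1 (gh_map (f_ (m_ k)) (a_ k)) (gh_map f (mk_elt s))).
by rewrite /= in aa'; lra.
Qed.

End separability.

(** * Complete metrizability of G-delta subspaces *)

(* A G-delta subspace [i : M -> T] of a complete space [T] is completely
   metrizable: to the induced distance one adds the oscillations of the inverse
   distances [(radius k x)^-1] to the complement of the [k]-th open set.  The
   axioms of [d] are plain hypotheses because the universe of [pseudometric] is
   bounded by that of metric spaces, too small for a space of triples. *)
Section gdelta.
Context {R : realType} {T M : Type}.
Variables (d : T -> T -> R) (U : nat -> T -> Prop) (i : M -> T).
Hypothesis dxx : forall t, d t t = 0.
Hypothesis d_sym : forall s t, d s t = d t s.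
Hypothesis d_triangle : forall t s u, d s u <= d s t + d t u.
Hypothesis d_complete : metric_complete d.
Hypothesis U_open : forall k, metric_open d (U k).
Hypothesis i_metric : is_metric (fun x y => d (i x) (i y)).
Hypothesis iU : forall k x, U k (i x).
Hypothesis i_onto : forall t, (forall k, U k t) -> exists x, d t (i x) = 0.

Let d_ge0 s t : 0 <= d s t.
Proof. by have := d_triangle t s s; rewrite dxx (d_sym t s); lra. Qed.

(** Capped at 1 so that the supremum exists also when [U k] is the whole space. *)
Let E k t : set R := [set e | 0 <= e <= 1 /\ forall t', d t t' < e -> U k t'].

Let E0 k t : E k t 0.
Proof. by split; rewrite ?lexx ?ler01// => t' /(le_lt_trans (d_ge0 _ _)); rewrite ltxx. Qed.

Let E_sup k t : has_sup (E k t).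
Proof. by split; [exists 0; exact: E0|exists 1 => e [/andP[_ ?] _]]. Qed.

Let radius k t : R := sup (E k t).

Let radius_ub k t e : E k t e -> e <= radius k t.
Proof. by move=> Ee; apply: ub_le_sup => //; case: (E_sup k t). Qed.

Let radius_ge0 k t : 0 <= radius k t.
Proof. exact/radius_ub/E0. Qed.

Let radius_lip k t t' : radius k t <= radius k t' + d t t'.
Proof.
apply: ge_sup; first by exists 0; exact: E0.
move=> e [/andP[e0 e1] eU]; have dtt := d_ge0 t t'.
have [ed|de] := lerP e (d t t'); first by have := radius_ge0 k t'; lra.
rewrite -lerBlDr; apply: radius_ub; split; first by apply/andP; split; lra.
by move=> s ts; apply: eU; have := d_triangle t' t s; lra.
Qed.

Let radius_gt0 k t : U k t -> 0 < radius k t.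
Proof.
move=> Ut; have [e e0 eU] := U_open Ut.
apply: (@lt_le_trans _ _ (Num.min e 1)); first by rewrite lt_min e0 ltr01.
apply: radius_ub; split; first by rewrite ge_min lexx orbT le_min ltW ?ler01.
by move=> t'; rewrite lt_min => /andP[/eU].
Qed.

Let radius_ball k t t' : d t t' < radius k t -> U k t'.
Proof.
move=> dr; have dr0 : 0 < radius k t - d t t' by rewrite subr_gt0.
have [e [_ eU] de] := sup_adherent dr0 (E_sup k t).
by apply: eU; rewrite -/(radius k t) in de; lra.
Qed.

Let phi k x : R := (radius k (i x))^-1.
(** The cap [1 / (k + 1)] leaves finitely many indices to control at a given precision, while a
    value below the cap still bounds the oscillation of [phi k]. *)
Let g k x y : R := Num.min k.+1%:R^-1 `|phi k x - phi k y|.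
Let G x y : R := sup [set g k x y | k in [set: nat]].

Let g_le1 k x y : g k x y <= 1.
Proof. by rewrite ge_min invf_le1// ler1n. Qed.

Let G_ub k x y : g k x y <= G x y.
Proof. by apply: ub_le_sup; [exists 1 => _ [j _ <-]; exact: g_le1|exists k]. Qed.

Let G_le x y c : (forall k, g k x y <= c) -> G x y <= c.
Proof. by move=> gc; apply: ge_sup; [exists (g 0%N x y), 0%N|move=> _ [k _ <-]]. Qed.

Let G_sym x y : G x y = G y x.
Proof. by congr sup; apply: eq_imagel => k _; rewrite /g distrC. Qed.

Let min_triangle (c a b e : R) : 0 <= c -> 0 <= a -> 0 <= b -> e <= a + b ->
  Num.min c e <= Num.min c a + Num.min c b.
Proof.
by move=> c0 a0 b0 eab; case: (leP c a) => ca; case: (leP c b) => cb;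
  rewrite ge_min; apply/orP; first [left; lra|right; lra].
Qed.

Let G_triangle y x z : G x z <= G x y + G y z.
Proof.
apply: G_le => k; apply: (@le_trans _ _ (g k x y + g k y z)); last by rewrite lerD.
by apply: min_triangle; rewrite ?invr_ge0// ler_distD.
Qed.

Let d' x y : R := Num.max (d (i x) (i y)) (G x y).

Let d'_metric : is_metric d'.
Proof.
split.
- by move=> x y; rewrite le_max d_ge0.
- move=> x y; split=> [dxy|->].
    apply/(dist_eq0 i_metric); apply/eqP; rewrite eq_le d_ge0 andbT.
    by rewrite -dxy le_max lexx.
  rewrite /d' dxx; apply/eqP; rewrite eq_le le_max lexx andbT ge_max lexx /=.
  by apply: G_le => k; rewrite /g subrr normr0 ge_min lexx orbT.
- by move=> x y; rewrite /d' d_sym G_sym.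
- move=> y x z; rewrite ge_max; apply/andP; split.
    apply: le_trans (d_triangle (i y) _ _) _.
    by rewrite lerD// le_max lexx.
  by apply: le_trans (G_triangle y x z) _; rewrite lerD// le_max lexx orbT.
Qed.

Let phi_cont k x (e : R) : 0 < e -> exists2 c : R, 0 < c &
  forall y, d (i x) (i y) < c -> `|phi k x - phi k y| < e.
Proof.
move=> e0; have r0 := radius_gt0 (iU k x); set r := radius k (i x) in r0.
have c0 : 0 < Num.min (r / 2) (e * r * r / 4).
  by rewrite lt_min !divr_gt0// !mulr_gt0.
exists (Num.min (r / 2) (e * r * r / 4)) => // y; rewrite lt_min => /andP[h1 h2].
have l1 := radius_lip k (i x) (i y); have l2 := radius_lip k (i y) (i x).
rewrite (d_sym (i y)) in l2.
rewrite /phi -/r in l1 l2 *; set r' := radius k (i y) in l1 l2 *.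
have r'2 : r / 2 < r' by lra.
have r'0 : 0 < r' by lra.
rewrite -[X in `|X - _|]mul1r -[X in `|_ - X|]mul1r -mulNr addf_div ?lt0r_neq0//.
rewrite normrM normfV (gtr0_norm (mulr_gt0 r0 r'0)) ltr_pdivrMr ?mulr_gt0//.
rewrite mul1r mulN1r.
apply: (@lt_le_trans _ _ (e * r * r / 2)).
  apply: (@le_lt_trans _ _ (d (i x) (i y))).
    by rewrite ler_norml; apply/andP; split; lra.
  have e1 : 0 < e * r * r by rewrite !mulr_gt0.
  by lra.
rewrite mulrA -[X in X <= _]mulrA ler_pM2l ?mulr_gt0//; lra.
Qed.

Let d'_small x (e : R) : 0 < e -> exists2 c : R, 0 < c &
  forall y, d (i x) (i y) < c -> d' x y < e.
Proof.
move=> e0; have e20 : 0 < e / 2 by rewrite divr_gt0.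
have [N [_ NP]] : exists N : nat, True /\ forall k, (N <= k)%N -> k.+1%:R^-1 < e / 2.
  by have [N _ NP] := near_invS e20; exists N.
have [c c0 cP] : exists2 c : R, 0 < c &
    forall y, d (i x) (i y) < c -> forall k, (k < N)%N -> `|phi k x - phi k y| < e / 2.
  elim: N {NP} => [|N [c c0 cP]]; first by exists 1.
  have [c' c'0 c'P] := phi_cont N x e20.
  exists (Num.min c c'); first by rewrite lt_min c0.
  move=> y; rewrite lt_min => /andP[yc yc'] k.
  by rewrite ltnS leq_eqVlt => /orP[/eqP ->|kN]; [exact: c'P|exact: cP].
exists (Num.min c e); first by rewrite lt_min c0.
move=> y; rewrite lt_min => /andP[yc ye]; rewrite gt_max ye /=.
apply: (@le_lt_trans _ _ (e / 2)); last by lra.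
apply: G_le => k; rewrite ge_min; have [kN|/NP/ltW ->//] := ltnP k N.
by rewrite (ltW (cP y yc k kN)) orbT.
Qed.

Let d'_complete : metric_complete d'.
Proof.
move=> u uC.
have dd' x y : d (i x) (i y) <= d' x y by rewrite le_max lexx.
have [t tP] : exists t, forall e : R, 0 < e -> \forall n \near \oo, d (i (u n)) t < e.
  apply: (d_complete (u := fun n => i (u n))) => e e0; apply: filterS (uC e e0) => -[m n] /=.
  exact: le_lt_trans.
have [k|x tx] := i_onto (t := t).
  have k0 : 0 < k.+1%:R^-1 :> R by rewrite invr_gt0.
  have [[A B] [[N1 _ NA] [N2 _ NB]] AB] := uC _ k0.
  (* From rank [N] on, [phi k (u n) <= C], so the balls of radius [C^-1] around the terms lie in
     [U k]; one of them contains the limit [t]. *)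
  pose N := maxn N1 N2; pose C := phi k (u N) + 1.
  have C0 : 0 < C by rewrite /C ltr_wpDl// invr_ge0.
  have C0' : 0 < C^-1 by rewrite invr_gt0.
  have [n [/= nt nN]] := filter_ex (filterI (tP _ C0') (nbhs_infty_ge N)).
  apply: (radius_ball (t := i (u n))); apply: lt_le_trans nt _.
  have : d' (u N) (u n) < k.+1%:R^-1.
    apply: (AB (_, _)); split; first by apply: NA; exact: leq_maxl.
    by apply: NB; exact: leq_trans (leq_maxr _ _) nN.
  rewrite gt_max => /andP[_ /(le_lt_trans (G_ub k _ _))].
  rewrite gt_min ltxx /= => phi_lt.
  have k1 : k.+1%:R^-1 <= 1 :> R by rewrite invf_le1// ler1n.
  have : phi k (u n) <= C.
    rewrite /C; move: phi_lt; rewrite ltr_norml => /andP[h _].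
    by move: h k1; set kk := k.+1%:R^-1; lra.
  by move=> h; rewrite -[leRHS]invrK lef_pV2 ?posrE ?invr_gt0 ?radius_gt0.
exists x => e e0; have [c c0 cP] := d'_small x e0.
apply: filterS (tP c c0) => n nt; rewrite (dist_sym d'_metric); apply: cP.
rewrite d_sym; apply: le_lt_trans nt.
by have := d_triangle t (i (u n)) (i x); rewrite tx addr0.
Qed.

Lemma gdelta_completely_metrizable : exists d' : M -> M -> R,
  [/\ is_metric d', metric_complete d' &
   forall V, metric_open (fun x y => d (i x) (i y)) V <-> metric_open d' V].
Proof.
exists d'; split; [exact: d'_metric|exact: d'_complete|].
move=> V; split=> oV x Vx; have [e e0 eV] := oV x Vx.
  exists e => // y xy; apply: eV; apply: le_lt_trans xy.
  by rewrite le_max lexx.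
have [c c0 cP] := d'_small x e0; exists c => // y /cP; exact: eV.
Qed.

End gdelta.

(** * The theorem *)

Lemma metrizable_embedding_cvg (S T : topologicalType) (f : S -> T) (u : nat -> S) x :
  topological_embedding f ->
  (f (u n) @[n --> \oo] --> f x) <-> (u n @[n --> \oo] --> x).
Proof.
move=> [f_inj f_cont f_open]; split=> [fux A|ux]; last exact: (cvg_comp _ _ ux (f_cont x)).
rewrite nbhsE => -[U [oU Ux] UA]; have [V oV fUV] := f_open U oU.
have Vfx : V (f x).
  by have : (f @` U) (f x) by [exists x]; rewrite fUV => -[].
have uV : \forall n \near \oo, V (f (u n)) by exact: fux (open_nbhs_nbhs (conj oV Vfx)).
suff : \forall n \near \oo, A (u n) by [].
apply: filterS uV => n Vfn; apply: UA.
have : (V `&` range f) (f (u n)) by split => //; exists (u n).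
by rewrite -fUV => -[y Uy /f_inj <-].
Qed.

Section assembly.
Context {R : realType} {tau tau' : gh_structure R}.
Variable eta : structure_embedding tau tau'.
Implicit Types (s t : marked tau) (C : Mbullet tau).

Definition eta_marked s : marked tau' := Marked (eta _ (mk_elt s)).

Lemma eta_marked_cvg (s_ : nat -> marked tau) s :
  marked_cvg (eta_marked \o s_) (eta_marked s) <-> marked_cvg s_ s.
Proof.
have key (Z : rbcm R) (f_ : forall n, isoemb (s_ n) Z) (f : isoemb s Z) :
    (gh_map (f_ n) (eta _ (mk_elt (s_ n))) @[n --> \oo] --> gh_map f (eta _ (mk_elt s))) <->
    (gh_map (f_ n) (mk_elt (s_ n)) @[n --> \oo] --> gh_map f (mk_elt s)).
  rewrite -(metrizable_embedding_cvg _ _ (se_embedding eta Z)) se_natural.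
  by under eq_cvg => n do rewrite -se_natural.
by split=> -[Z [f_ [f [rf_ rf nf cf]]]]; exists Z, f_, f; split => //; apply/key.
Qed.

Lemma marked_equiv_refl s : marked_equiv s s.
Proof. by exists (id_emb s); split; [exists id|by []|exact: gh_id]. Qed.

Lemma marked_equiv_inv s t : marked_equiv s t -> marked_equiv t s.
Proof.
move=> [f [[g fK gK] rf fa]].
have g_isom x y : mdist (g x) (g y) = mdist x y by rewrite -(isoembP f) !gK.
exists (Isoemb g_isom); split; first by exists f.
  by rewrite /root_preserving /= -rf fK.
rewrite -fa -gh_comp -[RHS]gh_id; congr gh_map.
by apply: isoemb_ext => x /=; rewrite fK.
Qed.

Lemma marked_equiv_comp s t u : marked_equiv s t -> marked_equiv t u -> marked_equiv s u.
Proof.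
move=> [f [bf rf fa]] [g [bg rg ga]]; exists (comp_emb g f); split.
- exact: bij_comp.
- by rewrite /root_preserving /= rf rg.
- by rewrite gh_comp fa ga.
Qed.

Lemma Mbullet_eq C D : marked_equiv (Mrepr C) (Mrepr D) -> C = D.
Proof.
move=> CD; have eC := projT2 (cid (proj2_sig C)); have eD := projT2 (cid (proj2_sig D)).
apply: eq_sig_hprop => [P|]; first exact: Prop_irrelevance.
rewrite eC eD; apply/funext => t; apply/propext; split => h.
  by apply: marked_equiv_comp h; exact: marked_equiv_inv.
exact: marked_equiv_comp CD h.
Qed.

Lemma Mbullet_onto s : exists C, marked_equiv s (Mrepr C).
Proof.
pose C : Mbullet tau := exist _ (marked_equiv s) (ex_intro _ s erefl).
exists C; have := projT2 (cid (proj2_sig C)) : marked_equiv s = marked_equiv (Mrepr C).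
by move=> ->; exact: marked_equiv_refl.
Qed.

Definition eta_repr C : marked tau' := eta_marked (Mrepr C).

Variable S : srm tau'.

Lemma eta_repr_metric : embedding_continuous tau' ->
  is_metric (fun C D => rdist S (eta_repr C) (eta_repr D)).
Proof.
move=> tau'_cont; split=> [C D|C D|C D|D C B].
- exact: rdist_ge0.
- split=> [CD|->]; last exact: rdistxx.
  (* Distance 0 makes the constant sequence at [C] converge to [D]. The isometry so obtained matches
     the images under [eta], and injectivity of [eta] matches the elements themselves. *)
  apply: Mbullet_eq; have : marked_cvg (fun _ => eta_repr C) (eta_repr D).
    by apply/(rdist_cvg S) => e e0; apply: (@near_oo_lt 0) => n _; rewrite CD.
  move/(marked_cvg_cst tau'_cont) => [f [bf rf fa]]; exists f; split => //.
  have [eta_inj _ _] := se_embedding eta (Mrepr D).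
  by apply: eta_inj; rewrite se_natural.
- exact: rdist_sym.
- exact: rdist_triangle.
Qed.

Lemma eta_repr_cvg (u : nat -> Mbullet tau) C :
  (forall e : R, 0 < e -> \forall n \near \oo, rdist S (eta_repr C) (eta_repr (u n)) < e) <->
  marked_cvg (fun n => Mrepr (u n)) (Mrepr C).
Proof.
rewrite -eta_marked_cvg -(rdist_cvg S).
by split=> h e e0; apply: filterS (h e e0) => n; rewrite rdist_sym.
Qed.

End assembly.

(** A dense sequence of [T] may miss the subspace, so for each pair [(n, k)] a point of [M] within
    [1 / (k + 1)] of [v n] is picked if there is one. The sequence is asked for under an inhabitant
    of [T], which may be empty. *)
Lemma polish_gdelta (R : realType) (T M : Type) (d : T -> T -> R)
    (U : nat -> T -> Prop) (i : M -> T) (O : (M -> Prop) -> Prop) :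
  (forall t, d t t = 0) -> (forall s t, d s t = d t s) ->
  (forall t s u, d s u <= d s t + d t u) ->
  metric_complete d -> (forall k, metric_open d (U k)) ->
  is_metric (fun x y => d (i x) (i y)) -> (forall k x, U k (i x)) ->
  (forall t, (forall k, U k t) -> exists x, d t (i x) = 0) ->
  (T -> exists v : nat -> T, forall t (e : R), 0 < e -> exists n, d (v n) t < e) ->
  (forall V, O V <-> metric_open (fun x y => d (i x) (i y)) V) ->
  polish_topology (R := R) O.
Proof.
move=> dxx d_sym d_triangle dC oU dM iU iO vD OE; split; last first.
  have [d' [d'M d'C d'E]] := gdelta_completely_metrizable dxx d_sym d_triangle dC oU dM iU iO.
  by exists d'; split => // V; rewrite OE.
have [[x0 _]|M0] := pselect (exists x : M, True); last first.
  exists (fun _ => False); split; first by exists (fun _ => 0%N).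
  by move=> V _ [x _]; exfalso; apply: M0; exists x.
have [v vP] := vD (i x0).
have /dep_choice[w wP] : forall N : nat, exists w : M, forall n k : nat,
    unpickle N = Some (n, k) ->
    (exists x, d (v n) (i x) < k.+1%:R^-1) -> d (v n) (i w) < k.+1%:R^-1.
  move=> N; case Nn : (unpickle N) => [[n k]|]; last by exists x0.
  have [[x xP]|nx] := pselect (exists x, d (v n) (i x) < k.+1%:R^-1).
    by exists x => _ _ [<- <-].
  by exists x0 => n' k' [<- <-] /nx.
pose D x := exists N, w N = x.
have /dep_choice[c cP] : forall x, exists N, D x -> w N = x.
  by move=> x; have [[N Nx]|nx] := pselect (D x); [exists N|exists 0%N].
exists D; split; first by exists c => x y /cP {2}<- /cP {2}<- ->.
move=> V /OE oV [x Vx]; have [e e0 eV] := oV x Vx.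
have e20 : 0 < e / 2 by rewrite divr_gt0.
have [k _ /(_ k (leqnn k)) ke] := near_invS e20.
have k0 : 0 < k.+1%:R^-1 :> R by rewrite invr_gt0.
have [n nx] := vP (i x) _ k0.
have := wP (pickle (n, k)) n k (pickleK _) (ex_intro _ x nx) => wx.
exists (w (pickle (n, k))); split; first by exists (pickle (n, k)).
apply: eV; have := d_triangle (v n) (i x) (i (w (pickle (n, k)))).
by rewrite (d_sym (i x) (v n)); move: nx wx ke => /=; set kk := k.+1%:R^-1; lra.
Qed.

Theorem theorem6p48 (R : realType) (tau : gh_structure R)
    (hstable : stably_metrizable tau) (hpolish : polish_preserved_roots tau)
    (E : erm tau) :
  (forall U : Mbullet tau -> Prop,
     open_preserved E U <-> open_nonpreserved E U) /\
  polish_topology (R := R) (open_preserved E).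
Proof.
have [E' E'_stable] := hstable.
have [tau' [eta [tau_ [tau'_cont tau_open tau_range]]]] := hpolish.
have [[tau'_ec tau'_usc tau'_lsc] tau'_sep [S S_complete]] := tau'_cont.
have pres_cvg (u : nat -> Mbullet tau) C :
    (forall e : R, 0 < e -> \forall n \near \oo, dist_preserved E C (u n) < e) <->
    marked_cvg (fun n => Mrepr (u n)) (Mrepr C).
  rewrite -(pre_dist_preserved_cvg E).
  by split=> h e e0; apply: filterS (h e e0) => n; rewrite /dist_preserved pre_dist_preserved_sym.
split=> [U|].
  rewrite /open_preserved /open_nonpreserved !metric_open_seq.
  split=> oU u C UC Cu; apply: (oU u C UC).
    apply/pres_cvg; apply: (pre_dist_nonpreserved_cvg E'_stable (E := E)) => e e0.
    by apply: filterS (Cu e e0) => n; rewrite /dist_nonpreserved pre_dist_nonpreserved_sym.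
  move=> e e0; apply: filterS (Cu e e0) => n; apply: le_lt_trans.
  exact: pre_dist_nonpreserved_le.
apply: (@polish_gdelta R _ _ (rdist S) (fun k t => tau_ k t (mk_elt t)) (eta_repr eta)).
- exact: rdistxx.
- exact: rdist_sym.
- exact: rdist_triangle.
- exact: rdist_complete.
(* In a common space [Z], the set [tau_ k Z] is a neighbourhood of the limit element;
   pullback-stability carries membership from [t] to [Z] and back to [u n]. *)
- move=> k; apply/metric_open_seq => u t tk tu.
  have : marked_cvg u t.
    by apply/(rdist_cvg S) => e e0; apply: filterS (tu e e0) => n; rewrite /= rdist_sym.
  move=> [Z [f_ [f [rf_ rf _ cf]]]]; have [oK pb] := tau_open k.
  have Zk : nbhs (gh_map f (mk_elt t)) (tau_ k Z).
    apply: open_nbhs_nbhs; split; first exact: oK.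
    by rewrite -(pb _ _ f rf) in tk.
  have [n _ /(_ n (leqnn n)) un] := cf _ Zk.
  by exists n; rewrite -(pb _ _ (f_ n) (rf_ n)).
- exact: eta_repr_metric.
- move=> k C; have : range (eta (Mrepr C)) (eta _ (mk_elt (Mrepr C))) by exists (mk_elt (Mrepr C)).
  by rewrite tau_range; apply.
(* An element lying in all the open subsets comes from [tau] through [eta], so the triple is
   equivalent to the image of a class. *)
- move=> t tU; have : (\bigcap_k tau_ k t) (mk_elt t) by move=> k _; exact: tU.
  rewrite -tau_range => -[b _ bt].
  have [C [f [bf rf fa]]] := Mbullet_onto (@Marked R tau t b).
  exists C; apply: marked_equiv_rdist; exists f; split => //.
  by rewrite /eta_repr /= -fa se_natural bt.
- exact: rdist_separable.
(* Both distances have the convergence of triples as their sequential convergence, hence the same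
   open sets. *)
move=> V; rewrite /open_preserved !metric_open_seq.
split=> oV u C VC Cu; apply: (oV u C VC).
  by apply/pres_cvg/(eta_repr_cvg eta S).
by apply/(eta_repr_cvg eta S)/pres_cvg.
Qed.
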